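(* Let $p$ be a prime, let $L$ be a $3$-dimensional $\mathbb{Z}_p$-Lie algebra and let $i\geq 0$ be an integer. If $s\in\mathbb{C}$ is a pole of (the meromorphic continuation of) $\zeta_{p^iL}(s)$, then $$\mathrm{Re}(s)\in\{0,\tfrac12,1,\tfrac32,2\}.$$
   Context: $\mathbb{Z}_p$ is the ring of $p$-adic integers. A $3$-dimensional $\mathbb{Z}_p$-Lie algebra is a Lie algebra over $\mathbb{Z}_p$ that is free of rank $3$ as a $\mathbb{Z}_p$-module. For a $\mathbb{Z}_p$-algebra $L$ additively isomorphic to $\mathbb{Z}_p^n$, the (subalgebra) zeta function is the Dirichlet series $\zeta_L(s)=\sum_{H\le L}|L:H|^{-s}$, where the sum ranges over the $\mathbb{Z}_p$-subalgebras $H$ of finite index in $L$; it is a rational function in $p^{-s}$ and so continues meromorphically to $\mathbb{C}$. $p^iL$ is the Lie subalgebra $p^iL\subseteq L$ with the restricted bracket, considered as a Lie algebra in its own right. *)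

(* Defs.v *)
From HB Require Import structures.
From mathcomp Require Import all_boot all_order all_algebra finmap complex.
From mathcomp Require Import all_classical all_reals all_analysis.
From mathcomp Require summability.

Set Implicit Arguments.
Unset Strict Implicit.
Unset Printing Implicit Defensive.

Import Order.TTheory GRing.Theory Num.Theory numFieldNormedType.Exports.

Local Open Scope classical_set_scope.
Local Open Scope ring_scope.

(* The ring Z_p of p-adic integers, as the inverse limit of the rings         *)
(* Z/p^(n+1)Z, n >= 0. The exponent starts at 1 because 'Z_1 is Z/2Z. Only    *)
(* p >= 2 is meaningful; for p < 2 the type is some other commutative ring.   *)
Definition padic_red (p n : nat) (x : 'Z_(p ^ n.+2)) : 'Z_(p ^ n.+1) :=
  inZp x.

Record padicInt (p : nat) := PadicInt {
  padic_res : forall n, 'Z_(p ^ n.+1);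
  padic_resP : forall n, padic_red (padic_res n.+1) = padic_res n }.

Section PadicRing.
Variable p : nat.
Implicit Types x y z : padicInt p.

Lemma padic_eq x y : (forall n, padic_res x n = padic_res y n) -> x = y.
Proof.
case: x y => [x xP] [y yP] /= exy.
have {}exy : x = y by apply: functional_extensionality_dep.
by case: _ / exy yP => yP; congr PadicInt; apply: Prop_irrelevance.
Qed.

Lemma padic_trunc_dvd n :
  ((Zp_trunc (p ^ n.+1)).+2 %| (Zp_trunc (p ^ n.+2)).+2)%N.
Proof.
case: p => [|[|q]]; first by rewrite !exp0n.
- by rewrite !exp1n.
- by rewrite !Zp_cast ?dvdn_exp2l // -[1%N](expn0 q.+2) ltn_exp2l.
Qed.

Lemma padic_red_is_zmod_morphism n : zmod_morphism (@padic_red p n).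
Proof.
have redD : {morph @padic_red p n : x y / x + y}.
  move=> x y; apply: val_inj.
  by rewrite /= modn_dvdm ?padic_trunc_dvd // modnDm.
by move=> x y; apply: (addIr (padic_red y)); rewrite -redD !subrK.
Qed.

Lemma padic_red_is_monoid_morphism n : monoid_morphism (@padic_red p n).
Proof.
split; first by apply: val_inj; rewrite /= modn_dvdm ?padic_trunc_dvd.
move=> x y; apply: val_inj.
by rewrite /= modn_dvdm ?padic_trunc_dvd // modnMm.
Qed.

HB.instance Definition _ n :=
  GRing.isZmodMorphism.Build _ _ (@padic_red p n) (@padic_red_is_zmod_morphism n).
HB.instance Definition _ n :=
  GRing.isMonoidMorphism.Build _ _ (@padic_red p n)
    (@padic_red_is_monoid_morphism n).

Fact padic_zeroP n : padic_red 0 = 0 :> 'Z_(p ^ n.+1).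
Proof. exact: rmorph0. Qed.
Definition padic_zero := PadicInt padic_zeroP.

Fact padic_oneP n : padic_red 1 = 1 :> 'Z_(p ^ n.+1).
Proof. exact: rmorph1. Qed.
Definition padic_one := PadicInt padic_oneP.

Fact padic_oppP x n : padic_red (- padic_res x n.+1) = - padic_res x n.
Proof. by rewrite rmorphN /= padic_resP. Qed.
Definition padic_opp x := PadicInt (padic_oppP x).

Fact padic_addP x y n :
  padic_red (padic_res x n.+1 + padic_res y n.+1) = padic_res x n + padic_res y n.
Proof. by rewrite rmorphD /= !padic_resP. Qed.
Definition padic_add x y := PadicInt (padic_addP x y).

Fact padic_mulP x y n :
  padic_red (padic_res x n.+1 * padic_res y n.+1) = padic_res x n * padic_res y n.
Proof. by rewrite rmorphM /= !padic_resP. Qed.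
Definition padic_mul x y := PadicInt (padic_mulP x y).

HB.instance Definition _ := gen_eqMixin (padicInt p).
HB.instance Definition _ := gen_choiceMixin (padicInt p).

Fact padic_addA : associative padic_add.
Proof. by move=> x y z; apply: padic_eq => n /=; rewrite addrA. Qed.
Fact padic_addC : commutative padic_add.
Proof. by move=> x y; apply: padic_eq => n /=; rewrite addrC. Qed.
Fact padic_add0 : left_id padic_zero padic_add.
Proof. by move=> x; apply: padic_eq => n /=; rewrite add0r. Qed.
Fact padic_addN : left_inverse padic_zero padic_opp padic_add.
Proof. by move=> x; apply: padic_eq => n /=; rewrite addNr. Qed.

HB.instance Definition _ :=
  GRing.isZmodule.Build (padicInt p) padic_addA padic_addC padic_add0 padic_addN.

Fact padic_mulA : associative padic_mul.
Proof. by move=> x y z; apply: padic_eq => n /=; rewrite mulrA. Qed.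
Fact padic_mulC : commutative padic_mul.
Proof. by move=> x y; apply: padic_eq => n /=; rewrite mulrC. Qed.
Fact padic_mul1 : left_id padic_one padic_mul.
Proof. by move=> x; apply: padic_eq => n /=; rewrite mul1r. Qed.
Fact padic_mulD : left_distributive padic_mul padic_add.
Proof. by move=> x y z; apply: padic_eq => n /=; rewrite mulrDl. Qed.
Fact padic_one_neq0 : padic_one != padic_zero.
Proof.
by apply/eqP => /(congr1 (fun x => padic_res x 0)) /= /eqP; rewrite oner_eq0.
Qed.

HB.instance Definition _ :=
  GRing.Zmodule_isComNzRing.Build (padicInt p)
    padic_mulA padic_mulC padic_mul1 padic_mulD padic_one_neq0.

End PadicRing.

HB.mixin Record Lmodule_isLieAlgebra (K : comNzRingType) L
    of GRing.Lmodule K L := {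
  lie : L -> L -> L;
  lie_linearl : forall y, linear (lie^~ y);
  lie_linearr : forall x, linear (lie x);
  liexx : forall x, lie x x = 0;
  lie_jacobi : forall x y z,
    lie x (lie y z) + lie y (lie z x) + lie z (lie x y) = 0 }.

#[short(type="lieAlgType")]
HB.structure Definition LieAlgebra (K : comNzRingType) :=
  {L of Lmodule_isLieAlgebra K L & GRing.Lmodule K L}.

HB.instance Definition _ (K : comNzRingType) (L : lieAlgType K) (x : L) :=
  GRing.isLinear.Build K L L *:%R (lie x) (lie_linearr x).

Definition free_of_rank (K : comNzRingType) (L : lmodType K) (n : nat) : Prop :=
  exists e : 'I_n -> L,
    forall x : L, exists! c : 'rV[K]_n, x = \sum_i c 0 i *: e i.

(* The Lie algebra aL, with the bracket restricted from L. *)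
Section Multiples.
Variables (K : comNzRingType) (L : lieAlgType K) (a : K).

Definition multiple : {pred L} := fun x => `[< exists y, x = a *: y >].

Fact multiple_submod_closed : submod_closed multiple.
Proof.
split; first by apply/asboolP; exists 0; rewrite scaler0.
move=> b _ _ /asboolP[x ->] /asboolP[y ->]; apply/asboolP.
by exists (b *: x + y); rewrite scalerDr !scalerA mulrC.
Qed.

HB.instance Definition _ :=
  GRing.isSubmodClosed.Build K L multiple multiple_submod_closed.

Definition scaledLie := {x : L | multiple x}.

HB.instance Definition _ := [isSub of scaledLie for @sval L multiple].
HB.instance Definition _ := [Choice of scaledLie by <:].
HB.instance Definition _ := [SubChoice_isSubLmodule of scaledLie by <:].

Fact scaled_lie_subproof (x y : scaledLie) : multiple (lie (\val x) (\val y)).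
Proof.
have /asboolP[z ->] := valP y; apply/asboolP; exists (lie (\val x) z).
exact: linearZ.
Qed.

Definition scaled_lie (x y : scaledLie) : scaledLie :=
  Sub (lie (\val x) (\val y)) (scaled_lie_subproof x y).

Fact scaled_lie_linearl y : linear (scaled_lie^~ y).
Proof. by move=> b u v; apply: val_inj; rewrite /= lie_linearl. Qed.
Fact scaled_lie_linearr x : linear (scaled_lie x).
Proof. by move=> b u v; apply: val_inj; rewrite /= lie_linearr. Qed.
Fact scaled_liexx x : scaled_lie x x = 0.
Proof. by apply: val_inj; rewrite /= liexx. Qed.
Fact scaled_lie_jacobi x y z :
  scaled_lie x (scaled_lie y z) + scaled_lie y (scaled_lie z x) +
  scaled_lie z (scaled_lie x y) = 0.
Proof. by apply: val_inj; rewrite /= lie_jacobi. Qed.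

HB.instance Definition _ :=
  Lmodule_isLieAlgebra.Build K scaledLie scaled_lie_linearl scaled_lie_linearr
    scaled_liexx scaled_lie_jacobi.

End Multiples.

Section Subalgebras.
Variables (K : comNzRingType) (L : lieAlgType K).
Implicit Type H : set L.

Record lie_subalgebra H : Prop := LieSubalgebra {
  lie_subalgebra0 : H 0;
  lie_subalgebraP : forall (c : K) x y, H x -> H y -> H (c *: x + y);
  lie_subalgebra_lie : forall x y, H x -> H y -> H (lie x y) }.

Definition cosets H : set (set L) := [set [set x + h | h in H] | x in setT].

(* |L : H|, meaningful when cosets H is finite. *)
Definition lie_index H : nat := #|` fset_set (cosets H)|.

Definition fin_index_subalgebras : set (set L) :=
  [set H | lie_subalgebra H /\ finite_set (cosets H)].

End Subalgebras.

Section Meromorphic.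
Variable C : numFieldType.
Implicit Types (F : C -> C) (w : C).

(* F has a Laurent expansion \sum_k c_k (z - w)^(k - N) on a punctured disc   *)
(* around w. The value F w is irrelevant.                                     *)
Definition laurent_expansion F w (N : nat) (c : nat -> C) : Prop :=
  exists2 r : C, 0 < r & forall z, 0 < `|z - w| < r ->
    series (fun k => c k * (z - w) ^+ k) @ \oo --> (z - w) ^+ N * F z.

Definition meromorphic F : Prop :=
  forall w, exists N c, laurent_expansion F w N c.

Definition pole F w : Prop :=
  exists N c, [/\ (0 < N)%N, c 0%N != 0 & laurent_expansion F w N c].

End Meromorphic.

Section Zeta.
Variable R : realType.

Definition cexp (z : R[i]) : R[i] :=
  (expR (complex.Re z))%:C%C *
  (cos (complex.Im z) +i* sin (complex.Im z))%C.

(* n ^ s, for n > 0. *)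
Definition nat_cpow (n : nat) (s : R[i]) : R[i] := cexp (s * (ln n%:R)%:C%C).

Section LieZeta.
Variables (K : comNzRingType) (L : lieAlgType K).

Definition zeta_term (s : R[i]) (H : @fin_index_subalgebras K L) : R[i] :=
  nat_cpow (lie_index (\val H)) (- s).

(* The series \sum_H |L : H|^(-s) over the subalgebras H of finite index      *)
(* converges (unconditionally, hence absolutely) to l.                        *)
Definition zeta_sum (s l : R[i]) : Prop :=
  summability.partial_sum (zeta_term s) @ summability.totally
    --> (l : (R[i])^o).

(* F is a meromorphic function on the complex plane which is the sum of the   *)
(* zeta series on some right half-plane.                                      *)
Definition zeta_continuation (F : R[i] -> R[i]) : Prop :=
  meromorphic F /\
  exists sigma : R, forall s, sigma < complex.Re s -> zeta_sum s (F s).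

End LieZeta.

End Zeta.

(* Main.v *)
From HB Require Import structures.
Require Import Defs.
From mathcomp Require Import all_boot all_order all_algebra finmap complex.
From mathcomp Require Import all_classical all_reals all_analysis.
From mathcomp Require Import zify ring lra.

(** The algebra [p^i L] is again free of rank three, so it suffices to consider a
    free Lie algebra [L] of rank three over the [p]-adic integers. In the
    variable [t = p^(-s)] its zeta function is the power series whose
    coefficients count the subalgebras of index [p^m]. The point is that this
    series is a polynomial divided by a product of factors [1 - p^a t^b] with
    [a / b] equal to [0], [1/2], [1], [3/2] or [2], because such a factor can
    only vanish where [Re s = a / b].

    Counting subalgebras. Let [p^N] be the exponent of [L / H], attained by a
    vector [e1] of a basis of [L]. Then [H] consists of the vectors whose last
    two coordinates lie in some lattice [P] of the plane and that satisfy one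
    linear congruence [X + a Y + b Z = 0] modulo [p^N]. If [P] has index [p^j],
    the bracket of two elements of [H] is, modulo [p^N L], a multiple of [p^j]
    times a fixed vector, and [H] is a subalgebra if and only if
    [p^j f(1, a, b) = 0] modulo [p^N], where [f] is the ternary quadratic form
    attached to the bracket ([lattice_subalgebra]). Writing [P] in Hermite
    normal form turns subalgebras into integer parameters ([hermite_inj],
    [hermite_surj]); the sums over the parameters of [P] are geometric series
    with denominators of the required kind ([good_count_congruence],
    [good_count_free]). What remains is the number of solutions of
    [f(1, a, b) = 0] modulo [p^k], as a function of [k].

    Counting zeros. Let [d k] be the proportion of zeros modulo [p^k] of a
    polynomial of degree at most two in two variables ([good_quad2_density]),
    and consider the Gram matrix of its homogenisation. If it is regular, the
    gradient is not very divisible at an approximate zero, and Newton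
    approximation ([hensel_average]) gives [d (k+1) = d k / p] for large [k].
    Otherwise the conic is a cone with a [p]-adic vertex. If the vertex is
    finite modulo [p], a translation makes the polynomial homogeneous; then
    [d k = d' k + p^(-2) d (k-2)], where [d'] counts primitive zeros, and these
    are governed by polynomials in one variable. If the vertex is at infinity
    modulo [p], projecting from it removes one variable. Polynomials in one
    variable are treated in the same way. The prime [2] needs no special care,
    as only the invertibility of [2] in the field of fractions is used.

    Continuation. A meromorphic function that coincides with such a rational
    function of [p^(-s)] on a half-plane satisfies the corresponding relation
    everywhere: its failures on a horizontal half-line would have a least upper
    bound, which the isolation of zeros excludes ([vanishes_everywhere]). At a pole the denominator then vanishes
    ([pole_root]). *)

Set Implicit Arguments.
Unset Strict Implicit.
Unset Printing Implicit Defensive.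

Import Order.TTheory GRing.Theory Num.Theory numFieldNormedType.Exports.
Local Open Scope ring_scope.

(** * Divisibility by powers of p in the p-adic integers *)

Section PadicIntegers.
Variables (p : nat) (p_prime : prime p).
Local Notation Zp := (padicInt p).
Implicit Types (x y z : Zp) (k m n : nat).

Let p_gt0 : (0 < p)%N. Proof. exact: prime_gt0. Qed.
Let p_gt1 : (1 < p)%N. Proof. exact: prime_gt1. Qed.

Lemma pexp_gt1 n : (1 < p ^ n.+1)%N.
Proof. by rewrite -[1%N](expn0 p) ltn_exp2l. Qed.

Lemma padic_modulus n : (Zp_trunc (p ^ n.+1)).+2 = (p ^ n.+1)%N.
Proof. exact: Zp_cast (pexp_gt1 n). Qed.

(** The residue modulo [p ^ k] as a natural number; unlike [padic_res], it covers
    the trivial modulus [p ^ 0]. *)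
Definition padic_mod k x : nat := if k is k'.+1 then val (padic_res x k') else 0.

Lemma padic_mod_lt k x : (padic_mod k x < p ^ k)%N.
Proof.
by case: k => [|k] //=; have := ltn_ord (padic_res x k); rewrite {2}padic_modulus.
Qed.

Lemma padic_mod_step k x : (padic_mod k.+2 x %% p ^ k.+1)%N = padic_mod k.+1 x.
Proof.
rewrite /= -(padic_resP x k) /padic_red [RHS]/=.
by congr (_ %% _)%N; rewrite padic_modulus.
Qed.

Lemma padic_mod_mod k m x : (k <= m)%N -> (padic_mod m x %% p ^ k)%N = padic_mod k x.
Proof.
case: k => [|k] km; first by rewrite expn0 modn1.
rewrite -(subnKC km); elim: (m - k.+1)%N => [|d IHd].
  by rewrite addn0 modn_small // padic_mod_lt.
rewrite addnS -IHd addSn -(padic_mod_step (k + d)) modn_dvdm //.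
by rewrite dvdn_exp2l // ltnS leq_addr.
Qed.

Lemma padic_mod_inj x y : (forall k, padic_mod k x = padic_mod k y) -> x = y.
Proof. by move=> xy; apply: padic_eq => n; apply: val_inj; apply: (xy n.+1). Qed.

Lemma padic_modD k x y : padic_mod k (x + y) = ((padic_mod k x + padic_mod k y) %% p ^ k)%N.
Proof. by case: k => [|k] //=; rewrite {3}padic_modulus. Qed.

Lemma padic_modM k x y : padic_mod k (x * y) = ((padic_mod k x * padic_mod k y) %% p ^ k)%N.
Proof. by case: k => [|k] //=; rewrite {3}padic_modulus. Qed.

Lemma padic_mod0 k : padic_mod k 0 = 0%N. Proof. by case: k. Qed.

Lemma padic_mod_nat k n : padic_mod k n%:R = (n %% p ^ k)%N.
Proof.
elim: n => [|n IHn]; first by rewrite padic_mod0 mod0n.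
rewrite -natr1 padic_modD IHn -addn1 modnDml -[RHS]modnDmr.
by congr ((_ + _) %% _)%N; case: k {IHn} => [|k] /=; rewrite ?modn1 ?padic_modulus.
Qed.

Lemma padic_of_residues (a : nat -> nat) :
    (forall n, a n.+1 = a n %[mod p ^ n.+1]) ->
  exists x, forall n, padic_mod n.+1 x = (a n %% p ^ n.+1)%N.
Proof.
move=> a_compat; pose r n : 'Z_(p ^ n.+1) := inZp (a n).
have rP n : padic_red (r n.+1) = r n.
  by apply: val_inj; rewrite /= !padic_modulus modn_dvdm ?dvdn_exp2l.
by exists (PadicInt rP) => n /=; rewrite padic_modulus.
Qed.

Definition pdvd k x : bool := padic_mod k x == 0%N.

(** The quotient is assembled from the residues modulo the higher powers
    [p ^ (n + k)], each divided by [p ^ k]. *)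
Lemma pdvdP k x : reflect (exists y, x = p%:R ^+ k * y) (pdvd k x).
Proof.
apply: (iffP eqP) => [x0|[y ->]]; last first.
  by rewrite padic_modM -natrX padic_mod_nat modnn mul0n mod0n.
have dvd_res n : (p ^ k %| padic_mod (n + k) x)%N.
  by rewrite /dvdn padic_mod_mod ?leq_addl // x0.
have [n|y yE] := @padic_of_residues (fun n => padic_mod (n.+1 + k) x %/ p ^ k)%N.
  apply/eqP; rewrite -(@eqn_pmul2r (p ^ k)) ?expn_gt0 ?p_gt0 // !muln_modl.
  by rewrite !divnK // -expnD !padic_mod_mod // leq_add2r.
exists y; apply: padic_mod_inj => -[|n] //.
rewrite padic_modM yE -natrX padic_mod_nat modnMml modnMmr mulnC divnK //.
by rewrite padic_mod_mod // leq_addr.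
Qed.

Lemma pdvd0 k : pdvd k 0. Proof. by rewrite /pdvd padic_mod0. Qed.

Lemma pdvd_k0 x : pdvd 0 x. Proof. by []. Qed.

Lemma pdvd_exp k x : pdvd k (p%:R ^+ k * x).
Proof. by apply/pdvdP; exists x. Qed.

Lemma pdvdD k x y : pdvd k x -> pdvd k y -> pdvd k (x + y).
Proof.
by move=> /pdvdP[u ->] /pdvdP[v ->]; apply/pdvdP; exists (u + v); rewrite mulrDr.
Qed.

Lemma pdvdMl k x y : pdvd k y -> pdvd k (x * y).
Proof. by move=> /pdvdP[u ->]; apply/pdvdP; exists (x * u); rewrite mulrCA. Qed.

Lemma pdvdMr k x y : pdvd k x -> pdvd k (x * y).
Proof. by rewrite mulrC; apply: pdvdMl. Qed.

Lemma pdvdN k x : pdvd k (- x) = pdvd k x.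
Proof.
have dN z : pdvd k z -> pdvd k (- z) by rewrite -mulN1r; apply: pdvdMl.
by apply/idP/idP => /dN; rewrite ?opprK.
Qed.

Lemma pdvdB k x y : pdvd k x -> pdvd k y -> pdvd k (x - y).
Proof. by move=> xP yP; rewrite pdvdD // pdvdN. Qed.

Lemma pdvdDr k x y : pdvd k y -> pdvd k (x + y) = pdvd k x.
Proof.
move=> yP; apply/idP/idP => [/pdvdB/(_ yP)|/pdvdD/(_ yP)//].
by rewrite addrK.
Qed.

Lemma pdvd_leq k m x : (k <= m)%N -> pdvd m x -> pdvd k x.
Proof.
by move=> /subnKC <- /pdvdP[u ->]; rewrite exprD -mulrA pdvdMr // -[_ ^+ _]mulr1 pdvd_exp.
Qed.

Lemma pdvd_nat k n : pdvd k n%:R = (p ^ k %| n)%N.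
Proof. by rewrite /pdvd padic_mod_nat. Qed.

Lemma pdvd_padic_mod k x : pdvd k (x - (padic_mod k x)%:R).
Proof.
rewrite /pdvd; set y := x - _; have: x = y + (padic_mod k x)%:R by rewrite subrK.
move/(congr1 (padic_mod k)); rewrite padic_modD padic_mod_nat modnDmr.
move: (padic_mod k x) (padic_mod_lt k x) (padic_mod k y) (padic_mod_lt k y).
move=> a a_lt b b_lt /esym aE.
have : b + a = 0 + a %[mod p ^ k] by rewrite aE add0n modn_small.
by move/eqP; rewrite eqn_modDr mod0n modn_small.
Qed.

Lemma pdvd_sub k x y : pdvd k (x - y) = (padic_mod k x == padic_mod k y).
Proof.
apply/idP/eqP => [/pdvdP[z]|xy].
  move/(canRL (subrK y)) ->; rewrite padic_modD -natrX padic_modM padic_mod_nat.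
  by rewrite modnn mul0n mod0n add0n modn_small ?padic_mod_lt.
have := pdvdB (pdvd_padic_mod k x) (pdvd_padic_mod k y).
by rewrite xy opprB addrA subrK.
Qed.

Lemma pdvd_nat_inj k m n :
  (m < p ^ k)%N -> (n < p ^ k)%N -> pdvd k (m%:R - n%:R) -> m = n.
Proof. by move=> mk nk; rewrite pdvd_sub !padic_mod_nat !modn_small // => /eqP. Qed.

Lemma pdvd_pexp k n : pdvd k (p%:R ^+ n) = (k <= n)%N.
Proof. by rewrite -natrX pdvd_nat dvdn_Pexp2l. Qed.

Lemma pexp_torsion_free k x : p%:R ^+ k * x = 0 -> x = 0.
Proof.
move=> px0; apply: padic_mod_inj => m; rewrite padic_mod0.
have := congr1 (padic_mod (k + m)) px0.
rewrite -natrX padic_modM padic_mod_nat padic_mod0 modnMml expnD.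
rewrite -muln_modr => /eqP; rewrite muln_eq0 expn_eq0 eqn0Ngt p_gt0 /=.
by rewrite padic_mod_mod ?leq_addl // => /eqP.
Qed.

Lemma pexp_inj k : injective (fun x => p%:R ^+ k * x).
Proof.
by move=> x y /= xy; apply/subr0_eq/(@pexp_torsion_free k); rewrite mulrBr xy subrr.
Qed.

Lemma pdvd_pexpM k m x : pdvd (k + m) (p%:R ^+ k * x) = pdvd m x.
Proof.
apply/pdvdP/pdvdP => -[y]; last by move=> ->; exists y; rewrite exprD mulrA.
by rewrite exprD -mulrA => /pexp_inj ->; exists y.
Qed.

Lemma padic_unit x : ~~ pdvd 1 x -> exists y, y * x = 1.
Proof.
move=> xN.
have x_unit n : padic_res x n \is a GRing.unit.
  rewrite -[padic_res x n]natr_Zp unitZpE ?pexp_gt1 // coprimeXl //.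
  rewrite prime_coprime // /dvdn -[X in (_ %% X)%N]expn1.
  by rewrite -/(padic_mod n.+1 x) padic_mod_mod.
have invP n : padic_red (padic_res x n.+1)^-1 = (padic_res x n)^-1.
  by rewrite (rmorphV (@padic_red p n)) //= padic_resP.
by exists (PadicInt invP); apply: padic_eq => n; apply: (mulVr (x_unit n)).
Qed.

Lemma pdvd_unitM k u x : ~~ pdvd 1 u -> pdvd k (u * x) = pdvd k x.
Proof.
move=> /padic_unit[v vu]; apply/idP/idP; last exact: pdvdMl.
by move=> /(pdvdMl v); rewrite mulrA vu mul1r.
Qed.

Lemma padic_valuation x : x != 0 -> exists k u, x = p%:R ^+ k * u /\ ~~ pdvd 1 u.
Proof.
move=> x0; have [k kN] : exists k, ~~ pdvd k x.
  apply/not_existsP => xP; move/eqP: x0; apply; apply: padic_mod_inj => k.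
  by rewrite padic_mod0; apply/eqP/negPn/negP/xP.
elim: k kN => // k IHk; have [/pdvdP[u ->]|/IHk//] := boolP (pdvd k x).
by rewrite -addn1 pdvd_pexpM; exists k, u.
Qed.

Lemma padic_integral x y : x * y = 0 -> x = 0 \/ y = 0.
Proof.
have [->|/padic_valuation[k [u [-> /padic_unit[v vu]]]]] := eqVneq x 0; first by left.
rewrite -mulrA => /pexp_torsion_free /(congr1 ( *%R v)).
by rewrite mulrA vu mul1r mulr0; right.
Qed.

Lemma padic_mulI x : x != 0 -> injective ( *%R x).
Proof.
move=> x0 y z /= /eqP; rewrite -subr_eq0 -mulrBr => /eqP/padic_integral.
by case=> [/eqP|/subr0_eq//]; rewrite (negPf x0).
Qed.

Lemma padic_two_neq0 : 2%:R != 0 :> Zp.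
Proof.
apply/eqP => /(congr1 (padic_mod 2)); rewrite padic_mod0 padic_mod_nat modn_small //.
by rewrite (leq_ltn_trans p_gt1) // expnS expn1 -[X in (X < _)%N]muln1 ltn_pmul2l.
Qed.

Lemma pdvd11 : ~~ pdvd 1 1.
Proof. by rewrite (pdvd_nat 1 1) expn1 gtnNdvd. Qed.

End PadicIntegers.

Arguments padic_mod : simpl never.

(** * Averages of locally constant functions on the p-adic integers *)

Section Averages.
Variables (p : nat) (p_prime : prime p) (F : numFieldType).
Local Notation Zp := (padicInt p).
Implicit Types (x y u c : Zp) (g h : Zp -> F) (k m K : nat).

Let p_gt0 : (0 < p)%N. Proof. exact: prime_gt0. Qed.
Let pF_neq0 k : (p ^ k)%:R != 0 :> F.
Proof. by rewrite pnatr_eq0 expn_eq0 eqn0Ngt p_gt0. Qed.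

(** The integral of [g] against the normalised Haar measure, for a function [g]
    that only depends on its argument modulo [p ^ K]. *)
Definition avg K g : F := (p ^ K)%:R^-1 * \sum_(i < p ^ K) g i%:R.

Definition periodic K g := forall x y, pdvd K (x - y) -> g x = g y.

Lemma sum_ord_mul (G : zmodType) a b (f : nat -> G) :
  \sum_(i < a * b) f i = \sum_(j < b) \sum_(r < a) f (r + a * j)%N.
Proof.
rewrite -(big_mkord xpredT) mulnC big_nat_mul big_mkord; apply: eq_bigr => j _.
rewrite -{1}[(j * a)%N]add0n big_addn mulSn addnK big_mkord.
by apply: eq_bigr => r _; rewrite mulnC.
Qed.

Lemma eq_avg K g h : g =1 h -> avg K g = avg K h.
Proof. by move=> gh; congr (_ * _); apply: eq_bigr => i _; apply: gh. Qed.

Lemma avgD K g h : avg K (fun x => g x + h x) = avg K g + avg K h.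
Proof. by rewrite /avg big_split mulrDr. Qed.

Lemma avgZ K a g : avg K (fun x => a * g x) = a * avg K g.
Proof. by rewrite /avg -big_distrr mulrCA. Qed.

Lemma avgZr K a g : avg K (fun x => g x * a) = avg K g * a.
Proof. by rewrite mulrC -avgZ; apply: eq_avg => x; rewrite mulrC. Qed.

Lemma avg_sum K (I : Type) (r : seq I) (P : pred I) (g : I -> Zp -> F) :
  avg K (fun x => \sum_(i <- r | P i) g i x) = \sum_(i <- r | P i) avg K (g i).
Proof.
by rewrite /avg exchange_big big_distrr; apply: eq_bigr.
Qed.

Lemma avg_cst K a : avg K (fun=> a) = a.
Proof. by rewrite /avg sumr_const card_ord -[a *+ _]mulr_natl mulKf. Qed.

Lemma avg_exchange K K' (g : Zp -> Zp -> F) :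
  avg K (fun x => avg K' (g x)) = avg K' (fun y => avg K (g^~ y)).
Proof.
rewrite /avg -!big_distrr /= mulrCA; congr (_ * (_ * _)).
by rewrite exchange_big.
Qed.

Lemma periodic_leq K m g : (K <= m)%N -> periodic K g -> periodic m g.
Proof. by move=> Km gP x y /(pdvd_leq p_prime Km)/gP. Qed.

Lemma avgS K g : periodic K g -> avg K.+1 g = avg K g.
Proof.
move=> gP; rewrite /avg expnS mulnC (sum_ord_mul _ _ (fun n => g n%:R)).
under eq_bigr => j _.
  under eq_bigr => r _.
    have -> : g (r + p ^ K * j)%:R = g r%:R.
      by apply: gP; rewrite natrD addrC addKr natrM natrX pdvd_exp.
    over.
  over.
rewrite sumr_const card_ord -[_ *+ p]mulr_natl natrM invfM -mulrA mulKf //.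
by rewrite -[p]expn1.
Qed.

(** Functions that live at different levels can thus be averaged together at
    any common finer level, as for an integral. *)
Lemma avg_level K m g : (K <= m)%N -> periodic K g -> avg m g = avg K g.
Proof.
move=> /subnKC <- gP; elim: (m - K)%N => [|d IHd]; first by rewrite addn0.
by rewrite addnS avgS //; apply: periodic_leq gP; apply: leq_addr.
Qed.

(** A map that is injective modulo [p ^ K] permutes the finitely many residues;
    translations and multiplications by units are of this kind. *)
Lemma avg_reindex K g (s : Zp -> Zp) : periodic K g ->
    (forall x y, pdvd K (x - y) = pdvd K (s x - s y)) ->
  avg K (g \o s) = avg K g.
Proof.
move=> gP sP; congr (_ * _).
pose t (i : 'I_(p ^ K)) := Ordinal (padic_mod_lt p_prime K (s i%:R)).
have t_inj : injective t.
  move=> i j /(congr1 val)/= /eqP; rewrite -pdvd_sub // -sP pdvd_sub //.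
  by rewrite !padic_mod_nat // !modn_small // => /eqP/val_inj.
rewrite [RHS](reindex_inj t_inj); apply: eq_bigr => i _ /=.
by apply: gP; rewrite pdvd_padic_mod.
Qed.

Lemma avg_affine K g u c : periodic K g -> ~~ pdvd 1 u ->
  avg K (fun x => g (u * x + c)) = avg K g.
Proof.
move=> gP uN; rewrite -[RHS](@avg_reindex _ _ (fun x => u * x + c)) // => x y.
by rewrite opprD addrACA subrr addr0 -mulrBr pdvd_unitM.
Qed.

Lemma avg_shift K g c : periodic K g -> avg K (fun x => g (x + c)) = avg K g.
Proof.
move=> gP; rewrite -[RHS](@avg_affine _ _ 1 c) // ?pdvd11 //.
by apply: eq_avg => x; rewrite mul1r.
Qed.

Lemma avg_split K g :
  avg K.+1 g = p%:R^-1 * \sum_(r < p) avg K (fun x => g (r%:R + p%:R * x)).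
Proof.
rewrite /avg expnS (sum_ord_mul _ _ (fun n => g n%:R)) -big_distrr /=.
rewrite natrM invfM -mulrA; congr (_ * (_ * _)).
rewrite exchange_big; apply: eq_bigr => i _; apply: eq_bigr => j _.
by rewrite natrD natrM.
Qed.

(** The change of variables [x = p y], whose Jacobian is [1 / p]. *)
Lemma avg_pdvd1 K g :
  avg K.+1 (fun x => (pdvd 1 x)%:R * g x) = p%:R^-1 * avg K (fun x => g (p%:R * x)).
Proof.
rewrite avg_split; congr (_ * _); rewrite (bigD1 (Ordinal p_gt0)) //=.
rewrite [X in _ + X]big1 ?addr0 => [|r r0].
  by apply: eq_avg => x; rewrite add0r -[p%:R]expr1 pdvd_exp // mul1r.
rewrite -[RHS](avg_cst K 0); apply: eq_avg => x.
rewrite pdvdDr // ?pdvd_nat ?expn1 -1?[X in X%:R * x]expr1 //; last first.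
  by rewrite -[p%:R]expr1 pdvd_exp.
rewrite gtnNdvd ?mul0r // lt0n; apply: contra r0 => /eqP r0.
by apply/eqP/val_inj.
Qed.

Lemma avg_unit K : (0 < K)%N -> avg K (fun x => (~~ pdvd 1 x)%:R) = 1 - p%:R^-1.
Proof.
case: K => // K _; apply/(canRL (addrK _)).
rewrite -[X in _ + X]mulr1 -[X in _ * X](avg_cst K 1).
rewrite -(avg_pdvd1 K (fun=> 1)) -avgD -[RHS](avg_cst K.+1).
by apply: eq_avg => x; rewrite mulr1; case: pdvd; rewrite ?add0r ?addr0.
Qed.

End Averages.

(** * Sequences with a rational generating function *)

Section GoodSequences.
Variables (p : nat) (F : numFieldType).
Implicit Types (u v w : nat -> F) (f : nat * nat) (fs : seq (nat * nat)) (M b n : nat).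

(** A pair [(a, b)] stands for the denominator [1 - p^a t^b]. At [t = p^(-s)] its
    zeros have real part [a / b], which is required to be [0], [1/2], [1], [3/2]
    or [2]. *)
Definition half_slope f := (0 < f.2)%N && (2 * f.1 \in [seq c * f.2 | c <- iota 0 5])%N.

Definition delay b u n : F := if (b <= n)%N then u (n - b)%N else 0.

(** Multiplication of the generating function of [u] by [1 - p^a t^b]. *)
Definition strip f u n : F := u n - (p ^ f.1)%:R * delay f.2 u n.

Definition eventually_zero u := exists M, forall n, (M <= n)%N -> u n = 0.

(** The generating function of [u] is a polynomial divided by a product of
    admissible denominators. Phrasing this with operators on sequences gives
    closure under sums because the operators commute. *)
Definition good u := exists2 fs, all half_slope fs & eventually_zero (foldr strip u fs).

Lemma good_ext u v : u =1 v -> good u -> good v.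
Proof. by move=> uv; have -> : v = u by apply/funext => n; rewrite uv. Qed.

Lemma stripD f u v : strip f (u \+ v) = strip f u \+ strip f v.
Proof.
by apply/funext => n; rewrite /strip /delay /=; case: ifP => _; ring.
Qed.

Lemma stripZ f a u : strip f (fun n => a * u n) = fun n => a * strip f u n.
Proof.
by apply/funext => n; rewrite /strip /delay /=; case: ifP => _; ring.
Qed.

Lemma strip_delay f b u : strip f (delay b u) = delay b (strip f u).
Proof.
apply/funext => n; rewrite /strip /delay.
have [bn|nb] := leqP b n; last first.
  by case: ifP => // fn; rewrite ?mulr0 ?subr0 // ifF ?mulr0 ?subr0 //; lia.
have [fn|nf] := leqP f.2 (n - b)%N.
  by rewrite !ifT ?[(n - f.2 - b)%N]subnAC //; lia.
by case: ifP => // fn; rewrite ifF //; lia.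
Qed.

Lemma strip_strip f f' u : strip f (strip f' u) = strip f' (strip f u).
Proof.
have delayC b b' : delay b (delay b' u) = delay b' (delay b u).
  apply/funext => n; rewrite /delay.
  by repeat case: ifP => ? //; rewrite ?[(n - b' - b)%N]subnAC //; lia.
apply/funext => n; rewrite -[LHS]/(strip f' u n - _ * delay f.2 (strip f' u) n).
rewrite -[RHS]/(strip f u n - _ * delay f'.2 (strip f u) n) -!strip_delay /strip.
by rewrite (delayC f.2); ring.
Qed.

Lemma foldr_strip f u fs : foldr strip (strip f u) fs = strip f (foldr strip u fs).
Proof. by elim: fs => //= f' fs ->; rewrite strip_strip. Qed.

Lemma eventually_zero_strip f u : eventually_zero u -> eventually_zero (strip f u).
Proof.
case=> M u0; exists (M + f.2)%N => n Mn; rewrite /strip /delay ifT; last by lia.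
by rewrite !u0 ?mulr0 ?subr0 //; lia.
Qed.

Lemma eventually_zero_foldr u fs :
  eventually_zero u -> eventually_zero (foldr strip u fs).
Proof. by move=> u0; elim: fs => //= f fs; apply: eventually_zero_strip. Qed.

Lemma good_eventually_zero u : eventually_zero u -> good u.
Proof. by exists [::]. Qed.

Lemma goodD u v : good u -> good v -> good (u \+ v).
Proof.
move=> [fs fsP [M uM]] [gs gsP [N vN]]; exists (fs ++ gs); first by rewrite all_cat fsP.
have foldrC w : foldr strip w (fs ++ gs) = foldr strip (foldr strip w fs) gs.
  rewrite foldr_cat; elim: gs {gsP vN} => //= g gs <-.
  by rewrite foldr_strip.
have [M' hM] : eventually_zero (foldr strip u (fs ++ gs)).
  by rewrite foldrC; apply: eventually_zero_foldr; exists M.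
have [N' hN] : eventually_zero (foldr strip v (fs ++ gs)).
  by rewrite foldr_cat; apply: eventually_zero_foldr; exists N.
exists (M' + N')%N => n Mn.
have -> : foldr strip (u \+ v) (fs ++ gs) =
          foldr strip u (fs ++ gs) \+ foldr strip v (fs ++ gs).
  by elim: (fs ++ gs) => //= f l ->; rewrite stripD.
by rewrite /= hM ?hN ?addr0 //; lia.
Qed.

Lemma goodZ a u : good u -> good (fun n => a * u n).
Proof.
move=> [fs fsP [M uM]]; exists fs => //; exists M => n Mn.
have -> : foldr strip (fun n => a * u n) fs = fun n => a * foldr strip u fs n.
  by elim: fs {fsP uM} => //= f l ->; rewrite stripZ.
by rewrite uM ?mulr0.
Qed.

Lemma good_sum (I : Type) (r : seq I) (P : pred I) (u : I -> nat -> F) :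
  (forall i, P i -> good (u i)) -> good (fun n => \sum_(i <- r | P i) u i n).
Proof.
move=> uP; elim: r => [|i r IHr].
  by apply: good_eventually_zero; exists 0%N => n _; rewrite big_nil.
case Pi: (P i); last by apply: good_ext IHr => n; rewrite big_cons Pi.
by apply: good_ext (goodD (uP i Pi) IHr) => n /=; rewrite big_cons Pi.
Qed.

Lemma good_strip f u : half_slope f -> good (strip f u) -> good u.
Proof.
move=> fP [fs fsP u0]; exists (f :: fs) => /=; first by rewrite fP.
by rewrite -foldr_strip.
Qed.

Lemma good_eventually_eq M u v : (forall n, (M <= n)%N -> u n = v n) -> good v -> good u.
Proof.
move=> uv /(goodD (good_eventually_zero _)) good_uv.
apply: good_ext (good_uv (fun n => u n - v n) _) => [n|] /=; first by rewrite subrK.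
by exists M => n Mn; rewrite uv ?subrr.
Qed.

(** A linear recurrence need only hold eventually, since finitely many terms
    change the generating function by a polynomial. *)
Lemma good_rec M a b u w : half_slope (a, b) -> good w ->
  (forall n, (M <= n)%N -> u (n + b)%N = w (n + b)%N + (p ^ a)%:R * u n) -> good u.
Proof.
move=> abP gw uP; apply: (good_strip abP); apply: (@good_eventually_eq (M + b)) gw => n Mn.
have [m -> mM] : exists2 m, n = (m + b)%N & (M <= m)%N by exists (n - b)%N; lia.
by rewrite /strip /delay /= uP // leq_addl addnK addrK.
Qed.

(** The coefficients of [W(t) / (1 - p^a t^b)], where [W] has coefficients [w]. *)
Definition geometric_conv a b w n : F :=
  \sum_(i < n.+1) (p ^ (a * i))%:R * delay (b * i) w n.

Lemma geometric_convE a b w n M : (0 < b)%N -> (n < M)%N ->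
  geometric_conv a b w n =
  \sum_(i < M) (p ^ (a * i))%:R * (if (b * i <= n)%N then w (n - b * i)%N else 0).
Proof.
move=> b0 nM; rewrite /geometric_conv.
rewrite (big_ord_widen M (fun i => (p ^ (a * i))%:R * delay (b * i) w n) nM).
rewrite big_mkcond; apply: eq_bigr => i _; case: ifP => // ni.
by rewrite ifF ?mulr0 //; nia.
Qed.

Lemma good_geometric_conv a b w :
  half_slope (a, b) -> good w -> good (geometric_conv a b w).
Proof.
move=> abP gw; have b0 : (0 < b)%N by case/andP: abP.
apply: (@good_rec 0 a b _ w abP gw) => n _.
rewrite (geometric_convE _ _ b0 (ltnSn _)).
rewrite (@geometric_convE a b w n (n + b)) //; last by rewrite -[X in (X < _)%N]addn0 ltn_add2l.
rewrite big_ord_recl /= !muln0 expn0 mul1r subn0 big_distrr.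
congr (_ + _); apply: eq_bigr => i _; rewrite /bump /= add1n !mulnS expnD natrM -mulrA.
congr (_ * (_ * _)); move: (b * i)%N => m.
by rewrite addnC leq_add2r [(m + b)%N]addnC [(n + b)%N]addnC subnDl.
Qed.

End GoodSequences.

(** * Newton approximation on average *)

Section HenselLifting.
Variables (p : nat) (p_prime : prime p) (F : numFieldType).
Local Notation Zp := (padicInt p).
Implicit Types (x y c : Zp) (k m e j : nat).

Lemma pdvd_congr k x y : pdvd k (x - y) -> pdvd k x = pdvd k y.
Proof. by move=> xy; rewrite -[x](subrK y) addrC pdvdDr. Qed.

Definition quad c0 c1 c2 x : Zp := c0 + c1 * x + c2 * x ^+ 2.

Lemma quad_congr k c0 c1 c2 x y :
  pdvd k (x - y) -> pdvd k (quad c0 c1 c2 x - quad c0 c1 c2 y).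
Proof.
move=> xy; rewrite (_ : _ - _ = (c1 + c2 * (x + y)) * (x - y)) ?pdvdMl //.
by rewrite /quad; ring.
Qed.

Lemma periodic_pdvd_quad k m c0 c1 c2 : (m <= k)%N ->
  periodic k (fun x => (pdvd m (quad c0 c1 c2 x))%:R : F).
Proof.
move=> mk x y /(pdvd_leq p_prime mk)/(quad_congr c0 c1 c2)/pdvd_congr.
by move=> ->.
Qed.

Lemma sum_linear_congruence c0 c1 : ~~ pdvd 1 c1 ->
  \sum_(i < p) (pdvd 1 (c0 + c1 * i%:R))%:R = 1 :> F.
Proof.
move=> c1N; have [v vc1] := padic_unit p_prime c1N.
pose r := - v * c0; have lt_p : (padic_mod 1 r < p)%N.
  by rewrite -[X in (_ < X)%N]expn1 padic_mod_lt.
rewrite (bigD1 (Ordinal lt_p)) //= big1 ?addr0 => [|i iN].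
  suff -> : pdvd 1 (c0 + c1 * (padic_mod 1 r)%:R) by [].
  rewrite (_ : _ + _ = - c1 * (r - (padic_mod 1 r)%:R)).
    by rewrite pdvdMl // pdvd_padic_mod.
  have c1r : c1 * r = - c0 by rewrite /r mulrA mulrN [c1 * v]mulrC vc1 mulN1r.
  by rewrite mulrBr !mulNr c1r; ring.
case: (boolP (pdvd 1 _)) => // div_i; case/eqP: iN; apply: val_inj; rewrite [val _]/= [RHS]/=.
have: pdvd 1 (v * (c0 + c1 * i%:R)) by apply: pdvdMl.
rewrite mulrDr mulrA vc1 mul1r addrC -[v * c0]opprK -mulNr -/r pdvd_sub //.
by rewrite padic_mod_nat // expn1 modn_small // => /eqP.
Qed.

(** Newton approximation, on average: where the derivative has valuation
    [j <= e], moving the variable by a multiple of [p ^ (k - j)] changes the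
    value modulo [p ^ k.+1] by an arbitrary multiple of [p ^ k], so that a
    root modulo [p ^ k] is a root modulo [p ^ k.+1] with probability [1 / p]. *)
Lemma hensel_average e k (W : Zp -> F) c0 c1 c2 :
    periodic e.+1 W -> (e.*2 < k)%N ->
  let G m x := W x * (~~ pdvd e.+1 (c1 + c2 *+ 2 * x))%:R
                   * (pdvd m (quad c0 c1 c2 x))%:R in
  avg k.+1 (G k.+1) = p%:R^-1 * avg k.+1 (G k).
Proof.
move=> WP ek G; pose h := quad c0 c1 c2; pose h' x := c1 + c2 *+ 2 * x.
pose v j x := pdvd j (h' x) && ~~ pdvd j.+1 (h' x).
pose Gj j m x := W x * (v j x)%:R * (pdvd m (h x))%:R.
have split_v x n : (~~ pdvd n (h' x))%:R = \sum_(j < n) (v j x)%:R :> F.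
  elim: n => [|n IHn]; first by rewrite big_ord0.
  rewrite big_ord_recr -IHn /= /v; have := @pdvd_leq _ p_prime n n.+1 (h' x) (leqnSn n).
  by case: pdvd => [|/(_ _)]; case: pdvd => //=; rewrite ?addr0 ?add0r // => /(_ isT).
have h'_congr m x y : pdvd m (x - y) -> pdvd m (h' x) = pdvd m (h' y).
  move=> xy; apply: pdvd_congr.
  by rewrite (_ : h' x - h' y = c2 *+ 2 * (x - y)) ?pdvdMl // /h'; ring.
have GjP j : (j <= e)%N -> periodic k.+1 (Gj j k.+1).
  move=> je x y xy; rewrite /Gj /v (WP x y); last by apply: pdvd_leq xy => //; lia.
  have xyj m : (m <= e.+1)%N -> pdvd m (h' x) = pdvd m (h' y).
    by move=> me; apply: h'_congr; apply: pdvd_leq xy => //; lia.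
  by rewrite !xyj ?ltnS //; [rewrite (pdvd_congr (quad_congr c0 c1 c2 xy))|lia].
have step j x : (j <= e)%N ->
    \sum_(i < p) Gj j k.+1 (x + p%:R ^+ (k - j) * i%:R) = Gj j k x.
  move=> je; pose y (i : 'I_p) : Zp := x + p%:R ^+ (k - j) * i%:R.
  have yx m i : (m <= k - j)%N -> pdvd m (y i - x).
    by move=> mkj; rewrite /y addrC addKr (pdvd_leq p_prime mkj) // pdvd_exp.
  have Wv i : W (y i) * (v j (y i))%:R = W x * (v j x)%:R.
    by rewrite (WP _ x) ?yx /v ?(h'_congr _ _ x) ?yx //; lia.
  under eq_bigr => i _ do rewrite /Gj Wv; rewrite -big_distrr /= /Gj.
  have [/andP[/pdvdP[|w h'E]]|_] := boolP (v j x); last by rewrite mulr0 !mul0r.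
    by [].
  rewrite h'E -addn1 pdvd_pexpM // => wN; congr (_ * _).
  (* The quadratic term of the Taylor expansion is divisible by p^(2(k-j)). *)
  have hy i : pdvd k.+1 (h (y i)) = pdvd k.+1 (h x + p%:R ^+ k * (w * i%:R)).
    apply: pdvd_congr.
    rewrite (_ : _ - _ = p%:R ^+ ((k - j) + (k - j)) * (c2 * i%:R ^+ 2)).
      by apply: (@pdvd_leq _ _ _ (k - j + (k - j))); rewrite ?pdvd_exp //; lia.
    have -> : p%:R ^+ k = p%:R ^+ (k - j) * p%:R ^+ j :> Zp.
      by rewrite -exprD; congr (_ ^+ _); lia.
    rewrite -mulrA [_ ^+ j * (_ * _)]mulrA -h'E /h /h' /quad /y exprD; ring.
  under eq_bigr => i _ do rewrite hy.
  have [/pdvdP[|m ->]|hxN] := boolP (pdvd k (h x)); first by [].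
    under eq_bigr => i _ do rewrite -mulrDr -addn1 pdvd_pexpM //.
    exact: sum_linear_congruence.
  rewrite big1 // => i _; case: (boolP (pdvd _ _)) => // /(pdvd_leq p_prime (leqnSn k)).
  by rewrite pdvdDr ?pdvd_exp // (negPf hxN).
have avg_j j : (j <= e)%N -> avg k.+1 (Gj j k.+1) = p%:R^-1 * avg k.+1 (Gj j k).
  move=> je; rewrite -(eq_avg k.+1 (fun x => step j x je)) avg_sum.
  under [in RHS]eq_bigr => i _ do rewrite (avg_shift p_prime _ (GjP j je)).
  rewrite sumr_const card_ord -[avg _ _ *+ p]mulr_natl mulKf //.
  by rewrite pnatr_eq0 -lt0n prime_gt0.
have G_sum m : avg k.+1 (G m) = \sum_(j < e.+1) avg k.+1 (Gj j m).
  rewrite -avg_sum; apply: eq_avg => x; rewrite /G split_v big_distrr big_distrl.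
  by apply: eq_bigr.
by rewrite !G_sum big_distrr; apply: eq_bigr => j _; rewrite avg_j // -ltnS.
Qed.

End HenselLifting.

(** * Zeros of quadratic polynomials in one variable *)

Section QuadraticDensities.
Variables (p : nat) (p_prime : prime p) (F : numFieldType).
Local Notation Zp := (padicInt p).
Implicit Types (x y z c A B C : Zp) (k m e M : nat) (d w : nat -> F).

Let pF_neq0 : p%:R != 0 :> F.
Proof. by rewrite pnatr_eq0 -lt0n prime_gt0. Qed.

(** A density [d k] of zeros modulo [p ^ k] enters the count of subalgebras
    through the number [p ^ (2 k) d k] of zeros of a polynomial in two
    variables modulo [p ^ k]. *)
Definition good_density d := good p (fun k => (p ^ (2 * k))%:R * d k).

Lemma good_densityD d w :
  good_density d -> good_density w -> good_density (fun k => d k + w k).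
Proof. by move=> dP /(goodD dP); apply: good_ext => k /=; rewrite mulrDr. Qed.

Lemma good_densityZ a d : good_density d -> good_density (fun k => a * d k).
Proof. by move=> /(goodZ a); apply: good_ext => k; rewrite mulrCA. Qed.

(** A homothety that divides the values of a form by [p ^ b] and the volume by
    [p ^ j] produces such a recurrence. *)
Lemma good_density_rec j b M d w : (0 < b)%N ->
    (2 * (2 * b - j) \in [seq i * b | i <- iota 0 5])%N ->
    (j <= 2 * b)%N -> good_density w ->
    (forall k, (M <= k)%N -> d (k + b)%N = w (k + b)%N + p%:R ^- j * d k) ->
  good_density d.
Proof.
move=> b0 slope jb wP dP; apply: (@good_rec _ _ M (2 * b - j) b _ _ _ wP).
  by rewrite /half_slope /= b0.
move=> k Mk; rewrite dP // mulrDr; congr (_ + _).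
rewrite !natrX mulrA; apply/eqP; rewrite mulrA eq_sym; apply/eqP.
congr (_ * _); rewrite -exprD.
rewrite -[X in _ = X ^+ _ / _]/(p%:R) -exprB ?unitfE //; last by lia.
by congr (_ ^+ _); lia.
Qed.

Lemma good_density0 : good_density (fun=> 0).
Proof. by apply: good_eventually_zero; exists 0%N => k _; rewrite mulr0. Qed.

Lemma good_density_geometric j M d : (j <= 2)%N ->
  (forall k, (M <= k)%N -> d k.+1 = p%:R ^- j * d k) -> good_density d.
Proof.
move=> j2 dP; apply: (@good_density_rec j 1 M d _ _ _ _ good_density0) => //.
  by case: j j2 {dP} => [|[|[|]]].
by move=> k Mk; rewrite addn1 dP // add0r.
Qed.

Definition constant_density c k : F := (pdvd k c)%:R.

Lemma padic_neq0P c : c != 0 -> exists e, ~~ pdvd e.+1 c.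
Proof.
move=> /(padic_valuation p_prime)[k [u [-> uN]]]; exists k.
by rewrite -addn1 pdvd_pexpM.
Qed.

Lemma good_constant_density c : good_density (constant_density c).
Proof.
have [->|/padic_neq0P[e cN]] := eqVneq c 0.
  apply: (@good_density_geometric 0 0) => // k _.
  by rewrite /constant_density !pdvd0 expr0 invr1 mul1r.
apply: good_eventually_zero; exists e.+1 => k ek.
by rewrite /constant_density; case: (boolP (pdvd k c)) => [/(pdvd_leq p_prime ek)|];
  rewrite ?mulr0 // (negPf cN).
Qed.

Lemma primitive_multiple x y z : ~ (x = 0 /\ y = 0 /\ z = 0) ->
  exists k x' y' z', [/\ x = p%:R ^+ k * x', y = p%:R ^+ k * y', z = p%:R ^+ k * z' &
    ~~ [&& pdvd 1 x', pdvd 1 y' & pdvd 1 z']].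
Proof.
move=> xyz0; have [k kN] : exists k, ~~ [&& pdvd k x, pdvd k y & pdvd k z].
  suff [c [c0 cP]] : exists c, c != 0 /\ forall k, ~~ pdvd k c ->
      ~~ [&& pdvd k x, pdvd k y & pdvd k z].
    by have [e eN] := padic_neq0P c0; exists e.+1; apply: cP.
  have [x0|x0] := eqVneq x 0; last first.
    by exists x; split=> // k; apply: contra => /and3P[].
  have [y0|y0] := eqVneq y 0; last first.
    by exists y; split=> // k; apply: contra => /and3P[].
  exists z; split; last by move=> k; apply: contra => /and3P[].
  by apply/eqP => z0; apply: xyz0.
elim: k kN => // k IHk.
have [/and3P[/pdvdP[//|x' ->] /pdvdP[//|y' ->] /pdvdP[//|z' ->]]|/IHk//] :=
  boolP [&& pdvd k x, pdvd k y & pdvd k z].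
by rewrite -addn1 !pdvd_pexpM // => N; exists k, x', y', z'.
Qed.

Definition quad_density c0 c1 c2 k : F := avg k (fun x => (pdvd k (quad c0 c1 c2 x))%:R).

Lemma quad_density_level c0 c1 c2 k m : (k <= m)%N ->
  avg m (fun x => (pdvd k (quad c0 c1 c2 x))%:R) = quad_density c0 c1 c2 k.
Proof. by move=> km; rewrite (avg_level p_prime km) //; apply: periodic_pdvd_quad. Qed.

(** The discriminant is a combination of the values of the polynomial and of its
    derivative, so the derivative is not very divisible at an approximate
    root, and Newton approximation makes the density eventually geometric. *)
Lemma good_quad_density_separable c0 c1 c2 :
  c0 * c2 *+ 4 - c1 ^+ 2 != 0 -> good_density (quad_density c0 c1 c2).
Proof.
move=> /padic_neq0P[e eN].
have regular k x : (e < k)%N -> pdvd k (quad c0 c1 c2 x) = true ->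
    ~~ pdvd e.+1 (c1 + c2 *+ 2 * x).
  move=> ek hP; apply: contra eN => h'P.
  rewrite (_ : _ - _ = c2 *+ 4 * quad c0 c1 c2 x - (c1 + c2 *+ 2 * x) * (c1 + c2 *+ 2 * x)).
    by rewrite pdvdB ?pdvdMl // (pdvd_leq p_prime ek).
  by rewrite /quad; ring.
apply: (@good_density_geometric 1 e.*2.+1) => // k ek; rewrite expr1.
rewrite -(quad_density_level _ _ _ (leqnSn k)).
have /= := @hensel_average p p_prime F e k (fun=> 1) c0 c1 c2 (fun _ _ _ => erefl) ek.
have drop m : (e < m)%N -> (fun x => 1 * (~~ pdvd e.+1 (c1 + c2 *+ 2 * x))%:R *
      (pdvd m (quad c0 c1 c2 x))%:R) =1 (fun x => (pdvd m (quad c0 c1 c2 x))%:R : F).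
  move=> em x; case hP: (pdvd m _); last by rewrite mulr0.
  by rewrite (regular m) // !mul1r.
by rewrite (eq_avg _ (drop k.+1 _)) ?(eq_avg _ (drop k _)) //; lia.
Qed.

(** On units the polynomial [c2 x^2] behaves like the constant [c2], and on
    multiples of [p] it is [p ^ 2] times itself. *)
Lemma good_quad_density_square c2 : good_density (quad_density 0 0 c2).
Proof.
apply: (@good_density_rec 1 2 0 _ (fun k => (1 - p%:R^-1) * constant_density c2 k)) => //.
  exact: good_densityZ (good_constant_density _).
move=> k _; rewrite addn2 expr1.
have quadE x : quad 0 0 c2 x = x ^+ 2 * c2 by rewrite /quad; ring.
have -> : quad_density 0 0 c2 k =
    avg k.+1 (fun x => (pdvd k.+2 (quad 0 0 c2 (p%:R * x)))%:R).
  rewrite -(quad_density_level _ _ _ (leqnSn k)); apply: eq_avg => x.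
  by rewrite !quadE exprMn -(mulrA (p%:R ^+ 2)) -[k.+2]/(2 + k)%N pdvd_pexpM.
rewrite -(avg_unit p_prime F (ltn0Sn k.+1)) -avgZr.
rewrite -(avg_pdvd1 p_prime k.+1 (fun x => (pdvd k.+2 (quad 0 0 c2 x))%:R)) -avgD.
apply: eq_avg => x; rewrite !quadE /constant_density.
case: (boolP (pdvd 1 x)) => [_|xN]; rewrite ?mul0r ?mul1r ?add0r ?addr0 //.
by rewrite expr2 -mulrA !pdvd_unitM.
Qed.

(** A kernel vector of the Gram matrix of the homogenised polynomial is a double
    root in the projective line. If it is finite modulo [p], a translation
    moves it to the origin; if it is infinite modulo [p], the polynomial is a
    constant times the square of a function with unit values. *)
Lemma good_quad_density_degenerate c0 c1 c2 :
  c0 * c2 *+ 4 = c1 ^+ 2 -> good_density (quad_density c0 c1 c2).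
Proof.
move=> disc0; have two_neq0 := padic_two_neq0 p_prime.
have [u0 [u1 [unz e0 e1]]] : exists u0 u1, [/\ ~ (u0 = 0 /\ u1 = 0 /\ (0 : Zp) = 0),
    c0 *+ 2 * u0 + c1 * u1 = 0 & c1 * u0 + c2 *+ 2 * u1 = 0].
  have [c00|c00] := eqVneq c0 0.
    have c10 : c1 = 0.
      by move: disc0; rewrite c00 mul0r mul0rn expr2 => /esym/(padic_integral p_prime)[].
    exists 1, 0; rewrite c00 c10; split; [|ring|ring].
    by case=> /eqP; rewrite oner_eq0.
  exists c1, (- (c0 *+ 2)); split; [|ring|].
    case=> _ [/eqP]; rewrite oppr_eq0 => /eqP c0n _; move/eqP: c00; apply.
    by apply: (padic_mulI p_prime two_neq0); rewrite mulr_natl c0n mulr0.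
  by rewrite -expr2 -disc0; ring.
have [k [v0 [v1 [v2 [u0E u1E v2E vN]]]]] := primitive_multiple unz.
have v20 := pexp_torsion_free p_prime (esym v2E).
have {}e0 : c0 *+ 2 * v0 + c1 * v1 = 0.
  by apply: (pexp_torsion_free p_prime (k := k)); rewrite -e0 u0E u1E; ring.
have {}e1 : c1 * v0 + c2 *+ 2 * v1 = 0.
  by apply: (pexp_torsion_free p_prime (k := k)); rewrite -e1 u0E u1E; ring.
have [v0N|v0U] := boolP (pdvd 1 v0); last first.
  have [w wv0] := padic_unit p_prime v0U; pose r := w * v1.
  have {}e0 : c0 *+ 2 + c1 * r = 0.
    transitivity (w * (c0 *+ 2 * v0 + c1 * v1) + (1 - w * v0) * c0 *+ 2).
      by rewrite /r; ring.
    by rewrite e0 wv0; ring.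
  have {}e1 : c1 + c2 *+ 2 * r = 0.
    transitivity (w * (c1 * v0 + c2 *+ 2 * v1) + (1 - w * v0) * c1).
      by rewrite /r; ring.
    by rewrite e1 wv0; ring.
  have root_r : c0 + c1 * r + c2 * r ^+ 2 = 0.
    apply: (padic_mulI p_prime two_neq0).
    transitivity ((c0 *+ 2 + c1 * r) + r * (c1 + c2 *+ 2 * r)); first by ring.
    by rewrite e0 e1; ring.
  apply: good_ext (good_quad_density_square c2) => m; congr (_ * _).
  rewrite -[RHS](avg_shift p_prime r) //; last exact: periodic_pdvd_quad.
  apply: eq_avg => x; congr (pdvd _ _)%:R.
  rewrite (_ : quad _ _ _ (x + r) =
    (c0 + c1 * r + c2 * r ^+ 2) + (c1 + c2 *+ 2 * r) * x + c2 * x ^+ 2); last first.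
    by rewrite /quad; ring.
  by rewrite root_r e1 /quad; ring.
have v1U : ~~ pdvd 1 v1 by move: vN; rewrite v0N v20 pdvd0 andbT.
have [w wv1] := padic_unit p_prime v1U; pose s := w * v0.
have sN : pdvd 1 s by apply: pdvdMl.
have {}e0 : c1 = - (c0 *+ 2 * s).
  transitivity (w * (c0 *+ 2 * v0 + c1 * v1) + (1 - w * v1) * c1 - c0 *+ 2 * s).
    by rewrite /s; ring.
  by rewrite e0 wv1; ring.
have {}e1 : c2 = c0 * s ^+ 2.
  apply: (padic_mulI p_prime two_neq0).
  transitivity (w * (c1 * v0 + c2 *+ 2 * v1) + (1 - w * v1) * c2 *+ 2 - c1 * s).
    by rewrite /s; ring.
  by rewrite e1 wv1 e0; ring.
apply: good_ext (good_constant_density c0) => m; congr (_ * _).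
rewrite -[LHS](avg_cst p_prime m); apply: eq_avg => x; congr _%:R.
have sxN : ~~ pdvd 1 (1 - s * x).
  by rewrite pdvdDr ?pdvd11 // pdvdN //; apply: pdvdMr.
rewrite (_ : quad _ _ _ _ = (1 - s * x) * ((1 - s * x) * c0)); last first.
  by rewrite /quad e0 e1; ring.
by rewrite !pdvd_unitM.
Qed.

Lemma good_quad_density c0 c1 c2 : good_density (quad_density c0 c1 c2).
Proof.
have [disc0|] := eqVneq (c0 * c2 *+ 4 - c1 ^+ 2) 0.
  exact/good_quad_density_degenerate/subr0_eq.
exact: good_quad_density_separable.
Qed.
End QuadraticDensities.

(** * Zeros of quadratic polynomials in two variables *)

Section BinaryQuadraticDensities.
Variables (p : nat) (p_prime : prime p) (F : numFieldType).
Local Notation Zp := (padicInt p).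
Implicit Types (x y z c A B C : Zp) (k m e : nat).
Local Notation good_density := (@good_density p F).

(** Columns of the adjugate matrix are kernel vectors; when they all vanish the
    matrix has rank at most one and the kernel is read off its first row. *)
Lemma symmetric_kernel (a b c d e f : Zp) :
    a * (d * f - e ^+ 2) + b * (e * c - f * b) + c * (b * e - d * c) = 0 ->
  exists u v w, [/\ ~ (u = 0 /\ v = 0 /\ w = 0), a * u + b * v + c * w = 0,
    b * u + d * v + e * w = 0 & c * u + e * v + f * w = 0].
Proof.
move=> det0.
pose m00 := d * f - e ^+ 2; pose m01 := e * c - f * b; pose m02 := b * e - d * c.
pose m11 := a * f - c ^+ 2; pose m12 := b * c - a * e; pose m22 := a * d - b ^+ 2.
have [[_ [_ m02_0]]|nz0] := pselect (m00 = 0 /\ m01 = 0 /\ m02 = 0); last first.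
  exists m00, m01, m02; split; [exact: nz0|rewrite -[RHS]det0 /m00 /m01 /m02; ring|..];
  by rewrite /m00 /m01 /m02; ring.
have [[_ [m11_0 m12_0]]|nz1] := pselect (m01 = 0 /\ m11 = 0 /\ m12 = 0); last first.
  exists m01, m11, m12; split; [exact: nz1| |rewrite -[RHS]det0|];
  by rewrite /m01 /m11 /m12; ring.
have [m22_0|nz2] := eqVneq m22 0; last first.
  exists m02, m12, m22; split; [by case=> _ [_ /eqP]; rewrite (negPf nz2)| | |rewrite -[RHS]det0];
  by rewrite /m02 /m12 /m22; ring.
have [a0|a_nz] := eqVneq a 0.
  have sq0 x : x ^+ 2 = 0 -> x = 0 by rewrite expr2 => /(padic_integral p_prime)[].
  have b0 : b = 0.
    by apply: sq0; transitivity (a * d - m22); [rewrite /m22; ring|rewrite m22_0 a0; ring].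
  have c0 : c = 0.
    by apply: sq0; transitivity (a * f - m11); [rewrite /m11; ring|rewrite m11_0 a0; ring].
  by exists 1, 0, 0; rewrite a0 b0 c0; split; [by case=> /eqP; rewrite oner_eq0|ring..].
exists (- b), a, 0; split; [by case=> _ [/eqP]; rewrite (negPf a_nz)|ring| |].
  by rewrite -[RHS]m22_0 /m22; ring.
by transitivity (- m12); [rewrite /m12; ring|rewrite m12_0 oppr0].
Qed.

(** The polynomial [c0 + c1 x + c2 y + A x^2 + B x y + C y^2], as a polynomial
    in [x]. *)
Definition quad2 c0 c1 c2 A B C x y : Zp := quad (quad c0 c2 C y) (c1 + B * y) A x.

Lemma quad2_swap c0 c1 c2 A B C x y : quad2 c0 c1 c2 A B C x y = quad2 c0 c2 c1 C B A y x.
Proof. by rewrite /quad2 /quad; ring. Qed.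

Definition quad2_density c0 c1 c2 A B C k : F :=
  avg k (fun y => avg k (fun x => (pdvd k (quad2 c0 c1 c2 A B C x y))%:R)).

Lemma periodic_avg k m (g : Zp -> Zp -> F) :
  (forall x, periodic k (g x)) -> periodic k (fun y => avg m (g^~ y)).
Proof. by move=> gP y z yz; apply: eq_avg => x; apply: gP. Qed.

Lemma periodic_quad2l c0 c1 c2 A B C k m y : (k <= m)%N ->
  periodic m (fun x => (pdvd k (quad2 c0 c1 c2 A B C x y))%:R : F).
Proof. by move=> km; apply: periodic_pdvd_quad. Qed.

Lemma periodic_quad2r c0 c1 c2 A B C k m x : (k <= m)%N ->
  periodic m (fun y => (pdvd k (quad2 c0 c1 c2 A B C x y))%:R : F).
Proof.
move=> km y z yz; rewrite !(quad2_swap _ _ _ _ _ _ x).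
exact: (periodic_quad2l _ _ _ _ _ _ _ km).
Qed.

Lemma quad2_density_level c0 c1 c2 A B C k m n : (k <= m)%N -> (k <= n)%N ->
  avg m (fun y => avg n (fun x => (pdvd k (quad2 c0 c1 c2 A B C x y))%:R)) =
  quad2_density c0 c1 c2 A B C k.
Proof.
move=> km kn; rewrite (avg_level p_prime km); last first.
  by apply: periodic_avg => x; apply: periodic_quad2r.
by apply: eq_avg => y; rewrite (avg_level p_prime kn) //; apply: periodic_quad2l.
Qed.

Lemma quad2_density_swap c0 c1 c2 A B C :
  quad2_density c0 c1 c2 A B C = quad2_density c0 c2 c1 C B A.
Proof.
apply/funext => k; rewrite /quad2_density avg_exchange.
by apply: eq_avg => x; apply: eq_avg => y; rewrite quad2_swap.
Qed.

(** The affine conic is smooth over the field of fractions. By Cramer's rule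
    the gradient cannot be very divisible at an approximate zero; Newton
    approximation then applies in the direction of [x] or in that of [y]. *)
Lemma good_quad2_density_smooth c0 c1 c2 A B C :
    c0 *+ 2 * (A *+ 2 * (C *+ 2) - B ^+ 2) + c1 * (B * c2 - C *+ 2 * c1)
      + c2 * (c1 * B - A *+ 2 * c2) != 0 ->
  good_density (quad2_density c0 c1 c2 A B C).
Proof.
move=> /(padic_neq0P p_prime)[e eN]; set q := quad2 c0 c1 c2 A B C.
pose qx x y := c1 + B * y + A *+ 2 * x; pose qy x y := c2 + B * x + C *+ 2 * y.
have regular k x y : (e < k)%N -> pdvd k (q x y) ->
    pdvd e.+1 (qx x y) -> ~~ pdvd e.+1 (qy x y).
  move=> ek qP qxP; apply: contra eN => qyP.
  set det := (X in pdvd _ X).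
  have -> : det = (A *+ 2 * (C *+ 2) - B ^+ 2) * (q x y *+ 2 - x * qx x y - y * qy x y)
      + (B * c2 - C *+ 2 * c1) * qx x y + (c1 * B - A *+ 2 * c2) * qy x y.
    by rewrite /det /q /quad2 /quad /qx /qy; ring.
  have {}qP := pdvd_leq p_prime ek qP.
  apply: pdvdD => //; last exact: pdvdMl.
  apply: pdvdD => //; last exact: pdvdMl.
  apply: pdvdMl => //; apply: pdvdB => //; last exact: pdvdMl.
  by apply: pdvdB => //; [apply: pdvdD|apply: pdvdMl].
pose Gx k x y : F := 1 * (~~ pdvd e.+1 (qx x y))%:R * (pdvd k (q x y))%:R.
pose Gy k x y : F := (pdvd e.+1 (qx x y))%:R * (~~ pdvd e.+1 (qy x y))%:R *
  (pdvd k (q x y))%:R.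
have split_q k x y : (e < k)%N -> (pdvd k (q x y))%:R = Gx k x y + Gy k x y.
  move=> ek; rewrite /Gx /Gy mul1r; case: (boolP (pdvd k _)) => [/(regular _ _ _ ek) |_].
    by case: pdvd => [->|]; rewrite // ?mul0r ?mul1r ?addr0 ?add0r.
  by rewrite !mulr0 addr0.
apply: (@good_density_geometric p p_prime F 1 e.*2.+1) => // k ek; rewrite expr1.
rewrite -(quad2_density_level _ _ _ _ _ _ (leqnSn k) (leqnSn k)).
have split_avg m : (e < m)%N ->
    avg k.+1 (fun y => avg k.+1 (fun x => (pdvd m (q x y))%:R)) =
    avg k.+1 (fun y => avg k.+1 (Gx m ^~ y)) + avg k.+1 (fun x => avg k.+1 (Gy m x)).
  move=> em; rewrite [X in _ + X]avg_exchange -avgD; apply: eq_avg => y.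
  by rewrite -avgD; apply: eq_avg => x; apply: split_q.
rewrite -/q /quad2_density !split_avg ?mulrDr; [|lia..]; congr (_ + _).
  rewrite -avgZ; apply: eq_avg => y.
  by have := @hensel_average p p_prime F e k (fun=> 1) (quad c0 c2 C y) (c1 + B * y) A
    (fun _ _ _ => erefl) ek.
rewrite -avgZ; apply: eq_avg => x.
have WP : periodic e.+1 (fun y => (pdvd e.+1 (qx x y))%:R : F).
  move=> y z yz; rewrite (@pdvd_congr _ p_prime _ _ (qx x z)) //.
  by rewrite (_ : _ - _ = B * (y - z)) ?pdvdMl // /qx; ring.
have /= := hensel_average p_prime (quad c0 c1 A x) (c2 + B * x) C WP ek.
by congr (_ = _); [|congr (_ * _)]; apply: eq_avg => y; rewrite /Gy /q quad2_swap.
Qed.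

(** A homogeneous form: primitive zeros are counted by one-variable
    polynomials in the slope of a line through the origin, and dividing a
    non-primitive vector by [p] divides the value of the form by [p ^ 2]. *)
Lemma good_quad2_density_form A B C : good_density (quad2_density 0 0 0 A B C).
Proof.
set q := quad2 0 0 0 A B C.
pose w k : F := (1 - p%:R^-1) * quad_density F A B C k +
  (1 - p%:R^-1) * (p%:R^-1 * quad_density F C (p%:R * B) (p%:R ^+ 2 * A) k).
apply: (@good_density_rec p p_prime F 2 2 0 _ w) => //.
  apply: good_densityD; first exact/good_densityZ/good_quad_density.
  exact/good_densityZ/good_densityZ/good_quad_density.
move=> k _; rewrite addn2 /w.
have qS x y : pdvd k.+2 (q (p%:R * x) (p%:R * y)) = pdvd k (q x y).
  rewrite (_ : q (_ * _) _ = p%:R ^+ 2 * q x y); last by rewrite /q /quad2 /quad; ring.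
  by rewrite -[k.+2]/(2 + k)%N pdvd_pexpM.
pose D x : F := (pdvd 1 x)%:R; pose U x : F := (~~ pdvd 1 x)%:R.
pose g x y : F := (pdvd k.+2 (q x y))%:R.
have -> : quad2_density 0 0 0 A B C k.+2 =
    avg k.+2 (fun x => U x * avg k.+2 (fun y => g x y)) +
    (avg k.+2 (fun y => U y * avg k.+2 (fun x => D x * g x y)) +
     avg k.+2 (fun y => D y * avg k.+2 (fun x => D x * g x y))).
  rewrite /quad2_density -avgD.
  have -> : avg k.+2 (fun x => U x * avg k.+2 (fun y => g x y)) =
            avg k.+2 (fun y => avg k.+2 (fun x => U x * g x y)).
    by rewrite avg_exchange; apply: eq_avg => x; rewrite avgZ.
  rewrite -avgD; apply: eq_avg => y; rewrite -mulrDl [_ + D y](_ : _ = 1) ?mul1r.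
    rewrite -avgD; apply: eq_avg => x; rewrite -mulrDl [_ + D x](_ : _ = 1) ?mul1r //.
    by rewrite /U /D; case: pdvd; rewrite ?add0r ?addr0.
  by rewrite /U /D; case: pdvd; rewrite ?add0r ?addr0.
rewrite -!(avg_unit p_prime F (ltn0Sn k.+1)) -/U -!avgZr addrA; congr (_ + _ + _).
- apply: eq_avg => x; rewrite /U; case: (boolP (pdvd 1 x)) => xN; rewrite ?mul0r ?mul1r //.
  have gP : periodic k.+2 (g x) by apply: periodic_quad2r.
  rewrite -(avg_affine p_prime 0 gP xN); apply: eq_avg => z; rewrite addr0 /g.
  rewrite (_ : q _ _ = x * (x * quad A B C z)); last by rewrite /q /quad2 /quad; ring.
  by rewrite !pdvd_unitM.
- apply: eq_avg => y; rewrite /U; case: (boolP (pdvd 1 y)) => yN; rewrite ?mul0r ?mul1r //.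
  have gP : periodic k.+2 (fun x => D x * g x y).
    move=> x z xz; rewrite /D /g (periodic_quad2l 0 0 0 A B C y (leqnn _) xz).
    by rewrite (pdvd_congr p_prime (pdvd_leq p_prime _ xz)).
  rewrite -(avg_affine p_prime 0 gP yN).
  pose h z : F := (pdvd k.+2 (quad C B A z))%:R.
  have -> : avg k.+2 (fun z => D (y * z + 0) * g (y * z + 0) y) =
            avg k.+2 (fun z => D z * h z).
    apply: eq_avg => z; rewrite addr0 /D pdvd_unitM // /g /h.
    rewrite (_ : q _ _ = y * (y * quad C B A z)); last by rewrite /q /quad2 /quad; ring.
    by rewrite !pdvd_unitM.
  rewrite /D avg_pdvd1 //; congr (_ * _).
  have hE z : h (p%:R * z) = (pdvd k.+2 (quad C (p%:R * B) (p%:R ^+ 2 * A) z))%:R.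
    by rewrite /h; congr (pdvd _ _)%:R; rewrite /quad; ring.
  rewrite (eq_avg _ hE); apply: esym; apply: avgS => // x z xz; rewrite -!hE /h.
  congr (nat_of_bool _)%:R; apply: (pdvd_congr p_prime); apply: quad_congr => //.
  by rewrite -mulrBr -[p%:R]expr1 -[k.+2]/(1 + k.+1)%N pdvd_pexpM.
rewrite /D avg_pdvd1 // expr2 invfM -mulrA; congr (_ * _).
rewrite -(quad2_density_level 0 0 0 A B C (leqnSn k) (leqnSn k)) -avgZ.
apply: eq_avg => y; rewrite avg_pdvd1 //; congr (_ * _).
by apply: eq_avg => x; rewrite /g qS.
Qed.

(** If the kernel vector of the Gram matrix reduces to a point at infinity with
    non-zero [y]-coordinate, the conic is a cone whose lines are parametrised,
    for each value of [y], by an affine coordinate. *)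
Lemma good_quad2_density_cone c0 c1 c2 A B C (s t : Zp) : pdvd 1 s ->
    c0 *+ 2 * s + c1 * t + c2 = 0 -> c1 * s + A *+ 2 * t + B = 0 ->
    c2 * s + B * t + C *+ 2 = 0 ->
  good_density (quad2_density c0 c1 c2 A B C).
Proof.
move=> sN e0 e1 e2.
have c2E : c2 = - (c0 *+ 2 * s + c1 * t) by apply/eqP; rewrite -addr_eq0 addrC e0.
have BE : B = - (c1 * s + A *+ 2 * t) by apply/eqP; rewrite -addr_eq0 addrC e1.
have CE : C = c0 * s ^+ 2 + c1 * s * t + A * t ^+ 2.
  apply: (padic_mulI p_prime (padic_two_neq0 p_prime)).
  transitivity ((c2 * s + B * t + C *+ 2) - c2 * s - B * t); first by ring.
  by rewrite e2 c2E BE; ring.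
apply: good_ext (good_quad_density p_prime F c0 c1 A) => k; congr (_ * _).
rewrite -[LHS](avg_cst p_prime k); apply: eq_avg => y.
have uN : ~~ pdvd 1 (1 - s * y).
  by rewrite pdvdDr ?pdvd11 // pdvdN //; apply: pdvdMr.
have gP := @periodic_quad2l c0 c1 c2 A B C k k y (leqnn k).
rewrite -(avg_affine p_prime (t * y) gP uN); apply: eq_avg => z.
rewrite (_ : quad2 _ _ _ _ _ _ _ _ = (1 - s * y) * ((1 - s * y) * quad c0 c1 A z)).
  by rewrite !pdvd_unitM.
by rewrite /quad2 /quad c2E BE CE; ring.
Qed.

(** The Gram matrix of the homogenised polynomial is either regular, or has a
    primitive kernel vector, the vertex of a cone. The vertex is moved to the
    origin when it is finite modulo [p]; otherwise it has a unit among its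
    coordinates at infinity, up to exchanging the variables. *)
Theorem good_quad2_density c0 c1 c2 A B C : good_density (quad2_density c0 c1 c2 A B C).
Proof.
pose det := c0 *+ 2 * (A *+ 2 * (C *+ 2) - B ^+ 2) + c1 * (B * c2 - C *+ 2 * c1)
  + c2 * (c1 * B - A *+ 2 * c2).
have [det0|] := eqVneq det 0; last exact: good_quad2_density_smooth.
have [u0 [u1 [u2 [unz e0 e1 e2]]]] := symmetric_kernel det0.
have [k [v0 [v1 [v2 [u0E u1E u2E vN]]]]] := primitive_multiple p_prime unz.
have descend a b c : a * u0 + b * u1 + c * u2 = 0 -> a * v0 + b * v1 + c * v2 = 0.
  move=> abc; apply: (pexp_torsion_free p_prime (k := k)).
  by rewrite -abc u0E u1E u2E; ring.
move: e0 e1 e2 => /descend e0 /descend e1 /descend e2.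
have [v0N|v0U] := boolP (pdvd 1 v0); last first.
  have [w wv0] := padic_unit p_prime v0U; pose r := w * v1; pose s := w * v2.
  have scale a b c : a * v0 + b * v1 + c * v2 = 0 -> a + b * r + c * s = 0.
    move=> abc; transitivity (w * (a * v0 + b * v1 + c * v2) + (1 - w * v0) * a).
      by rewrite /r /s; ring.
    by rewrite abc wv0; ring.
  move: e0 e1 e2 => /scale e0 /scale e1 /scale e2.
  have q0 : quad2 c0 c1 c2 A B C r s = 0.
    apply: (padic_mulI p_prime (padic_two_neq0 p_prime)).
    transitivity (c0 *+ 2 + c1 * r + c2 * s + r * (c1 + A *+ 2 * r + B * s)
      + s * (c2 + B * r + C *+ 2 * s)); first by rewrite /quad2 /quad; ring.
    by rewrite e0 e1 e2; ring.
  apply: good_ext (good_quad2_density_form A B C) => m; congr (_ * _).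
  rewrite [RHS]/quad2_density -[RHS](avg_shift p_prime s); last first.
    by apply: periodic_avg => x; apply: periodic_quad2r.
  apply: eq_avg => y; rewrite -[RHS](avg_shift p_prime r); last exact: periodic_quad2l.
  apply: eq_avg => x; congr (pdvd _ _)%:R.
  transitivity (quad2 c0 c1 c2 A B C r s + x * (c1 + A *+ 2 * r + B * s)
      + y * (c2 + B * r + C *+ 2 * s) + quad2 0 0 0 A B C x y).
    by rewrite q0 e1 e2; ring.
  by rewrite /quad2 /quad; ring.
have [v2N|v2U] := boolP (pdvd 1 v2).
  have v1U : ~~ pdvd 1 v1 by move: vN; rewrite v0N v2N andbT.
  have [w wv1] := padic_unit p_prime v1U.
  have scale a b c : a * v0 + b * v1 + c * v2 = 0 -> a * (w * v0) + c * (w * v2) + b = 0.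
    move=> abc; transitivity (w * (a * v0 + b * v1 + c * v2) + (1 - w * v1) * b).
      by ring.
    by rewrite abc wv1; ring.
  rewrite quad2_density_swap; apply: (@good_quad2_density_cone _ _ _ _ _ _ (w * v0) (w * v2));
    [exact: pdvdMl|exact: scale..].
have [w wv2] := padic_unit p_prime v2U.
have scale a b c : a * v0 + b * v1 + c * v2 = 0 -> a * (w * v0) + b * (w * v1) + c = 0.
  move=> abc; transitivity (w * (a * v0 + b * v1 + c * v2) + (1 - w * v2) * c).
    by ring.
  by rewrite abc wv2; ring.
by apply: (@good_quad2_density_cone _ _ _ _ _ _ (w * v0) (w * v1));
  [exact: pdvdMl|exact: scale..].
Qed.

End BinaryQuadraticDensities.

(** * Lattices relative to a frame of the Lie algebra *)

Section Frames.
Variables (p : nat) (p_prime : prime p) (L : lieAlgType (padicInt p)).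
Local Notation Zp := (padicInt p).
Local Open Scope classical_set_scope.
Implicit Types (x y z : L) (a b c : Zp).

(** A basis together with its coordinate functions, so that no choice of
    coordinates is needed later. *)
Record is_frame (e1 e2 e3 : L) (X Y Z : L -> Zp) : Prop := IsFrame {
  frame_expand : forall x, x = X x *: e1 + Y x *: e2 + Z x *: e3;
  frame_coord : forall a b c, [/\ X (a *: e1 + b *: e2 + c *: e3) = a,
    Y (a *: e1 + b *: e2 + c *: e3) = b & Z (a *: e1 + b *: e2 + c *: e3) = c] }.

Lemma frame_of_free : free_of_rank L 3 -> exists e1 e2 e3 X Y Z, is_frame e1 e2 e3 X Y Z.
Proof.
move=> [e eP]; pose e1 := e 0; pose e2 := e 1; pose e3 := e 2%:R.
have sum3 (c : 'rV[Zp]_3) : \sum_i c 0 i *: e i = c 0 0 *: e1 + c 0 1 *: e2 + c 0 2%:R *: e3.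
  rewrite !big_ord_recl big_ord0 addr0 addrA; congr (_ + _ *: _ + _ *: _);
  by congr (_ _) || congr (_ _ _); apply: val_inj.
have coord x := cid (eP x).
exists e1, e2, e3, (fun x => sval (coord x) 0 0), (fun x => sval (coord x) 0 1),
  (fun x => sval (coord x) 0 2%:R); split.
  by move=> x; rewrite -sum3; case: (coord x) => c /= [].
move=> a b c; case: (coord _) => u /= [_ uniq_u].
pose v : 'rV[Zp]_3 := \row_i [:: a; b; c]`_i.
by rewrite (uniq_u v) ?sum3 !mxE.
Qed.

Section Frame.
Variables (e1 e2 e3 : L) (X Y Z : L -> Zp).
Hypothesis frame : is_frame e1 e2 e3 X Y Z.
Let expand := frame_expand frame.
Let coord := frame_coord frame.

Lemma frame_rotate : is_frame e2 e3 e1 Y Z X.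
Proof.
split=> [x|a b c]; first by rewrite {1}(expand x) -addrA addrC.
by have [] := coord c a b; rewrite -addrA addrC.
Qed.

Lemma frame_linear c x y :
  [/\ X (c *: x + y) = c * X x + X y, Y (c *: x + y) = c * Y x + Y y &
      Z (c *: x + y) = c * Z x + Z y].
Proof.
rewrite {1 3 5}(expand x) {1 3 5}(expand y).
rewrite !scalerDr !scalerA [_ + (_ + _ *: e3)]addrACA [_ + (_ + _ *: e2)]addrACA -!scalerDl.
exact: coord.
Qed.

Lemma frame_ext x y : X x = X y -> Y x = Y y -> Z x = Z y -> x = y.
Proof. by move=> xX xY xZ; have := expand x; rewrite xX xY xZ -expand. Qed.

Lemma frame0 : [/\ X 0 = 0, Y 0 = 0 & Z 0 = 0].
Proof. by have [] := coord 0 0 0; rewrite !scale0r !addr0. Qed.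

Lemma frame_e1 a : [/\ X (a *: e1) = a, Y (a *: e1) = 0 & Z (a *: e1) = 0].
Proof. by have [] := coord a 0 0; rewrite !scale0r !addr0. Qed.

Lemma frame_e2 a : [/\ X (a *: e2) = 0, Y (a *: e2) = a & Z (a *: e2) = 0].
Proof. by have [] := coord 0 a 0; rewrite !scale0r !addr0 add0r. Qed.

Lemma frame_e3 a : [/\ X (a *: e3) = 0, Y (a *: e3) = 0 & Z (a *: e3) = a].
Proof. by have [] := coord 0 0 a; rewrite !scale0r !add0r. Qed.

Lemma lieD x y z : lie x (y + z) = lie x y + lie x z.
Proof. by rewrite -[y]scale1r lie_linearr !scale1r. Qed.

Lemma lieDl x y z : lie (x + y) z = lie x z + lie y z.
Proof. by rewrite -[x]scale1r lie_linearl !scale1r. Qed.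

Lemma lie0r x : lie x 0 = 0.
Proof. exact: linear0. Qed.

Lemma lie0l x : lie 0 x = 0.
Proof. by apply: (addrI (lie 0 x)); rewrite -lieDl !addr0. Qed.

Lemma lieZr c x y : lie x (c *: y) = c *: lie x y.
Proof. by rewrite -[c *: y]addr0 lie_linearr lie0r addr0. Qed.

Lemma lieZl c x y : lie (c *: x) y = c *: lie x y.
Proof. by rewrite -[c *: x]addr0 lie_linearl lie0l addr0. Qed.

Lemma lie_anti x y : lie y x = - lie x y.
Proof.
have := liexx (x + y); rewrite lieD !lieDl !liexx add0r addr0 => /eqP.
by rewrite addr_eq0 => /eqP.
Qed.

Let b1 := lie e2 e3.
Let b2 := lie e3 e1.
Let b3 := lie e1 e2.

Lemma frame_lie x y :
  lie x y = (Y x * Z y - Z x * Y y) *: b1 + (Z x * X y - X x * Z y) *: b2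
          + (X x * Y y - Y x * X y) *: b3.
Proof.
rewrite {1}(expand x) {1}(expand y) !lieD !lieDl !lieZr !lieZl !liexx !scaler0.
rewrite (lie_anti e1 e2) (lie_anti e3 e1) (lie_anti e2 e3) -/b1 -/b2 -/b3.
rewrite !scalerN !scalerBl !scalerA.
rewrite sub0r !addr0 ![X y * _]mulrC ![Y y * _]mulrC ![Z y * _]mulrC.
by rewrite [LHS](AC ((2*2)*2) (((6*4)*(2*5))*(3*1))).
Qed.

(** The projection to the last two coordinates is spanned by [(p^al, 0)] and
    [(y, p^be)], and the elements satisfy the linear congruence
    [X + a Y + b Z = 0] modulo [p^N]. *)
Definition lattice N al be (y a b : Zp) : set L := [set x |
  exists r s t, [/\ X x = p%:R ^+ N * r - a * Y x - b * Z x,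
    Y x = p%:R ^+ al * s + y * t & Z x = p%:R ^+ be * t]].

Section Lattice.
Variables (N al be : nat) (y a b : Zp).
Local Notation H := (lattice N al be y a b).

Lemma lattice0 : H 0.
Proof. by exists 0, 0, 0; have [-> -> ->] := frame0; split; ring. Qed.

Lemma latticeP c x x' : H x -> H x' -> H (c *: x + x').
Proof.
move=> [r [s [t [Xx Yx Zx]]]] [r' [s' [t' [Xx' Yx' Zx']]]].
exists (c * r + r'), (c * s + s'), (c * t + t').
by have [-> -> ->] := frame_linear c x x'; rewrite Xx Yx Zx Xx' Yx' Zx'; split; ring.
Qed.

Lemma lattice_pN x : (al <= N)%N -> (be <= N)%N -> pdvd al (p%:R ^+ (N - be) * y) ->
  H (p%:R ^+ N *: x).
Proof.
move=> alN beN /(pdvdP p_prime)[u yu].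
have [XE YE ZE] := frame_linear (p%:R ^+ N) x 0; move: XE YE ZE.
have [-> -> ->] := frame0; rewrite !addr0 => XE YE ZE.
exists (X x + a * Y x + b * Z x), (p%:R ^+ (N - al) * Y x - u * Z x), (p%:R ^+ (N - be) * Z x).
have alE : p%:R ^+ al * p%:R ^+ (N - al) = p%:R ^+ N :> Zp by rewrite -exprD subnKC.
have beE : p%:R ^+ be * p%:R ^+ (N - be) = p%:R ^+ N :> Zp by rewrite -exprD subnKC.
rewrite XE YE ZE; split; first by ring.
  transitivity (p%:R ^+ al * p%:R ^+ (N - al) * Y x - p%:R ^+ al * u * Z x
    + p%:R ^+ (N - be) * y * Z x); last by ring.
  by rewrite alE yu; ring.
by rewrite mulrA beE.
Qed.

(** Modulo [p^N L], which lies in the lattice, an element is determined by its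
    projection to a plane, so the bracket of two elements is a determinant, a
    multiple of [p^(al+be)], times the bracket [V] of two fixed vectors. The
    projection of [p^(al+be) V] lies in the projection of the lattice, so that
    only the linear congruence remains: it says that [p^(al+be)] times the
    quadratic form of the Lie algebra at [(1, a, b)] vanishes modulo [p^N]. *)
Lemma lattice_subalgebra :
    (al <= N)%N -> (be <= N)%N -> pdvd al (p%:R ^+ (N - be) * y) ->
  lie_subalgebra H <->
  pdvd N (p%:R ^+ (al + be) * quad2 (X b1) (X b2 + Y b1) (X b3 + Z b1) (Y b2)
     (Y b3 + Z b2) (Z b3) a b).
Proof.
move=> alN beN yP; set q := quad2 _ _ _ _ _ _ _ _.
pose V := b1 + a *: b2 + b *: b3.
have [XV YV ZV] : [/\ X V = X b1 + a * X b2 + b * X b3,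
    Y V = Y b1 + a * Y b2 + b * Y b3 & Z V = Z b1 + a * Z b2 + b * Z b3].
  rewrite /V -addrA addrC [_ + b *: b3]addrC -addrA.
  have [-> -> ->] := frame_linear b b3 (a *: b2 + b1).
  have [-> -> ->] := frame_linear a b2 b1.
  by split; ring.
have qE : q = X V + a * Y V + b * Z V by rewrite XV YV ZV /q /quad2 /quad; ring.
have scaleE c x : [/\ X (c *: x) = c * X x, Y (c *: x) = c * Y x & Z (c *: x) = c * Z x].
  by have := frame_linear c x 0; rewrite addr0; have [-> -> ->] := frame0; rewrite !addr0.
have HV c : H ((p%:R ^+ (al + be) * c) *: V) <-> pdvd N (p%:R ^+ (al + be) * c * q).
  rewrite /lattice /=; have [-> -> ->] := scaleE (p%:R ^+ (al + be) * c) V.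
  split.
    move=> [r [_ [_ [XE _ _]]]].
    apply/(pdvdP p_prime); exists r; rewrite qE.
    transitivity (p%:R ^+ (al + be) * c * X V + b * (p%:R ^+ (al + be) * c * Z V)
      + a * (p%:R ^+ (al + be) * c * Y V)); first by ring.
    by rewrite XE; ring.
  move=> /(pdvdP p_prime)[r qr]; exists r, (c * (p%:R ^+ be * Y V - y * Z V)),
    (p%:R ^+ al * c * Z V).
  by rewrite -qr qE exprD; split; ring.
split=> [Hsub|qP].
  have := HV 1; rewrite mulr1 => -[+ _]; apply.
  pose g := (- (a * p%:R ^+ al)) *: e1 + p%:R ^+ al *: e2 + 0 *: e3.
  pose h := (- (a * y + b * p%:R ^+ be)) *: e1 + y *: e2 + p%:R ^+ be *: e3.
  have [Xg Yg Zg] : [/\ X g = - (a * p%:R ^+ al), Y g = p%:R ^+ al & Z g = 0] := coord _ _ _.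
  have [Xh Yh Zh] : [/\ X h = - (a * y + b * p%:R ^+ be), Y h = y & Z h = p%:R ^+ be] :=
    coord _ _ _.
  have Hg : H g by exists 0, 1, 0; rewrite Xg Yg Zg; split; ring.
  have Hh : H h by exists 0, 0, 1; rewrite Xh Yh Zh; split; ring.
  suff -> : p%:R ^+ (al + be) *: V = lie g h by apply: lie_subalgebra_lie.
  rewrite frame_lie Xg Yg Zg Xh Yh Zh /V !scalerDr !scalerA exprD.
  by congr (_ *: _ + _ *: _ + _ *: _); ring.
split; [exact: lattice0|exact: latticeP|].
move=> x x' [r [s [t [Xx Yx Zx]]]] [r' [s' [t' [Xx' Yx' Zx']]]].
pose w := (Z x * r' - r * Z x') *: b2 + (r * Y x' - Y x * r') *: b3.
have -> : lie x x' = (p%:R ^+ (al + be) * (s * t' - t * s')) *: V + p%:R ^+ N *: w.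
  rewrite frame_lie /V /w !scalerDr !scalerA.
  rewrite [RHS](AC (3*2) ((1*(2*4))*(3*5))).
  rewrite /= -!scalerDl.
  rewrite Xx Yx Zx Xx' Yx' Zx' exprD.
  by congr (_ *: _ + _ *: _ + _ *: _); ring.
have Hw : H (p%:R ^+ N *: w) by apply: lattice_pN.
rewrite -[_ *: V]scale1r; apply: latticeP => //; apply/HV.
by rewrite mulrAC mulrC pdvdMl.
Qed.

Lemma latticeB x x' : H x -> H x' -> H (x' - x).
Proof. by move=> Hx Hx'; rewrite addrC -scaleN1r; apply: latticeP. Qed.

Lemma lattice_transversal x : exists i j l, [/\ (i < p ^ N)%N, (j < p ^ al)%N, (l < p ^ be)%N &
  H (x - (i%:R *: e1 + j%:R *: e2 + l%:R *: e3))].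
Proof.
pose l := padic_mod be (Z x).
have [t tE] := elimT (pdvdP p_prime _ _) (pdvd_padic_mod p_prime be (Z x)).
pose j := padic_mod al (Y x - y * t).
have [s sE] := elimT (pdvdP p_prime _ _) (pdvd_padic_mod p_prime al (Y x - y * t)).
pose c := X x + a * (Y x - j%:R) + b * (Z x - l%:R); pose i := padic_mod N c.
have [r rE] := elimT (pdvdP p_prime _ _) (pdvd_padic_mod p_prime N c).
exists i, j, l; split; rewrite ?padic_mod_lt //; exists r, s, t.
rewrite addrC -scaleN1r.
have [-> -> ->] := frame_linear (-1) (i%:R *: e1 + j%:R *: e2 + l%:R *: e3) x.
have [-> -> ->] := coord i%:R j%:R l%:R.
by rewrite -sE -rE -tE /c /i /j /l; split; ring.
Qed.

Lemma lattice_box_inj i j l i' j' l' :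
    (i < p ^ N)%N -> (j < p ^ al)%N -> (l < p ^ be)%N ->
    (i' < p ^ N)%N -> (j' < p ^ al)%N -> (l' < p ^ be)%N ->
    H ((i%:R *: e1 + j%:R *: e2 + l%:R *: e3) - (i'%:R *: e1 + j'%:R *: e2 + l'%:R *: e3)) ->
  [/\ i = i', j = j' & l = l'].
Proof.
move=> iN jal lbe i'N j'al l'be [r [s [t]]].
rewrite addrC -scaleN1r; have [-> -> ->] := frame_linear (-1)
  (i'%:R *: e1 + j'%:R *: e2 + l'%:R *: e3) (i%:R *: e1 + j%:R *: e2 + l%:R *: e3).
have [-> -> ->] := coord i%:R j%:R l%:R; have [-> -> ->] := coord i'%:R j'%:R l'%:R.
rewrite !mulN1r ![- _ + _]addrC => -[Xr Ys Zt].
have lE : l = l' by apply: (pdvd_nat_inj p_prime) lbe l'be _; rewrite Zt pdvd_exp.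
have t0 : t = 0.
  by apply: (@pexp_torsion_free _ p_prime be); rewrite -Zt lE subrr.
have jE : j = j' by apply: (pdvd_nat_inj p_prime) jal j'al _; rewrite Ys t0 mulr0 addr0 pdvd_exp.
split=> //; apply: (pdvd_nat_inj p_prime) iN i'N _.
by rewrite Xr lE jE !subrr !mulr0 !subr0 pdvd_exp.
Qed.

Lemma cosets_eq x x' : [set x + h | h in H] = [set x' + h | h in H] <-> H (x - x').
Proof.
split=> [E|Hxx'].
  have : [set x + h | h in H] x by exists 0; rewrite ?addr0 //; apply: lattice0.
  by rewrite E => -[h Hh <-]; rewrite addrC addKr.
have sub z z' : H (z - z') -> [set z + h | h in H] `<=` [set z' + h | h in H].
  move=> Hz _ [h Hh <-]; exists (1 *: h + (z - z')); first exact: latticeP.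
  by rewrite scale1r [h + _]addrC addrA subrKC.
apply/seteqP; split; apply: sub => //.
by rewrite -opprB -sub0r; apply: latticeB => //; apply: lattice0.
Qed.

Let box : finType := ('I_(p ^ N) * 'I_(p ^ al) * 'I_(p ^ be))%type.
Let corner (d : box) : L := d.1.1%:R *: e1 + d.1.2%:R *: e2 + d.2%:R *: e3.

Lemma cosets_lattice : cosets H = [set [set corner d + h | h in H] | d in [set: box]].
Proof.
apply/seteqP; split=> [_ [x _ <-]|_ [d _ <-]]; last by exists (corner d).
have [i [j [l [iN jal lbe Hx]]]] := lattice_transversal x.
by exists (Ordinal iN, Ordinal jal, Ordinal lbe) => //; apply/esym/cosets_eq.
Qed.

Lemma finite_cosets_lattice : finite_set (cosets H).
Proof. by rewrite cosets_lattice; apply: finite_image; apply: finite_finset. Qed.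

Lemma lie_index_lattice : lie_index H = (p ^ (N + al + be))%N.
Proof.
rewrite /lie_index cosets_lattice fset_set_image; last exact: finite_finset.
rewrite card_in_imfset /=; last first.
  move=> [[i j] l] [[i' j'] l'] _ _ /cosets_eq/lattice_box_inj[] //= *.
  by congr (_, _, _); apply: val_inj.
have -> : #|` fset_set [set: box]| = #|{: box}|.
  have -> : fset_set [set: box] = [fset d in enum {: box}]%fset.
    apply/fsetP => d; rewrite (in_fset_set (finite_finset (X := [set: box]))).
    by rewrite in_setT !inE mem_enum.
  by rewrite card_fseq undup_id ?enum_uniq // cardE.
by rewrite !card_prod !card_ord !expnD.
Qed.
End Lattice.


End Frame.
End Frames.

(** * Hermite normal forms *)

Section HermiteForms.
Variables (p : nat) (p_prime : prime p) (L : lieAlgType (padicInt p)).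
Local Notation Zp := (padicInt p).
Local Open Scope classical_set_scope.
Variables (e1 e2 e3 : L) (X Y Z : L -> Zp) (frame : is_frame e1 e2 e3 X Y Z).
Variables f2 f3 : nat.
Implicit Types (x : L) (N al be y a b n : nat) (H : set L).

(** The ranges make the parameters unique. The parameters [a] and [b] count
    multiples of [p ^ f2] and [p ^ f3], as forced by strict domination. *)
Definition hermite N al be y a b : bool :=
  [&& (al + f2 <= N)%N, (be + f3 <= N)%N, (y < p ^ al)%N, (p ^ al %| p ^ (N - f3 - be) * y)%N,
      (a < p ^ (N - f2 - al))%N & (b < p ^ (N - f3 - be))%N].

Definition hermite_lattice N al be y a b : set L :=
  lattice X Y Z N al be y%:R (p%:R ^+ f2 * a%:R) (p%:R ^+ f3 * b%:R).

(** The image of [e1] in [L / H] has maximal order [p ^ N] among the images of the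
    frame. The flags [f2] and [f3] make the inequality strict for [e2] or
    [e3], which breaks ties between the three rotations of a frame. *)
Definition dominant H N : Prop :=
  [/\ (f2 <= N)%N, (f3 <= N)%N, forall n, H (p%:R ^+ n *: e1) <-> (N <= n)%N,
      H (p%:R ^+ (N - f2) *: e2) & H (p%:R ^+ (N - f3) *: e3)].

Let pexpE k m : (k <= m)%N -> p%:R ^+ m = p%:R ^+ k * p%:R ^+ (m - k) :> Zp.
Proof. by move=> km; rewrite -exprD subnKC. Qed.

Lemma hermite_dominant N al be y a b :
  hermite N al be y a b -> dominant (hermite_lattice N al be y a b) N.
Proof.
case/and5P => alN beN _ yP _; split; [lia|lia| | |].
- move=> n; rewrite /hermite_lattice /lattice /=; have [-> -> ->] := frame_e1 frame (p%:R ^+ n).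
  rewrite -(pdvd_pexp p_prime N n); split.
    move=> [r [s [t [nr /esym st /esym t0]]]].
    by rewrite nr !mulr0 !subr0 pdvd_exp.
  move=> /(pdvdP p_prime)[r ->]; exists r, 0, 0; split; ring.
- have [XE YE ZE] := frame_e2 frame (p%:R ^+ (N - f2)).
  exists a%:R, (p%:R ^+ (N - f2 - al)), 0; rewrite XE YE ZE; split; last by ring.
    by rewrite (@pexpE f2 N); [ring|lia].
  by rewrite (@pexpE al (N - f2)%N); [ring|lia].
have [XE YE ZE] := frame_e3 frame (p%:R ^+ (N - f3)).
have : pdvd al (p%:R ^+ (N - f3 - be) * y%:R : Zp) by rewrite -natrX -natrM pdvd_nat.
move=> /(pdvdP p_prime)[u uE].
exists b%:R, (- u), (p%:R ^+ (N - f3 - be)); rewrite XE YE ZE; split.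
- by rewrite (@pexpE f3 N); [ring|lia].
- by rewrite mulrN -uE; ring.
by rewrite (@pexpE be (N - f3)%N); [ring|lia].
Qed.

Lemma lattice_generator2 N al be (y a b : Zp) :
  lattice X Y Z N al be y a b ((- (a * p%:R ^+ al)) *: e1 + p%:R ^+ al *: e2 + 0 *: e3).
Proof.
exists 0, 1, 0; have [-> -> ->] := frame_coord frame (- (a * p%:R ^+ al)) (p%:R ^+ al) 0.
by split; ring.
Qed.

Lemma lattice_generator3 N al be (y a b : Zp) :
  lattice X Y Z N al be y a b
    ((- (a * y + b * p%:R ^+ be)) *: e1 + y *: e2 + p%:R ^+ be *: e3).
Proof.
exists 0, 0, 1.
have [-> -> ->] := frame_coord frame (- (a * y + b * p%:R ^+ be)) y (p%:R ^+ be).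
by split; ring.
Qed.

Lemma lattice_levels N al be N' al' be' (y a b y' a' b' : Zp) :
    lattice X Y Z N al be y a b `<=` lattice X Y Z N' al' be' y' a' b' ->
  (be' <= be)%N /\ (al' <= al)%N.
Proof.
move=> sub; split.
  have [_ [_ [t [_ _]]]] := sub _ (lattice_generator3 N al be y a b).
  have [_ _ ->] := frame_coord frame (- (a * y + b * p%:R ^+ be)) y (p%:R ^+ be).
  by rewrite -(pdvd_pexp p_prime) => ->; apply: pdvd_exp.
have [_ [s [t [_]]]] := sub _ (lattice_generator2 N al be y a b).
have [_ -> ->] := frame_coord frame (- (a * p%:R ^+ al)) (p%:R ^+ al) 0.
move=> + /esym/(pexp_torsion_free p_prime) t0.
by rewrite t0 mulr0 addr0 -(pdvd_pexp p_prime) => ->; apply: pdvd_exp.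
Qed.

(** The parameters are recovered one after the other from the elements of the
    lattice with prescribed last coordinates. *)
Lemma hermite_inj N al be y a b N' al' be' y' a' b' :
    hermite N al be y a b -> hermite N' al' be' y' a' b' ->
    hermite_lattice N al be y a b = hermite_lattice N' al' be' y' a' b' ->
  [/\ N = N', al = al' & be = be'] /\ [/\ y = y', a = a' & b = b'].
Proof.
move=> hd hd' E.
have NE : N = N'.
  have [_ _ HN _ _] := hermite_dominant hd; have [_ _ HN' _ _] := hermite_dominant hd'.
  apply/eqP; rewrite eqn_leq; apply/andP; split.
    by apply/HN; rewrite E; apply/HN'.
  by apply/HN'; rewrite -E; apply/HN.
have [|be'be al'al] := lattice_levels (N := N) (N' := N')
  (al := al) (al' := al') (be := be) (be' := be')
  (y := y%:R) (a := p%:R ^+ f2 * a%:R) (b := p%:R ^+ f3 * b%:R)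
  (y' := y'%:R) (a' := p%:R ^+ f2 * a'%:R) (b' := p%:R ^+ f3 * b'%:R).
  by rewrite -/(hermite_lattice N al be y a b) E.
have [|bebe' alal'] := lattice_levels (N := N') (N' := N)
  (al := al') (al' := al) (be := be') (be' := be)
  (y := y'%:R) (a := p%:R ^+ f2 * a'%:R) (b := p%:R ^+ f3 * b'%:R)
  (y' := y%:R) (a' := p%:R ^+ f2 * a%:R) (b' := p%:R ^+ f3 * b%:R).
  by rewrite -/(hermite_lattice N' al' be' y' a' b') -E.
have {be'be bebe'} beE : be = be' by apply/eqP; rewrite eqn_leq bebe'.
have {al'al alal'} alE : al = al' by apply/eqP; rewrite eqn_leq alal'.
subst N' be' al'; case/and5P: hd hd' => alN beN y_lt yP /andP[a_lt b_lt].
case/and5P => _ _ y'_lt _ /andP[a'_lt b'_lt].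
have : hermite_lattice N al be y' a' b'
    ((- (p%:R ^+ f2 * a%:R * p%:R ^+ al)) *: e1 + p%:R ^+ al *: e2 + 0 *: e3).
  by rewrite -E; apply: lattice_generator2.
move=> [r [s [t []]]].
have [-> -> ->] := frame_coord frame (- (p%:R ^+ f2 * a%:R * p%:R ^+ al)) (p%:R ^+ al) 0.
move=> + _ _ => Ea.
have aE : a = a'.
  apply: (pdvd_nat_inj p_prime a_lt a'_lt).
  rewrite -(@pdvd_pexpM _ p_prime (f2 + al)).
  have -> : (f2 + al + (N - f2 - al) = N)%N by lia.
  apply/(pdvdP p_prime); exists (- r); rewrite exprD.
  transitivity (- (- (p%:R ^+ f2 * a%:R * p%:R ^+ al)) - p%:R ^+ f2 * a'%:R * p%:R ^+ al : Zp).
    by ring.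
  by rewrite Ea; ring.
subst a'.
have : hermite_lattice N al be y' a b'
    ((- (p%:R ^+ f2 * a%:R * y%:R + p%:R ^+ f3 * b%:R * p%:R ^+ be)) *: e1
      + y%:R *: e2 + p%:R ^+ be *: e3).
  by rewrite -E; apply: lattice_generator3.
move=> [{Ea}r [{}s [{}t []]]].
have [-> -> ->] := frame_coord frame
  (- (p%:R ^+ f2 * a%:R * y%:R + p%:R ^+ f3 * b%:R * p%:R ^+ be)) y%:R (p%:R ^+ be).
move=> Eb Ey /esym Et.
have t1 : t = 1 by apply: (@pexp_inj _ p_prime be); rewrite /= Et mulr1.
have yE : y = y'.
  by apply: (pdvd_nat_inj p_prime y_lt y'_lt); rewrite Ey t1 mulr1 addrK pdvd_exp.
subst y'; suff -> : b = b' by [].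
apply: (pdvd_nat_inj p_prime b_lt b'_lt); rewrite -(@pdvd_pexpM _ p_prime (f3 + be)).
have -> : (f3 + be + (N - f3 - be) = N)%N by lia.
apply/(pdvdP p_prime); exists (- r); rewrite exprD.
transitivity (- (- (p%:R ^+ f2 * a%:R * y%:R + p%:R ^+ f3 * b%:R * p%:R ^+ be))
  - p%:R ^+ f2 * a%:R * y%:R - p%:R ^+ f3 * b'%:R * p%:R ^+ be : Zp); first by ring.
by rewrite Eb; ring.
Qed.

(** Take elements of [H] whose last non-zero coordinates have the least
    valuations and reduce their other coordinates. The divisibilities required
    of the parameters come from the multiples of the frame vectors that
    dominance puts in [H]. *)
Lemma hermite_surj H N :
    H 0 -> (forall c x x', H x -> H x' -> H (c *: x + x')) -> dominant H N ->
  exists al be y a b, hermite N al be y a b /\ H = hermite_lattice N al be y a b.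
Proof.
move=> H0 Hlin [f2N f3N HN He2 He3].
have HZ c x : H x -> H (c *: x) by move=> Hx; rewrite -[c *: x]addr0; apply: Hlin.
have HD x x' : H x -> H x' -> H (x + x') by move=> Hx; rewrite -[x]scale1r; apply: Hlin.
have HB x x' : H x -> H x' -> H (x - x').
  by move=> Hx Hx'; rewrite addrC -scaleN1r; apply: Hlin.
have linE c x x' := frame_linear frame c x x'.
have XYZ0 := frame0 frame.
have least (I : Zp -> Prop) m : I (p%:R ^+ m) -> (forall c z, I z -> I (c * z)) ->
    exists k, [/\ (k <= m)%N, I (p%:R ^+ k) & forall z, I z -> pdvd k z].
  move=> Im Iscale; have exI : exists k, `[< I (p%:R ^+ k) >] by exists m; apply/asboolP.
  case: (ex_minnP exI) => k /asboolP Ik kmin.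
  exists k; split=> [| // |z Iz]; first by apply: kmin; apply/asboolP.
  have [->|/(padic_valuation p_prime)[v [u [zE /(padic_unit p_prime)[w wu]]]]] := eqVneq z 0.
    exact: pdvd0.
  rewrite zE pdvdMr // pdvd_pexp //; apply: kmin; apply/asboolP.
  have := Iscale w _ Iz; rewrite zE [w * (_ * _)]mulrCA wu mulr1; exact.
have H1 x : H x -> Y x = 0 -> Z x = 0 -> pdvd N (X x).
  have [||k [_ Hk kP]] := least (fun z => H (z *: e1)) N.
  - by apply/HN.
  - by move=> c z /(HZ c); rewrite scalerA.
  have /HN Nk := Hk; move=> Hx Yx Zx; apply: (pdvd_leq p_prime Nk); apply: kP.
  by have := frame_expand frame x; rewrite Yx Zx !scale0r !addr0 => <-.
have [|c _ [x [Hx Zx <-]]|al [alN [g [Hg Zg Yg]] alP]] :=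
    least (fun z => exists x, [/\ H x, Z x = 0 & Y x = z]) (N - f2)%N.
- exists (p%:R ^+ (N - f2) *: e2); have [_ -> ->] := frame_e2 frame (p%:R ^+ (N - f2)).
  by split.
- exists (c *: x); split; first exact: HZ.
    by have := linE c x 0; rewrite addr0; case: XYZ0 => -> -> -> [_ _ ->]; rewrite Zx; ring.
  by have := linE c x 0; rewrite addr0; case: XYZ0 => -> -> -> [_ -> _]; ring.
have [|c _ [x [Hx <-]]|be [beN [h0 [Hh0 Zh0]] beP]] :=
    least (fun z => exists x, H x /\ Z x = z) (N - f3)%N.
- by exists (p%:R ^+ (N - f3) *: e3); have [_ _ ->] := frame_e3 frame (p%:R ^+ (N - f3)).
- exists (c *: x); split; first exact: HZ.
  by have := linE c x 0; rewrite addr0; case: XYZ0 => -> -> -> [_ _ ->]; ring.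
have HpN x : Y x = 0 -> Z x = 0 -> pdvd N (X x) -> H x.
  move=> Yx Zx /(pdvdP p_prime)[r Xr]; rewrite (frame_expand frame x) Yx Zx !scale0r !addr0 Xr.
  by rewrite mulrC -scalerA; apply: HZ; apply/HN.
(* A multiple of p^N e1 brings the first coordinate of g to its normal form. *)
have /(pdvdP p_prime)[a0 a0E] : pdvd (f2 + al) (X g).
  rewrite -(@pdvd_pexpM _ p_prime (N - f2 - al)).
  have -> : (N - f2 - al + (f2 + al) = N)%N by lia.
  pose x := p%:R ^+ (N - f2 - al) *: g + (-1) *: (p%:R ^+ (N - f2) *: e2).
  have [Xx Yx Zx] := linE (p%:R ^+ (N - f2 - al)) g ((-1) *: (p%:R ^+ (N - f2) *: e2)).
  rewrite -/x scalerA in Xx Yx Zx; move: Xx Yx Zx.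
  have [-> -> ->] := frame_e2 frame (-1 * p%:R ^+ (N - f2)); rewrite addr0 => <- Yx Zx.
  apply: H1; first by apply: HD; [exact: HZ|apply: HZ].
    by rewrite Yx Yg -exprD subnK //; ring.
  by rewrite Zx Zg; ring.
pose a := padic_mod (N - f2 - al) (- a0); pose A : Zp := p%:R ^+ f2 * a%:R.
pose g1 : L := (- (A * p%:R ^+ al)) *: e1 + p%:R ^+ al *: e2 + 0 *: e3.
have [Xg1 Yg1 Zg1] : [/\ X g1 = - (A * p%:R ^+ al), Y g1 = p%:R ^+ al & Z g1 = 0].
  exact: frame_coord.
have Hg1 : H g1.
  rewrite -[g1](subrK g); apply: HD => //; rewrite -[g1 - g]addrC -scaleN1r.
  have [XE YE ZE] := linE (-1) g g1; apply: HpN.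
  - by rewrite YE Yg Yg1; ring.
  - by rewrite ZE Zg Zg1; ring.
  rewrite XE Xg1 a0E.
  have -> : -1 * (p%:R ^+ (f2 + al) * a0) - A * p%:R ^+ al = p%:R ^+ (f2 + al) * (- a0 - a%:R).
    by rewrite /A exprD; ring.
  have -> : N = (f2 + al + (N - f2 - al))%N by lia.
  by rewrite pdvd_pexpM // pdvd_padic_mod.
(* A multiple of g1 reduces the second coordinate of h0 modulo p^al. *)
pose y := padic_mod al (Y h0).
have [s0 s0E] := elimT (pdvdP p_prime _ _) (pdvd_padic_mod p_prime al (Y h0)).
pose h1 := (- s0) *: g1 + h0; have Hh1 : H h1 by apply: Hlin.
have [Xh1 Yh1 Zh1] := linE (- s0) g1 h0.
have {}Yh1 : Y h1 = y%:R.
  rewrite Yh1 Yg1 mulNr mulrC -s0E /y; ring.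
have {}Zh1 : Z h1 = p%:R ^+ be by rewrite Zh1 Zg1 Zh0; ring.
pose x := p%:R ^+ (N - f3 - be) *: h1 + (-1) *: (p%:R ^+ (N - f3) *: e3).
have Hx : H x by apply: HD; [exact: HZ|apply: HZ].
have [Xx Yx Zx] : [/\ X x = p%:R ^+ (N - f3 - be) * X h1,
    Y x = p%:R ^+ (N - f3 - be) * y%:R & Z x = 0].
  have := linE (p%:R ^+ (N - f3 - be)) h1 ((-1) *: (p%:R ^+ (N - f3) *: e3)).
  rewrite -/x scalerA; have [-> -> ->] := frame_e3 frame (-1 * p%:R ^+ (N - f3)).
  by move=> [-> -> ->]; rewrite Yh1 Zh1 -exprD subnK //; split; ring.
have /(pdvdP p_prime)[u uE] : pdvd al (Y x) by apply: alP; exists x.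
have yP : (p ^ al %| p ^ (N - f3 - be) * y)%N.
  by rewrite -(pdvd_nat p_prime) natrM natrX -Yx uE pdvd_exp.
have /(pdvdP p_prime)[b0 b0E] : pdvd (f3 + be) (X h1 + A * y%:R).
  rewrite -(@pdvd_pexpM _ p_prime (N - f3 - be)).
  have -> : (N - f3 - be + (f3 + be) = N)%N by lia.
  have -> : p%:R ^+ (N - f3 - be) * (X h1 + A * y%:R) = X ((- u) *: g1 + x).
    have [-> _ _] := linE (- u) g1 x; rewrite Xx Xg1.
    transitivity (p%:R ^+ (N - f3 - be) * X h1 + A * (p%:R ^+ (N - f3 - be) * y%:R)).
      by ring.
    by rewrite -Yx uE; ring.
  have [_ YE ZE] := linE (- u) g1 x; apply: H1; first exact: Hlin.
    by rewrite YE Yg1 uE; ring.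
  by rewrite ZE Zg1 Zx; ring.
(* A multiple of p^N e1 then normalises the first coordinate of h1. *)
pose b := padic_mod (N - f3 - be) (- b0); pose B : Zp := p%:R ^+ f3 * b%:R.
pose h : L := (- (A * y%:R + B * p%:R ^+ be)) *: e1 + y%:R *: e2 + p%:R ^+ be *: e3.
have [Xh Yh Zh] : [/\ X h = - (A * y%:R + B * p%:R ^+ be), Y h = y%:R & Z h = p%:R ^+ be].
  exact: frame_coord.
have Hh : H h.
  rewrite -[h](subrK h1); apply: HD => //; rewrite -[h - h1]addrC -scaleN1r.
  have [XE YE ZE] := linE (-1) h1 h; apply: HpN.
  - by rewrite YE Yh Yh1; ring.
  - by rewrite ZE Zh Zh1; ring.
  rewrite XE Xh.
  have -> : -1 * X h1 - (A * y%:R + B * p%:R ^+ be) = p%:R ^+ (f3 + be) * (- b0 - b%:R).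
    transitivity (- (X h1 + A * y%:R) - B * p%:R ^+ be); first by ring.
    by rewrite b0E /B exprD; ring.
  have -> : N = (f3 + be + (N - f3 - be))%N by lia.
  by rewrite pdvd_pexpM // pdvd_padic_mod.
exists al, be, y, a, b; split.
  by rewrite /hermite !padic_mod_lt // yP !andbT; apply/andP; split; lia.
apply/seteqP; split=> [z Hz|z [r [s [t [Xz Yz Zz]]]]].
  have /(pdvdP p_prime)[t tE] : pdvd be (Z z) by apply: beP; exists z.
  pose z1 := (- t) *: h + z; have [Xz1 Yz1 Zz1] := linE (- t) h z.
  have Hz1 : H z1 by apply: Hlin.
  have {}Zz1 : Z z1 = 0 by rewrite Zz1 Zh tE; ring.
  have /(pdvdP p_prime)[s sE] : pdvd al (Y z1) by apply: alP; exists z1.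
  have [Xz2 Yz2 Zz2] := linE (- s) g1 z1.
  have /(pdvdP p_prime)[r rE] : pdvd N (X ((- s) *: g1 + z1)).
    apply: H1; first exact: Hlin.
      by rewrite Yz2 Yg1 sE; ring.
    by rewrite Zz2 Zg1 Zz1; ring.
  exists r, s, t; rewrite -/A -/B; split=> //; last first.
    by rewrite -sE Yz1 Yh; ring.
  have YzE : Y z = p%:R ^+ al * s + y%:R * t by rewrite -sE Yz1 Yh; ring.
  rewrite YzE tE -rE Xz2 Xg1 Xz1 Xh; ring.
have -> : z = r *: (p%:R ^+ N *: e1) + (s *: g1 + t *: h).
  have [XE YE ZE] := linE s g1 (t *: h).
  have := linE t h 0; rewrite addr0; case: XYZ0 => -> -> -> [XtE YtE ZtE].
  have [XrE YrE ZrE] := linE r (p%:R ^+ N *: e1) (s *: g1 + t *: h).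
  have [Xe Ye Ze] := frame_e1 frame (p%:R ^+ N).
  apply: (frame_ext frame).
  - by rewrite XrE Xe XE XtE Xg1 Xh Xz Yz Zz -/A -/B; ring.
  - by rewrite YrE Ye YE YtE Yg1 Yh Yz; ring.
  by rewrite ZrE Ze ZE ZtE Zg1 Zh Zz; ring.
by apply: Hlin; [apply/HN|apply: HD; apply: HZ].
Qed.

End HermiteForms.

(** * Classification of the subalgebras of finite index *)

Section Classification.
Variables (p : nat) (p_prime : prime p) (L : lieAlgType (padicInt p)).
Local Notation Zp := (padicInt p).
Local Open Scope classical_set_scope.
Variables (E : 'I_3 -> L) (C : 'I_3 -> L -> Zp).
Implicit Types (c : 'I_3) (x z : L) (N al be y a b n m : nat) (H : set L).

Definition rotated_frames := forall c,
  is_frame (E c) (E (c + 1)) (E (c + 1 + 1)) (C c) (C (c + 1)) (C (c + 1 + 1)).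

Hypothesis frames : rotated_frames.

(** The linear congruence satisfied by a lattice is a point of the projective
    plane, normalised by a coordinate equal to [1]. To count each
    point once, the coordinates that were normalised to [1] in the earlier
    charts are divisible by [p] in the later ones, as recorded by the flags. *)
Definition flag2 c : nat := (2 <= c)%N.
Definition flag3 c : nat := (1 <= c)%N.

Definition chart_dominant c H N :=
  dominant (E c) (E (c + 1)) (E (c + 1 + 1)) (flag2 c) (flag3 c) H N.

(** Two of the vectors [p^i x] are congruent modulo [H] by the pigeonhole principle,
    and [p^i - p^j] is [p^i] times a unit for [i < j]. *)
Lemma pexp_order H x : lie_subalgebra H -> finite_set (cosets H) ->
  exists n, H (p%:R ^+ n *: x).
Proof.
move=> [H0 Hlin _] finH.
have HZ (u : Zp) z : H z -> H (u *: z) by move=> Hz; rewrite -[u *: z]addr0; apply: Hlin.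
pose f n := [set p%:R ^+ n *: x + h | h in H].
have [i [j [ij fij]]] : exists i j, (i < j)%N /\ f i = f j.
  apply/not_existsP => noi; have f_inj : injective f.
    move=> i j fij; have [ij|ji|//] := ltngtP i j.
      by case: (noi i); exists j; split.
    by case: (noi j); exists i; split=> //; apply: esym.
  have : finite_set (f @^-1` cosets H) by apply: finite_preimage => // i j _ _ /f_inj.
  have -> : f @^-1` cosets H = [set: nat].
    by apply/seteqP; split=> // n _; exists (p%:R ^+ n *: x).
  exact: infinite_nat.
have : f i (p%:R ^+ i *: x) by exists 0; rewrite ?addr0.
rewrite fij => -[h Hh hE]; exists i.
have uN : ~~ pdvd 1 (1 - p%:R ^+ (j - i) : Zp).
  rewrite pdvdDr ?pdvd11 // pdvdN // pdvd_pexp // subn_gt0 //.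
have [w wu] := padic_unit p_prime uN.
have hE' : h = p%:R ^+ i * (1 - p%:R ^+ (j - i)) *: x.
  by rewrite mulrBr mulr1 -exprD subnKC ?(ltnW ij) // scalerBl -hE addrC addKr.
have -> : p%:R ^+ i *: x = w *: h.
  by rewrite hE' scalerA mulrCA wu mulr1.
exact: HZ.
Qed.

Lemma ord3_cases c : [\/ c = 0, c = 1 | c = 1 + 1].
Proof.
by case: c => [[|[|[|//]]] lt_c3]; [apply: Or31|apply: Or32|apply: Or33]; apply: val_inj.
Qed.

(** Rotate the frame so that the vector of largest order modulo [H] comes first,
    ties being resolved in favour of the earlier vector. *)
Lemma chart_exists H : lie_subalgebra H -> finite_set (cosets H) ->
  exists c N, chart_dominant c H N.
Proof.
move=> Hsub finH; have [H0 Hlin _] := Hsub.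
have HZ (u : Zp) z : H z -> H (u *: z) by move=> Hz; rewrite -[u *: z]addr0; apply: Hlin.
have order c : exists n, forall k, H (p%:R ^+ k *: E c) <-> (n <= k)%N.
  have exn : exists n, `[< H (p%:R ^+ n *: E c) >].
    by have [n Hn] := pexp_order (E c) Hsub finH; exists n; apply/asboolP.
  case: (ex_minnP exn) => n /asboolP Hn nmin; exists n => k; split=> [Hk|nk].
    exact/nmin/asboolP.
  by rewrite -(subnK nk) exprD -scalerA; apply: HZ.
have [[n0 H0E] [n1 H1E] [n2 H2E]] := And3 (order 0) (order 1) (order (1 + 1)).
have r3 : 1 + 1 + 1 = 0 :> 'I_3 by apply: val_inj.
rewrite /chart_dominant /dominant.
have [/andP[n10 n20]|] := boolP ((n1 <= n0) && (n2 <= n0))%N.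
  exists 0, n0; rewrite add0r !subn0; split=> //; [exact/H1E|exact/H2E].
have [n21 n0_small|n12 n0_small] := leqP n2 n1.
  exists 1, n1; rewrite r3 /flag2 /flag3 /= subn0.
  by split=> //; [lia|apply/H2E|apply/H0E; lia].
exists (1 + 1), n2; rewrite r3 add0r /flag2 /flag3 /=.
by split=> //; [lia|lia|apply/H0E; lia|apply/H1E; lia].
Qed.

Lemma chart_unique c c' H N N' :
  chart_dominant c H N -> chart_dominant c' H N' -> c = c'.
Proof.
have r3 : 1 + 1 + 1 = 0 :> 'I_3 by apply: val_inj.
rewrite /chart_dominant.
have [->|->|->] := ord3_cases c; have [->|->|->] := ord3_cases c' => //;
  rewrite ?r3 ?add0r /flag2 /flag3 /= => -[c1 c2 c3 c4 c5] [d1 d2 d3 d4 d5];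
  do ?[move: c4 => /d3]; do ?[move: c5 => /d3]; do ?[move: d4 => /c3]; do ?[move: d5 => /c3];
  rewrite ?subn0; lia.
Qed.

Definition chart_form c : Zp -> Zp -> Zp :=
  let b1 := lie (E (c + 1)) (E (c + 1 + 1)) in
  let b2 := lie (E (c + 1 + 1)) (E c) in
  let b3 := lie (E c) (E (c + 1)) in
  let X := C c in let Y := C (c + 1) in let Z := C (c + 1 + 1) in
  quad2 (X b1) (X b2 + Y b1) (X b3 + Z b1) (Y b2) (Y b3 + Z b2) (Z b3).

Definition box m : finType :=
  ('I_3 * ('I_m.+1 * 'I_m.+1 * 'I_m.+1) * ('I_(p ^ m) * 'I_(p ^ m) * 'I_(p ^ m)))%type.

Definition admissible c N al be y a b : bool :=
  hermite p (flag2 c) (flag3 c) N al be y a b &&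
  pdvd N (p%:R ^+ (al + be) *
    chart_form c (p%:R ^+ flag2 c * a%:R) (p%:R ^+ flag3 c * b%:R)).

Definition chart_lattice c N al be y a b : set L :=
  hermite_lattice (C c) (C (c + 1)) (C (c + 1 + 1)) (flag2 c) (flag3 c) N al be y a b.

Lemma admissible_subalgebra c N al be y a b : admissible c N al be y a b ->
  fin_index_subalgebras (chart_lattice c N al be y a b).
Proof.
move=> /andP[hd qP]; split; last exact: (finite_cosets_lattice p_prime (frames c)).
case/and5P: hd => alN beN _ yP _.
apply/(lattice_subalgebra p_prime (frames c) _ _) => //; [lia|lia|].
rewrite -natrX -natrM pdvd_nat //; apply: dvdn_trans yP _.
by rewrite dvdn_mul // dvdn_exp2l //; lia.
Qed.

Lemma lie_index_chart_lattice c N al be y a b :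
  lie_index (chart_lattice c N al be y a b) = (p ^ (N + al + be))%N.
Proof. exact: (lie_index_lattice p_prime (frames c)). Qed.

Definition data m := [set d : box m | let: (c, (N, al, be), (y, a, b)) := d in
  (N + al + be == m)%N && admissible c N al be y a b]%SET.

Definition lattice_of m (d : box m) : set L :=
  let: (c, (N, al, be), (y, a, b)) := d in chart_lattice c N al be y a b.

Lemma data_subalgebra m (d : box m) : d \in data m ->
  fin_index_subalgebras (lattice_of d) /\ lie_index (lattice_of d) = (p ^ m)%N.
Proof.
case: d => [[c [[N al] be]] [[y a] b]]; rewrite inE => /andP[/eqP mE dP]; split.
  exact: admissible_subalgebra.
by rewrite /lattice_of lie_index_chart_lattice mE.
Qed.

Lemma lattice_of_inj m : {in data m &, injective (@lattice_of m)}.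
Proof.
case=> [[c [[N al] be]] [[y a] b]] [[c' [[N' al'] be']] [[y' a'] b']].
rewrite !inE => /andP[_ /andP[hd _]] /andP[_ /andP[hd' _]] /= HE.
have dom := hermite_dominant p_prime (frames c) hd.
have dom' := hermite_dominant p_prime (frames c') hd'.
have cE : c = c'.
  by apply: (chart_unique dom); rewrite -/(chart_lattice _ _ _ _ _ _ _) HE; exact: dom'.
subst c'; have [[NE alE beE] [yE aE bE]] := hermite_inj p_prime (frames c) hd hd' HE.
by congr (_, (_, _, _), (_, _, _)); apply: val_inj.
Qed.

Lemma data_surj H : fin_index_subalgebras H ->
  exists m, exists2 d : box m, d \in data m & lattice_of d = H.
Proof.
move=> [Hsub finH]; have [c [N dom]] := chart_exists Hsub finH.
have [H0 Hlin _] := Hsub.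
have [al [be [y [a [b [hd HE]]]]]] := hermite_surj p_prime (frames c) H0 Hlin dom.
have qP : admissible c N al be y a b.
  rewrite /admissible hd /=; case/and5P: hd => alN beN _ yP _.
  apply/(lattice_subalgebra p_prime (frames c) (y := y%:R)); [lia|lia| |].
    rewrite -natrX -natrM pdvd_nat //; apply: dvdn_trans yP _.
    by rewrite dvdn_mul // dvdn_exp2l //; lia.
  by move: Hsub; rewrite HE.
case/and5P: (hd) => alN beN y_lt _ /andP[a_lt b_lt].
pose m := (N + al + be)%N; exists m.
have lt_m k n : (n < p ^ k)%N -> (k <= m)%N -> (n < p ^ m)%N.
  by move=> nk km; rewrite (leq_trans nk) // leq_exp2l // prime_gt1.
have [N_lt al_lt be_lt] : [/\ (N < m.+1)%N, (al < m.+1)%N & (be < m.+1)%N].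
  by rewrite /m; split; lia.
have ym : (y < p ^ m)%N by apply: lt_m y_lt _; lia.
have am : (a < p ^ m)%N by apply: lt_m a_lt _; rewrite /m; lia.
have bm : (b < p ^ m)%N by apply: lt_m b_lt _; rewrite /m; lia.
by exists (c, (Ordinal N_lt, Ordinal al_lt, Ordinal be_lt), (Ordinal ym, Ordinal am, Ordinal bm));
  rewrite ?inE /= ?eqxx.
Qed.

End Classification.

Lemma rotated_frames_of_free p (L : lieAlgType (padicInt p)) : free_of_rank L 3 ->
  exists E C, @rotated_frames p L E C.
Proof.
move=> /frame_of_free[e1 [e2 [e3 [X [Y [Z frame]]]]]].
exists (fun c : 'I_3 => [:: e1; e2; e3]`_c), (fun c : 'I_3 => nth X [:: X; Y; Z] c) => c.
have [->|->|->] := ord3_cases c => //; first exact: frame_rotate.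
exact/frame_rotate/frame_rotate.
Qed.

(** * Sums over the parameters of Hermite normal forms *)

Section CountGoodness.
Variables (p : nat) (p_prime : prime p) (F : numFieldType).
Local Notation Zp := (padicInt p).
Implicit Types (N al be m k f g : nat).

Let p_gt0 : (0 < p)%N. Proof. exact: prime_gt0. Qed.

(** Substituting [p^f x] for [x] makes the polynomial depend on [x] modulo
    [p^(k-f)] only, so averaging at that coarser level suffices. *)
Lemma scaled_quad2_average (c0 c1 c2 A B C : Zp) f g k m n : (k <= f + m)%N -> (k <= g + n)%N ->
  avg n (fun y => avg m (fun x =>
    (pdvd k (quad2 c0 c1 c2 A B C (p%:R ^+ f * x) (p%:R ^+ g * y)))%:R)) =
  quad2_density F c0 (p%:R ^+ f * c1) (p%:R ^+ g * c2) (p%:R ^+ f * p%:R ^+ f * A)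
    (p%:R ^+ f * p%:R ^+ g * B) (p%:R ^+ g * p%:R ^+ g * C) k.
Proof.
move=> km kn; set G := fun x y : Zp =>
  (pdvd k (quad2 c0 c1 c2 A B C (p%:R ^+ f * x) (p%:R ^+ g * y)))%:R : F.
have scale j i (x y : Zp) : (k <= j + i)%N -> pdvd i (x - y) ->
    pdvd k (p%:R ^+ j * x - p%:R ^+ j * y).
  by move=> kji xy; rewrite -mulrBr (pdvd_leq p_prime kji) // pdvd_pexpM.
have GPx i y : (k <= f + i)%N -> periodic i (G^~ y).
  by move=> ki x x' /(scale _ _ _ _ ki); apply: periodic_quad2l.
have GPy i x : (k <= g + i)%N -> periodic i (G x).
  by move=> ki y y' /(scale _ _ _ _ ki); apply: periodic_quad2r.
have level j i i' (h : Zp -> F) : (k <= j + i)%N -> (k <= j + i')%N ->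
    (forall i, (k <= j + i)%N -> periodic i h) -> avg i h = avg i' h.
  move=> ki ki' hP; rewrite (avg_level p_prime (K := k - j) (m := i)); [|lia|by apply: hP; lia].
  by rewrite (avg_level p_prime (K := k - j) (m := i')); [|lia|by apply: hP; lia].
rewrite /quad2_density (level g n k) //; [|exact: leq_addl|]; last first.
  by move=> i ki; apply: periodic_avg => x; apply: GPy.
apply: eq_avg => y; rewrite (level f m k) //; [|exact: leq_addl|]; last first.
  by move=> i; apply: GPx.
by apply: eq_avg => x; congr (pdvd _ _)%:R; rewrite /quad2 /quad; ring.
Qed.

Lemma sum_ord_ltn (M n : nat) (u : nat -> F) : (n <= M)%N ->
  \sum_(i < M) (i < n)%:R * u i = \sum_(i < n) u i.
Proof.
move=> nM; rewrite (big_ord_widen M u nM) [RHS]big_mkcond; apply: eq_bigr => i _.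
by case: ifP; rewrite ?mul1r ?mul0r.
Qed.

Lemma sum_divisible al b m : (al <= m)%N ->
  \sum_(y < p ^ m) ((y < p ^ al)%N && (p ^ al %| p ^ b * y)%N)%:R = (p ^ minn al b)%:R :> F.
Proof.
move=> alm; under eq_bigr => y _ do rewrite -mulnb natrM.
rewrite (@sum_ord_ltn _ _ (fun y => (p ^ al %| p ^ b * y)%:R)) ?leq_pexp2l //.
have [alb|bal] := leqP al b.
  rewrite (eq_bigr (fun=> 1)) ?sumr_const ?card_ord // => y _.
  by rewrite dvdn_mulr // dvdn_exp2l.
have -> : (p ^ al = p ^ (al - b) * p ^ b)%N by rewrite -expnD subnK // ltnW.
rewrite (@sum_ord_mul F (p ^ (al - b)) (p ^ b)
  (fun y => (p ^ (al - b) * p ^ b %| p ^ b * y)%:R)).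
rewrite (eq_bigr (fun=> 1)) ?sumr_const ?card_ord // => j _.
have lt0 : (0 < p ^ (al - b))%N by rewrite expn_gt0 p_gt0.
rewrite (bigD1 (Ordinal lt0)) //= big1 => [|r r0].
  by rewrite add0n mulnC dvdn_pmul2l ?expn_gt0 ?p_gt0 // dvdn_mulr // addr0.
rewrite mulnC dvdn_pmul2l ?expn_gt0 ?p_gt0 // mulnC dvdn_addl ?dvdn_mull //.
rewrite gtnNdvd // lt0n; apply: contra r0 => /eqP r0.
by apply/eqP/val_inj.
Qed.

Lemma sum_avg2 m n (u : Zp -> Zp -> F) :
  \sum_(a < p ^ m) \sum_(b < p ^ n) u a%:R b%:R =
  (p ^ (m + n))%:R * avg n (fun y => avg m (u^~ y)).
Proof.
have pn0 k : (p ^ k)%:R != 0 :> F by rewrite pnatr_eq0 expn_eq0 eqn0Ngt p_gt0.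
by rewrite avg_exchange /avg -big_distrr /= expnD natrM mulrACA divff // mul1r mulVKf.
Qed.


(** Set [k = N - al - be], the level of the quadratic congruence. The index
    [N + al + be] is [k + 2 al + 2 be], so the sums over [al] and [be] are
    geometric, with denominators [1 - p^2 t^2] and [1 - p t^2]. *)
Lemma good_count_congruence f g (d : nat -> F) : (f <= 1)%N -> (g <= 1)%N ->
    good_density p d ->
  good p (fun m => \sum_(N < m.+1) \sum_(al < m.+1) \sum_(be < m.+1)
    if [&& (N + al + be == m)%N, (al + f <= N)%N, (be + g <= N)%N & (al + be < N)%N]
    then (p ^ minn al (N - g - be))%:R * (p ^ ((N - f - al) + (N - g - be)))%:R * d (N - al - be)%N
    else 0).
Proof.
move=> f1 g1 dP; pose w k : F := if (0 < k)%N then (p ^ (2 * k))%:R * d k else 0.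
have wP : good p w.
  by apply: (good_eventually_eq (M := 1)) dP => k k1; rewrite /w k1.
have gwP : good p (geometric_conv p 2 2 (geometric_conv p 1 2 w)).
  by do 2!(apply: good_geometric_conv => //).
have pfg : (p ^ (f + g))%:R != 0 :> F by rewrite pnatr_eq0 expn_eq0 eqn0Ngt p_gt0.
apply: good_ext (goodZ (p ^ (f + g))%:R^-1 gwP) => m.
rewrite (geometric_convE p _ _ (isT : 0 < 2)%N (ltnSn m)) big_distrr exchange_big /=.
apply: eq_bigr => al _; rewrite exchange_big /=.
transitivity ((p ^ (f + g))%:R^-1 * \sum_(be < m.+1) (p ^ (2 * al))%:R * ((p ^ (1 * be))%:R *
    (if (2 * be + 2 * al <= m)%N then w (m - 2 * al - 2 * be)%N else 0))).
  rewrite -big_distrr; congr (_ * (_ * _)); case: leqP => alm; last first.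
    by rewrite big1 // => be _; rewrite ifF ?mulr0 //; lia.
  rewrite (@geometric_convE p F 1 2 w (m - 2 * al) m.+1) //; last by lia.
  by apply: eq_bigr => be _; congr (_ * _); congr (if _ then _ else _); lia.
rewrite big_distrr; apply: eq_bigr => be _ /=.
have [km|mk] := ltnP (2 * be + 2 * al) m; last first.
  rewrite big1 => [|N _]; last by rewrite ifF //; lia.
  by case: ifP => km; rewrite /w ?ifF ?mulr0 //; lia.
have Nm : (m - al - be < m.+1)%N by lia.
rewrite (bigD1 (Ordinal Nm)) //= big1 ?addr0 => [|N NE]; last first.
  rewrite ifF //; apply/negP => /and4P[/eqP mE _ _ _]; case/eqP: NE.
  by apply: val_inj => /=; lia.
rewrite !ifT; [|lia..]; rewrite /w ifT; last by lia.
rewrite !mulrA; congr (_ * d _); last by lia.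
apply: (mulfI pfg); rewrite -!mulrA mulVKf // -!natrM -!expnD; congr (p ^ _)%:R.
lia.
Qed.

(** With the complementary parameters [i = N - f - al], [j = N - g - be] and
    [l = al + be - N] the index is [2 i + 2 j + 3 l] up to a constant and the
    weight is [p^(i + 2 j)], so the generating function is the product of three
    geometric series, with denominators [1 - p t^2], [1 - p^2 t^2] and
    [1 - t^3]. *)
Lemma good_count_free f g : good p (fun m => \sum_(N < m.+1) \sum_(al < m.+1) \sum_(be < m.+1)
    if [&& (N + al + be == m)%N, (al + f <= N)%N, (be + g <= N)%N & (N <= al + be)%N]
    then (p ^ minn al (N - g - be))%:R * (p ^ ((N - f - al) + (N - g - be)))%:R
    else 0 : F).
Proof.
pose w k : F := (k == 2 * (f + g))%:R.
have wP : good p w.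
  apply: good_eventually_zero; exists (2 * (f + g)).+1 => k.
  by rewrite /w; case: eqP => // -> ; rewrite ltnn.
have gwP : good p (geometric_conv p 1 2 (geometric_conv p 2 2 (geometric_conv p 0 3 w))).
  by do 3!(apply: good_geometric_conv => //).
apply: good_ext gwP => m.
transitivity (\sum_(i < m.+1) \sum_(j < m.+1) \sum_(l < m.+1)
  if (2 * i + 2 * j + 3 * l + 2 * (f + g) == m)%N then (p ^ (i + 2 * j))%:R else 0 : F).
  rewrite (geometric_convE p _ _ (isT : 0 < 2)%N (ltnSn m)); apply: eq_bigr => i _.
  have [im|mi] := leqP; last first.
    by rewrite mulr0 big1 // => j _; rewrite big1 // => l _; rewrite ifF //; lia.
  rewrite (@geometric_convE p F 2 2 _ (m - 2 * i) m.+1) //; last by lia.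
  rewrite big_distrr; apply: eq_bigr => j _ /=.
  have [jm|mj] := leqP; last first.
    by rewrite !mulr0 big1 // => l _; rewrite ifF //; lia.
  rewrite (@geometric_convE p F 0 3 _ (m - 2 * i - 2 * j) m.+1) //; last by lia.
  rewrite !big_distrr; apply: eq_bigr => l _ /=.
  rewrite mul0n expn0 mul1r mul1n /w.
  have -> : (if (3 * l <= m - 2 * i - 2 * j)%N
             then (m - 2 * i - 2 * j - 3 * l == 2 * (f + g))%N%:R else 0)
      = (2 * i + 2 * j + 3 * l + 2 * (f + g) == m)%N%:R :> F.
    by case: leqP => lm; [congr (nat_of_bool _)%:R; lia|case: eqP => //; lia].
  by case: ifP; rewrite ?mulr0 // mulr1 -natrM -expnD.
rewrite !pair_big !big_mkcond /=.
pose T := ('I_m.+1 * 'I_m.+1 * 'I_m.+1)%type.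
pose P (t : T) := let: (N, al, be) := t in
  [&& (N + al + be == m)%N, (al + f <= N)%N, (be + g <= N)%N & (N <= al + be)%N].
pose h (t : T) : T := let: (i, j, l) := t in
  (inord (i + j + f + g + l), inord (j + g + l), inord (i + f + l)).
pose h' (t : T) : T := let: (N, al, be) := t in
  (inord (N - f - al), inord (N - g - be), inord (al + be - N)).
rewrite [RHS](_ : _ = \sum_(t : T | P t) let: (N, al, be) := t in
    (p ^ minn al (N - g - be))%:R * (p ^ ((N - f - al) + (N - g - be)))%:R); last first.
  by rewrite [RHS]big_mkcond; apply: eq_bigr => -[[N al] be] _.
rewrite [RHS](reindex_onto h h') => [|[[N al] be]]; last first.
  rewrite /P => /and4P[/eqP mE alN beN Nab].
  by rewrite /h /h'; congr (_, _, _); apply: val_inj; rewrite /= !inordK //; lia.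
rewrite [RHS]big_mkcond; apply: eq_bigr => -[[i j] l] _ /=.
have [mE|mN] := eqVneq (2 * i + 2 * j + 3 * l + 2 * (f + g))%N m; last first.
  rewrite ifF //; apply/negP => /andP[/and4P[/eqP mE alN beN Nab] /eqP[iE jE lE]].
  case/eqP: mN; move: mE alN beN Nab iE jE lE.
  move: (inord (i + j + f + g + l)) (inord (j + g + l)) (inord (i + f + l)).
  move=> N al be mE alN beN Nab /(congr1 val) /= + /(congr1 val) /= + /(congr1 val) /=.
  rewrite !inordK; lia.
have EN : val (inord (i + j + f + g + l) : 'I_m.+1) = (i + j + f + g + l)%N.
  by rewrite /= inordK //; lia.
have Eal : val (inord (j + g + l) : 'I_m.+1) = (j + g + l)%N by rewrite /= inordK //; lia.
have Ebe : val (inord (i + f + l) : 'I_m.+1) = (i + f + l)%N by rewrite /= inordK //; lia.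
rewrite /= in EN Eal Ebe; rewrite EN Eal Ebe ifT; last first.
  apply/andP; split; first by apply/and4P; split; lia.
  by apply/eqP; congr (_, _, _); apply: val_inj; rewrite /= inordK; lia.
by rewrite -natrM -expnD; congr (p ^ _)%:R; lia.
Qed.

End CountGoodness.

(** * The number of subalgebras of given index *)

Section SubalgebraCount.
Variables (p : nat) (p_prime : prime p) (L : lieAlgType (padicInt p)) (F : numFieldType).
Local Notation Zp := (padicInt p).
Variables (E : 'I_3 -> L) (C : 'I_3 -> L -> Zp).
Implicit Types (c : 'I_3) (N al be m k : nat).

Let p_gt0 : (0 < p)%N. Proof. exact: prime_gt0. Qed.

(** The proportion of points of the chart at which the quadratic form of the Lie
    algebra vanishes modulo [p ^ k]. *)
Definition chart_density c k : F := avg k (fun y => avg k (fun x =>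
  (pdvd k (chart_form E C c (p%:R ^+ flag2 c * x) (p%:R ^+ flag3 c * y)))%:R)).

Lemma chart_density_scaled c : exists c0 c1 c2 A B D : Zp, forall k m n,
    (k <= flag2 c + m)%N -> (k <= flag3 c + n)%N ->
  avg n (fun y => avg m (fun x =>
    (pdvd k (chart_form E C c (p%:R ^+ flag2 c * x) (p%:R ^+ flag3 c * y)))%:R)) =
  quad2_density F c0 c1 c2 A B D k.
Proof.
do 6 eexists; move=> k m n km kn; exact: (scaled_quad2_average p_prime).
Qed.

Lemma chart_density_level c k m n : (k <= flag2 c + m)%N -> (k <= flag3 c + n)%N ->
  avg n (fun y => avg m (fun x =>
    (pdvd k (chart_form E C c (p%:R ^+ flag2 c * x) (p%:R ^+ flag3 c * y)))%:R)) =
  chart_density c k.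
Proof.
have [c0 [c1 [c2 [A [B [D scaled]]]]]] := chart_density_scaled c => km kn.
by rewrite /chart_density !scaled // leq_addl.
Qed.

Lemma good_chart_density c : good_density p (chart_density c).
Proof.
have [c0 [c1 [c2 [A [B [D scaled]]]]]] := chart_density_scaled c.
apply: good_ext (good_quad2_density p_prime F c0 c1 c2 A B D) => k; congr (_ * _).
by rewrite -(scaled k k k) ?leq_addl.
Qed.

Lemma sum_admissible c N al be m : (N <= m)%N -> (al <= m)%N ->
  \sum_(y < p ^ m) \sum_(a < p ^ m) \sum_(b < p ^ m) (admissible E C c N al be y a b)%:R =
  if (al + flag2 c <= N)%N && (be + flag3 c <= N)%N then
    (p ^ minn al (N - flag3 c - be))%:R *
    (p ^ ((N - flag2 c - al) + (N - flag3 c - be)))%:R * chart_density c (N - al - be)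
  else 0.
Proof.
move=> Nm alm; set f := flag2 c; set g := flag3 c.
case: ifP => [/andP[alN beN]|fgN]; last first.
  rewrite big1 // => y _; rewrite big1 // => a _; rewrite big1 // => b _.
  by rewrite /admissible /hermite -/f -/g; case: (_ <= N)%N (_ <= N)%N fgN => -[].
set Q := fun a b : Zp => pdvd (N - al - be) (chart_form E C c (p%:R ^+ f * a) (p%:R ^+ g * b)).
have QE (q : Zp) : pdvd N (p%:R ^+ (al + be) * q) = pdvd (N - al - be) q.
  have [abN|Nab] := leqP (al + be) N.
    have {1}-> : (N = al + be + (N - al - be))%N by lia.
    exact: pdvd_pexpM.
  have -> : (N - al - be = 0)%N by lia.
  by rewrite pdvd_k0 (pdvd_leq p_prime (ltnW Nab)) // pdvd_exp.
have factor (y a b : nat) : (admissible E C c N al be y a b)%:R =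
    ((y < p ^ al)%N && (p ^ al %| p ^ (N - g - be) * y)%N)%:R *
    ((a < p ^ (N - f - al))%N%:R * ((b < p ^ (N - g - be))%N%:R * (Q a%:R b%:R)%:R)) :> F.
  rewrite /admissible /hermite -/f -/g alN beN QE /=.
  by rewrite -!natrM !mulnb andbA -!andbA.
transitivity ((\sum_(y < p ^ m) ((y < p ^ al)%N && (p ^ al %| p ^ (N - g - be) * y)%N)%:R) *
    \sum_(a < p ^ (N - f - al)) \sum_(b < p ^ (N - g - be)) (Q a%:R b%:R)%:R : F).
  rewrite big_distrl; apply: eq_bigr => y _ /=.
  have le_m k : (k <= N)%N -> (p ^ k <= p ^ m)%N.
    by move=> kN; rewrite leq_pexp2l // (leq_trans kN).
  rewrite -(@sum_ord_ltn F _ _ (fun a => \sum_(b < p ^ (N - g - be)) (Q a%:R b%:R)%:R)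
    (le_m (N - f - al)%N _)); last by lia.
  rewrite big_distrr; apply: eq_bigr => a _ /=.
  rewrite -(@sum_ord_ltn F _ _ (fun b => (Q a%:R b%:R)%:R) (le_m (N - g - be)%N _)); last by lia.
  by rewrite !big_distrr; apply: eq_bigr => b _; rewrite factor.
rewrite (sum_divisible p_prime) // (sum_avg2 p_prime _ _ (fun a b => (Q a b)%:R)) mulrA.
by congr (_ * _); apply: chart_density_level; rewrite -/f -/g; lia.
Qed.

Lemma card_data m : #|data E C m|%:R = \sum_c \sum_(N < m.+1) \sum_(al < m.+1) \sum_(be < m.+1)
  if [&& (N + al + be == m)%N, (al + flag2 c <= N)%N & (be + flag3 c <= N)%N] then
    (p ^ minn al (N - flag3 c - be))%:R *
    (p ^ ((N - flag2 c - al) + (N - flag3 c - be)))%:R * chart_density c (N - al - be)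
  else 0.
Proof.
pose G c N al be (y a b : nat) : F :=
  if (N + al + be == m)%N then (admissible E C c N al be y a b)%:R else 0.
transitivity (\sum_c \sum_(N < m.+1) \sum_(al < m.+1) \sum_(be < m.+1)
    \sum_(y < p ^ m) \sum_(a < p ^ m) \sum_(b < p ^ m) G c N al be y a b).
  rewrite -sum1_card natr_sum big_mkcond.
  under [RHS]eq_bigr => c _.
    do 2!rewrite pair_big /=.
    under eq_bigr => t _ do rewrite !pair_big /=.
    over.
  rewrite !pair_big /=; apply: eq_bigr => -[[c [[N al] be]] [[y a] b]] _.
  by rewrite inE /G /=; case: eqP => //= _; case: admissible.
apply: eq_bigr => c _; apply: eq_bigr => N _; apply: eq_bigr => al _.
apply: eq_bigr => be _; rewrite /G; case: eqP => /= _.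
  by rewrite (sum_admissible c be (m := m)) // -ltnS.
by rewrite big1 // => y _; rewrite big1 // => a _; rewrite big1.
Qed.

(** The congruence modulo [p^N] on [p^(al+be)] times the quadratic form has level
    [N - al - be] or is void; both parts of the sum have been computed. *)
Theorem good_card_data : good p (fun m => #|data E C m|%:R : F).
Proof.
have flag_le1 : (forall c, flag2 c <= 1)%N /\ (forall c, flag3 c <= 1)%N.
  by split=> c; rewrite /flag2 /flag3; case: leqP.
have [f1 g1] := flag_le1.
apply: (good_ext (fun m => esym (card_data m))); apply: good_sum => c _.
apply: good_ext (goodD (good_count_congruence p_prime (f1 c) (g1 c) (good_chart_density c))
  (good_count_free p_prime F (flag2 c) (flag3 c))) => m /=.
rewrite -big_split; apply: eq_bigr => N _; rewrite -big_split; apply: eq_bigr => al _.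
rewrite -big_split; apply: eq_bigr => be _ /=.
case: eqP => /= _; last by rewrite addr0.
case: (al + flag2 c <= N)%N; last by rewrite addr0.
case: (be + flag3 c <= N)%N; last by rewrite addr0.
rewrite /=; have [kN|Nk] := ltnP (al + be) N; first by rewrite addr0.
have -> : (N - al - be = 0)%N by lia.
rewrite add0r.
have -> : chart_density c 0 = 1.
  rewrite /chart_density -[RHS](avg_cst p_prime 0); apply: eq_avg => y.
  by rewrite -[RHS](avg_cst p_prime 0); apply: eq_avg => x.
by rewrite mulr1.
Qed.

End SubalgebraCount.

(** * The zeta series as a power series *)

Section ComplexExponential.
Variable R : realType.
Local Open Scope complex_scope.
Implicit Types z w : R[i].

Lemma cexpD z w : cexp (z + w) = cexp z * cexp w.
Proof.
case: z w => a b [c d]; rewrite /cexp /= expRD cosD sinD.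
by apply/eqP; rewrite eq_complex /=; apply/andP; split; apply/eqP; ring.
Qed.

Lemma cexp0 : cexp 0 = 1 :> R[i].
Proof. by rewrite /cexp /= expR0 cos0 sin0 mul1r; apply/eqP; rewrite eq_complex /= !eqxx. Qed.

Lemma cexpMn n z : cexp (z * n%:R) = cexp z ^+ n.
Proof.
elim: n => [|n IHn]; first by rewrite mulr0 cexp0.
by rewrite -natr1 mulrDr mulr1 cexpD IHn exprSr.
Qed.

Lemma nat_cpowX n m z : (0 < n)%N -> nat_cpow (n ^ m) z = nat_cpow n z ^+ m.
Proof.
move=> n0; rewrite /nat_cpow natrX lnXn ?ltr0n // -cexpMn; congr cexp.
by rewrite -mulrA mulr_natr -rmorphMn.
Qed.
End ComplexExponential.

Section ZetaSeries.
Variables (R : realType) (p : nat) (p_prime : prime p) (L : lieAlgType (padicInt p)).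
Local Open Scope classical_set_scope.
Variables (E : 'I_3 -> L) (C : 'I_3 -> L -> padicInt p) (frames : rotated_frames E C).

Local Notation index_set := (@fin_index_subalgebras (padicInt p) L).

Let block m : finType := {d : box p m | d \in data E C m}.
Let blocks M : finType := {m : 'I_M & block m}.

Let blocks_lattice_subproof M (j : blocks M) :
  lattice_of C (val (tagged j)) \in index_set.
Proof. by apply/mem_set; have [] := data_subalgebra p_prime frames (valP (tagged j)). Qed.

Let blocks_lattice M (j : blocks M) : index_set :=
  exist (fun H => H \in index_set) _ (blocks_lattice_subproof j).

Let blocks_lattice_index M (j : blocks M) : lie_index (val (blocks_lattice j)) = (p ^ tag j)%N.
Proof. by have [] := data_subalgebra p_prime frames (valP (tagged j)). Qed.

Let blocks_lattice_inj M : injective (@blocks_lattice M).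
Proof.
move=> [m [d dP]] [m' [d' dP']] jE.
have mE : m = m'.
  apply/val_inj/eqP; rewrite -(eqn_exp2l _ _ (prime_gt1 p_prime)) /=.
  by rewrite -[(p ^ m)%N](blocks_lattice_index (Tagged _ (exist _ d dP))) jE blocks_lattice_index.
subst m'; have dE : d = d' by apply: (lattice_of_inj p_prime frames) => //; exact: (congr1 val jE).
by subst d'; rewrite (bool_irrelevance dP dP').
Qed.

Let small_subalgebras M : {fset index_set} := [fset blocks_lattice j | j in {: blocks M}]%fset.

Let small_subalgebrasP M (H : index_set) :
  (logn p (lie_index (val H)) < M)%N -> H \in small_subalgebras M.
Proof.
have [m [d dP HE]] := data_surj p_prime frames (set_mem (valP H)).
have [_ index_d] := data_subalgebra p_prime frames dP.
rewrite -HE index_d lognX logn_prime // eqxx muln1 => mM.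
apply/imfsetP; exists (Tagged (fun m : 'I_M => block m) (exist _ d dP : block (Ordinal mM))) => //.
exact/val_inj/esym.
Qed.

Let partial_sum_small s M :
  summability.partial_sum (@zeta_term R _ L s) (small_subalgebras M) =
  series (fun m => #|data E C m|%:R * nat_cpow p (- s) ^+ m) M.
Proof.
rewrite /summability.partial_sum -(big_seq_fsetE _ _ xpredT (@zeta_term R _ L s)).
rewrite big_imfset /=; last by move=> j j' _ _; apply: blocks_lattice_inj.
rewrite big_enum /= /series /= big_mkord.
transitivity (\sum_(m < M) \sum_(d : block m) nat_cpow p (- s) ^+ m).
  rewrite sig_big_dep; apply: eq_bigr => j _.
  by rewrite /zeta_term blocks_lattice_index nat_cpowX // prime_gt0.
by apply: eq_bigr => m _; rewrite sumr_const card_sig mulr_natl.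
Qed.

(** The subalgebras of index less than [p ^ M] form finite sets that exhaust all
    subalgebras, so the net of partial sums converges along them. *)
Lemma zeta_sum_series s l : @zeta_sum R _ L s l ->
  series (fun m => #|data E C m|%:R * nat_cpow p (- s) ^+ m) @ \oo --> (l : (R[i])^o).
Proof.
move=> sum_l; rewrite (_ : series _ =
    summability.partial_sum (@zeta_term R _ L s) \o small_subalgebras).
  apply: cvg_comp sum_l => P [A _ AP].
  exists (\max_(H <- A) (logn p (lie_index (val H))).+1)%N => // M /= AM; apply: AP => /=.
  apply/fsubsetP => H HA; apply: small_subalgebrasP; apply: leq_trans AM.
  exact: (leq_bigmax_seq (F := fun H : index_set => (logn p (lie_index (val H))).+1)).
by apply/funext => M; rewrite /= partial_sum_small.
Qed.

End ZetaSeries.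

(** * Germs of convergent power series *)

Section PowerSeriesGerms.
Variable C : numFieldType.
Hypothesis arch : forall e : C, 0 < e -> exists n, 2%:R ^- n < e.
Local Open Scope classical_set_scope.
Implicit Types (u v a b c d : nat -> C) (g f : C -> C) (h x y e r A B : C) (n m k i j : nat).

Lemma common_radius r1 r2 : 0 < r1 -> 0 < r2 -> exists r, [/\ 0 < r, r <= r1 & r <= r2].
Proof.
move=> r10 r20; exists (r1^-1 + r2^-1)^-1; have s0 : 0 < r1^-1 + r2^-1.
  by rewrite addr_gt0 ?invr_gt0.
split; first by rewrite invr_gt0.
  by rewrite -[leRHS]invrK lef_pV2 ?posrE ?invr_gt0 // lerDl ltW ?invr_gt0.
by rewrite -[leRHS]invrK lef_pV2 ?posrE ?invr_gt0 // lerDr ltW ?invr_gt0.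
Qed.

Lemma ler_expr x y n : 0 <= x -> x <= y -> x ^+ n <= y ^+ n.
Proof. by move=> x0 xy; apply: lerXn2r => //; rewrite nnegrE // (le_trans x0). Qed.

Lemma cvg_half_powers u A : (forall n, `|u n| <= A * 2%:R ^- n) -> u @ \oo --> (0 : C).
Proof.
move=> uA; have A0 : 0 <= A by have := uA 0%N; rewrite expr0 invr1 mulr1; apply: le_trans.
apply/cvgr0Pnorm_lt => e e0; have A1 : 0 < A + 1 by rewrite ltr_wpDl.
have [n ne] := arch (divr_gt0 e0 A1); exists n => // m /= nm.
apply: le_lt_trans (uA m) _; apply: (@le_lt_trans _ _ (A * 2%:R ^- n)).
  by rewrite ler_wpM2l // lef_pV2 ?posrE ?exprn_gt0 // ler_weXn2l ?ler1n.
move: ne; rewrite ltr_pdivlMr // => ne; apply: le_lt_trans ne.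
by rewrite mulrC ler_wpM2l ?invr_ge0 ?exprn_ge0 // lerDl.
Qed.

Definition conv a b n : C := \sum_(i < n.+1) a i * b (n - i)%N.

Lemma series_conv a b n : series (conv a b) n =
  \sum_(i < n) \sum_(j < n) if (i + j < n)%N then a i * b j else 0.
Proof.
rewrite /series /= big_mkord.
transitivity (\sum_(k < n) \sum_(i < n) if (i <= k)%N then a i * b (k - i)%N else 0).
  apply: eq_bigr => k _; rewrite /conv.
  by rewrite (big_ord_widen n (fun i => a i * b (k - i)%N)) // big_mkcond.
rewrite exchange_big; apply: eq_bigr => i _ /=.
rewrite -!big_mkcond -!(big_mkord (fun k => (i <= k)%N) (fun k => a i * b (k - i)%N)) /=.
rewrite -(big_mkord (fun j => (i + j < n)%N) (fun j => a i * b j)) /=.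
rewrite (@big_cat_nat _ _ _ i) //=; last exact: ltnW.
rewrite [X in X + _]big_nat_cond [X in X + _]big1 ?add0r => [|k]; last by lia.
rewrite -{1}[i : nat]add0n big_addn (@big_cat_nat _ _ _ (n - i) 0 n) ?leq_subr //=.
rewrite [X in _ = _ + X]big_nat_cond [X in _ = _ + X]big1 ?addr0 => [|k]; last by lia.
rewrite big_nat_cond [RHS]big_nat_cond; apply: eq_big => [k|k _]; last by rewrite addnK.
by lia.
Qed.

(** The product of the partial sums up to [n] differs from the partial sum of the
    Cauchy product by at most [n^2 <= 4^n] terms, each of size at most a
    constant times [8^(-n)]. *)
Lemma cvg_series_conv a b A B x y :
    (forall n, `|a n| <= A * 8%:R ^- n) -> (forall n, `|b n| <= B * 8%:R ^- n) ->
    series a @ \oo --> x -> series b @ \oo --> y ->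
  series (conv a b) @ \oo --> x * y.
Proof.
move=> aA bB ax by_; have ge0 u D : (forall n, `|u n| <= D * 8%:R ^- n) -> 0 <= D.
  by move=> uD; have := uD 0%N; rewrite expr0 invr1 mulr1; apply: le_trans.
have A0 := ge0 _ _ aA; have B0 := ge0 _ _ bB.
pose err n := series (conv a b) n - series a n * series b n.
have err0 : err @ \oo --> (0 : C).
  apply: (@cvg_half_powers _ (A * B)) => n; rewrite /err distrC series_conv.
  rewrite /series /= !big_mkord big_distrl /= -sumrB.
  have errE : \sum_(i < n) (a i * (\sum_(j < n) b j) -
      \sum_(j < n) if (i + j < n)%N then a i * b j else 0) =
      \sum_(i < n) \sum_(j < n) if (n <= i + j)%N then a i * b j else 0.
    apply: eq_bigr => i _; rewrite big_distrr -sumrB; apply: eq_bigr => j _ /=.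
    by rewrite ltnNge; case: (n <= i + j)%N; rewrite /= ?subr0 ?subrr.
  rewrite errE; apply: (@le_trans _ _ (\sum_(i < n) \sum_(j < n) A * B * 8%:R ^- n)).
    rewrite (le_trans (ler_norm_sum _ _ _)) // ler_sum // => i _.
    rewrite (le_trans (ler_norm_sum _ _ _)) // ler_sum // => j _.
    case: ifP => nij; last first.
      by rewrite normr0 !mulr_ge0 ?invr_ge0 ?exprn_ge0 .
    rewrite normrM (le_trans (ler_pM _ _ (aA i) (bB j))) // mulrACA.
    rewrite ler_wpM2l ?mulr_ge0  // -invfM -exprD.
    by rewrite lef_pV2 ?posrE ?exprn_gt0 // ler_weXn2l ?ler1n.
  rewrite !sumr_const !card_ord -mulrnA -[_ *+ (n * n)]mulr_natr -mulrA.
  rewrite ler_wpM2l ?mulr_ge0  //.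
  have -> : 8%:R ^- n = 2%:R ^- n * (4 ^ n)%:R^-1 :> C.
    by rewrite natrX -invfM -exprMn -natrM.
  rewrite -mulrA ler_piMr ?invr_ge0 ?exprn_ge0 // ler_pdivrMl ?ltr0n ?expn_gt0 //.
  rewrite mulr1 ler_nat -[4%N]/(2 * 2)%N expnMn leq_mul // ltnW // ltn_expl //.
rewrite (_ : series _ = err \+ (fun n => series a n * series b n)).
  by rewrite -[x * y]add0r; apply: cvgD => //; apply: cvgM.
by apply/funext => n; rewrite /err /= subrK.
Qed.

(** The geometric bound on the coefficients replaces a radius of convergence: it
    holds for every convergent power series and is easily propagated through
    sums and products. *)
Definition is_germ g c : Prop := exists B q r : C, [/\ 0 < B, 0 < q & 0 < r] /\
  (forall k, `|c k| <= B * q ^+ k) /\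
  (forall h, `|h| < r -> series (fun k => c k * h ^+ k) @ \oo --> g h).

Definition germ g : Prop := exists c, is_germ g c.

Lemma cvg_series_finite u m : (forall n, (m <= n)%N -> u n = 0) ->
  series u @ \oo --> \sum_(i < m) u i.
Proof.
move=> u0; apply: cvg_near_cst; exists m => // n /= mn.
rewrite /series /= (@big_cat_nat _ _ _ m) //= [X in _ + X]big_nat_cond.
by rewrite [X in _ + X]big1 ?addr0 ?big_mkord // => i /andP[/andP[/u0->]].
Qed.

Lemma germ_monomial x m : germ (fun h => x * h ^+ m).
Proof.
exists (fun k => if k == m then x else 0), (`|x| + 1), 1, 1.
split; [by split; rewrite ?ltr_wpDl|split].
  by move=> k; rewrite expr1n mulr1; case: eqP => _; rewrite ?normr0 ?lerDl // addr_ge0.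
move=> h _; have := @cvg_series_finite (fun k => (if k == m then x else 0) * h ^+ k) m.+1 _.
rewrite big_ord_recr /= eqxx big1 ?add0r => [|i _]; last first.
  by rewrite ifF ?mul0r //; apply/negbTE; rewrite neq_ltn ltn_ord.
by apply=> n mn; rewrite ifF ?mul0r //; apply/negbTE; rewrite neq_ltn mn orbT.
Qed.

Lemma germ_cst x : germ (fun=> x).
Proof.
by have := germ_monomial x 0; congr germ; apply/funext => h; rewrite expr0 mulr1.
Qed.

Lemma germD f g : germ f -> germ g -> germ (fun h => f h + g h).
Proof.
move=> [c [A [a [r [[A0 a0 r0] [cA cf]]]]]] [d [B [b [s [[B0 b0 s0] [dB dg]]]]]].
have [t [t0 tr ts]] := common_radius r0 s0.
exists (fun k => c k + d k), (A + B), (a + b), t; split; first by split; rewrite ?addr_gt0.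
split=> [k|h ht].
  rewrite (le_trans (ler_normD _ _)) // mulrDl lerD //.
    by rewrite (le_trans (cA k)) // (ler_wpM2l (ltW A0)) // ler_expr ?lerDl ?ltW.
  by rewrite (le_trans (dB k)) // (ler_wpM2l (ltW B0)) // ler_expr ?lerDr ?ltW.
rewrite (_ : series _ = series (fun k => c k * h ^+ k) \+ series (fun k => d k * h ^+ k)).
  by apply: cvgD; [apply/cf/(lt_le_trans ht)|apply/dg/(lt_le_trans ht)].
by apply/funext => n; rewrite /series /= -big_split; apply: eq_bigr => i _; rewrite mulrDl.
Qed.

Lemma germM f g : germ f -> germ g -> germ (fun h => f h * g h).
Proof.
move=> [c [A [a [r [[A0 a0 r0] [cA cf]]]]]] [d [B [b [s [[B0 b0 s0] [dB dg]]]]]].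
pose q := a + b; have q0 : 0 < q by rewrite addr_gt0.
have {}cA k : `|c k| <= A * q ^+ k.
  by rewrite (le_trans (cA k)) // (ler_wpM2l (ltW A0)) // ler_expr ?lerDl ?ltW.
have {}dB k : `|d k| <= B * q ^+ k.
  by rewrite (le_trans (dB k)) // (ler_wpM2l (ltW B0)) // ler_expr ?lerDr ?ltW.
have [t1 [t10 t1r t1s]] := common_radius r0 s0.
have e0 : 0 < (8%:R * q)^-1 by rewrite invr_gt0 mulr_gt0.
have [t [t0 tt1 te]] := common_radius t10 e0.
exists (conv c d), (A * B), (2%:R * q), t; split; first by split; rewrite ?mulr_gt0.
split=> [k|h ht].
  rewrite (le_trans (ler_norm_sum _ _ _)) //.
  apply: (@le_trans _ _ (\sum_(i < k.+1) A * B * q ^+ k)).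
    apply: ler_sum => i _; rewrite normrM (le_trans (ler_pM _ _ (cA i) (dB _))) //.
    by rewrite mulrACA -exprD subnKC // -ltnS.
  rewrite sumr_const card_ord exprMn -[_ *+ k.+1]mulr_natl [leRHS]mulrCA ler_wpM2r //.
    by rewrite mulr_ge0 ?exprn_ge0 ?ltW ?mulr_gt0.
  by rewrite -natrX ler_nat ltn_expl.
have small c' D : 0 < D -> (forall k, `|c' k| <= D * q ^+ k) ->
    forall k, `|c' k * h ^+ k| <= D * 8%:R ^- k.
  move=> D0 cD k; rewrite normrM normrX (le_trans (ler_wpM2r _ (cD k))) ?exprn_ge0 //.
  rewrite -mulrA (ler_wpM2l (ltW D0)) // -exprMn -exprVn.
  apply: ler_expr; first by rewrite mulr_ge0 ?(ltW q0).
  have := lt_le_trans ht te; rewrite invfM => hq.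
  by rewrite mulrC -ler_pdivlMr // ltW.
have := cvg_series_conv (small _ _ A0 cA) (small _ _ B0 dB)
  (cf h (lt_le_trans ht (le_trans tt1 t1r))) (dg h (lt_le_trans ht (le_trans tt1 t1s))).
rewrite (_ : conv _ _ = fun k => conv c d k * h ^+ k) //.
apply/funext => k; rewrite /conv big_distrl; apply: eq_bigr => i _ /=.
by rewrite mulrACA -exprD subnKC // -ltnS.
Qed.

Lemma germX f n : germ f -> germ (fun h => f h ^+ n).
Proof.
move=> fP; elim: n => [|n IHn]; first exact: germ_cst.
by have := germM fP IHn; congr germ; apply/funext => h; rewrite exprS.
Qed.

(** Near the centre the first non-zero term dominates the sum of all the later
    ones, which are bounded by a geometric series. *)
Lemma germ_isolated_zeros g : germ g ->
    (forall e, 0 < e -> exists h, [/\ 0 < `|h|, `|h| < e & g h = 0]) ->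
  exists r, 0 < r /\ forall h, `|h| < r -> g h = 0.
Proof.
move=> [c [B [a [r [[B0 a0 r0] [cB cg]]]]]] zeros.
have c0 : forall k, c k = 0.
  elim/ltn_ind => k IHk; apply/eqP; apply: contraT => ck0.
  have ck_gt0 : 0 < `|c k| by rewrite normr_gt0.
  have e10 : 0 < (2%:R * a)^-1 by rewrite invr_gt0 mulr_gt0.
  pose D := 2%:R * B * a ^+ k.+1; have D0 : 0 < D by rewrite !mulr_gt0 ?exprn_gt0.
  have [e1 [e1_gt0 e1r e1a]] := common_radius r0 e10.
  have [e [e_gt0 ee1 eD]] := common_radius e1_gt0 (divr_gt0 ck_gt0 D0).
  have [h [h0 he gh]] := zeros e e_gt0.
  have := cg h (lt_le_trans he (le_trans ee1 e1r)); rewrite gh => S0.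
  have ah : `|h| * a <= 2%:R^-1.
    have := lt_le_trans he (le_trans ee1 e1a); rewrite invfM => ha.
    by rewrite -ler_pdivlMr // ltW.
  pose delta := `|h| ^+ k * (`|c k| - D * `|h|).
  have delta0 : 0 < delta.
    rewrite mulr_gt0 ?exprn_gt0 // subr_gt0 mulrC -ltr_pdivlMr //.
    exact: lt_le_trans he eD.
  move/cvgr0Pnorm_lt: S0 => /(_ delta delta0)[n0 _ n0P].
  have /= lt_delta := n0P (k.+1 + n0)%N (leq_addl _ _).
  suff le_delta : delta <= `|series (fun i => c i * h ^+ i) (k.+1 + n0)%N|.
    by have := le_lt_trans le_delta lt_delta; rewrite ltxx.
  rewrite /series /= big_mkord big_split_ord /= big_ord_recr /= big1 ?add0r => [|i _]; last first.
    by rewrite IHk ?mul0r.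
  set T := \sum_(i < n0) _.
  have T_le : `|T| <= D * `|h| * `|h| ^+ k.
    have half_sum m : \sum_(i < m) 2%:R ^- i <= 2%:R - 2%:R * 2%:R ^- m :> C.
      elim: m => [|m IHm]; first by rewrite big_ord0 expr0 invr1 mulr1 subrr.
      rewrite big_ord_recr /= (le_trans (lerD IHm (lexx _))) // exprS invfM mulVKf //.
      by rewrite mulr_natl mulr2n opprD addrA addrNK.
    apply: (@le_trans _ _ (\sum_(i < n0) B * (a * `|h|) ^+ k.+1 * 2%:R ^- i)).
      rewrite (le_trans (ler_norm_sum _ _ _)) // ler_sum // => i _.
      rewrite normrM normrX (le_trans (ler_wpM2r _ (cB _))) ?exprn_ge0 //.
      rewrite -!mulrA (ler_wpM2l (ltW B0)) // -exprMn exprD ler_wpM2l ?exprn_ge0 ?mulr_ge0 ?(ltW a0) //.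
      by rewrite -exprVn; apply: ler_expr; rewrite ?mulr_ge0 ?(ltW a0) // mulrC.
    rewrite -big_distrr /= (le_trans (ler_wpM2l _ (half_sum n0))) //.
      by rewrite mulr_ge0 ?exprn_ge0 ?mulr_ge0 ?(ltW a0) ?(ltW B0).
    apply: (@le_trans _ _ (B * (a * `|h|) ^+ k.+1 * 2%:R)).
      rewrite ler_wpM2l ?mulr_ge0 ?exprn_ge0 ?mulr_ge0 ?(ltW a0) ?(ltW B0) // gerDl oppr_le0.
      by rewrite mulr_ge0 ?invr_ge0 ?exprn_ge0.
    by rewrite /D exprMn [Num.norm h ^+ k.+1]exprS le_eqVlt; apply/orP; left; apply/eqP; ring.
  apply: le_trans (lerB_normD _ _); rewrite /delta mulrBr normrM normrX.
  by rewrite mulrC lerB // (le_trans T_le) // mulrC.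
exists r; split=> // h hr; have := cg h hr.
rewrite (_ : series _ = fun=> 0) => [/cvg_lim gh|]; last first.
  by apply/funext => n; rewrite /series /= big1 // => i _; rewrite c0 mul0r.
by rewrite -(gh (@norm_hausdorff _ _)) lim_cst //; apply: norm_hausdorff.
Qed.

End PowerSeriesGerms.

(** * The complex exponential as a power series *)

Section MeromorphicContinuation.
Variable R : realType.
Local Notation C := (R[i])^o.
Local Open Scope classical_set_scope.
Local Open Scope complex_scope.
Implicit Types (s w z h : R[i]) (F G Q : R[i] -> R[i]) (N n m k : nat).

Lemma complex_arch (e : R[i]) : 0 < e -> exists n, 2%:R ^- n < e.
Proof.
case: e => a b; rewrite ltcE /= => /andP[/eqP -> a0].
have ai : 0 <= a^-1 by rewrite invr_ge0 ltW.
have lt_b := Num.Theory.archi_boundP ai.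
exists (Num.Def.archi_bound a^-1); set n := Num.Def.archi_bound _ in lt_b *.
have -> : 2%:R ^- n = (2%:R ^- n : R)%:C.
  by rewrite (fmorphV (real_complex R)) rmorphXn /= rmorph_nat.
rewrite -[a +i* 0]/(a%:C) ltcR invf_plt ?posrE ?exprn_gt0 //.
by rewrite (lt_trans lt_b) // -natrX ltr_nat ltn_expl.
Qed.

Lemma cvg_real_complex (u : nat -> R) (x : R) :
  u @ \oo --> x -> (fun n => (u n)%:C) @ \oo --> (x%:C : C).
Proof.
move=> /cvgrPdist_lt ux; apply/(@cvgrPdist_lt R[i] C nat) => -[e e'].
rewrite ltcE /= => /andP[/eqP -> e0].
have [n _ nP] := ux e e0; exists n => // m nm; have /= := nP m nm.
by rewrite -rmorphB /= -[e +i* 0]/(e%:C) normc_def /= expr0n addr0 sqrtr_sqr ltcR.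
Qed.

Lemma expR_series (x : R) : series (fun k => x%:C ^+ k / k`!%:R) @ \oo --> ((expR x)%:C : C).
Proof.
rewrite (_ : series _ = fun n => (series (exp_coeff x) n)%:C).
  exact: cvg_real_complex (is_cvg_series_exp_coeff x).
apply/funext => n; rewrite /series /= rmorph_sum; apply: eq_bigr => k _.
by rewrite /exp_coeff /= rmorphM /= rmorphXn (fmorphV (real_complex R)) /= rmorph_nat.
Qed.

Lemma exp_imaginary_series (y : R) :
  series (fun k => ('i * y%:C) ^+ k / k`!%:R) @ \oo --> ((cos y +i* sin y) : C).
Proof.
have -> : cos y +i* sin y = (cos y)%:C + 'i * (sin y)%:C by rewrite [LHS]complexE.
have cosP : series (cos_coeff y) @ \oo --> cos y.
  by rewrite cos.unlock; exact: (@is_cvg_series_cos_coeff R y).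
have sinP : series (sin_coeff y) @ \oo --> sin y.
  by rewrite sin.unlock; exact: (@is_cvg_series_sin_coeff R y).
have iP : (fun=> 'i : C) @ \oo --> ('i : C) by exact: (@cvg_cst C).
rewrite (_ : series _ = (fun n => (series (cos_coeff y) n)%:C : C) \+
    (fun n => ('i : C) * ((series (sin_coeff y) n)%:C : C))).
  apply: (@cvgD R[i] C nat); first exact: cvg_real_complex.
  by apply: (@cvgM (R[i] : numFieldType) nat); [exact: iP|exact: cvg_real_complex].
apply/funext => n; rewrite /series /= !rmorph_sum mulr_sumr -big_split.
apply: eq_bigr => k _; rewrite /cos_coeff /sin_coeff /= exprMn.
rewrite -exprnP; have iE : 'i ^+ k =
    ((~~ odd k)%:R * (-1) ^+ k./2)%:C + 'i * ((odd k)%:R * (-1) ^+ k.-1./2)%:C :> R[i].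
  rewrite -[in LHS](odd_double_half k) exprD -mul2n exprM sqr_i.
  have pow1 m : ((-1) ^+ m : R)%:C = (-1) ^+ m :> R[i] by rewrite rmorphXn rmorphN1.
  case ok: (odd k); rewrite /= ?mul1r ?mul0r ?expr0 ?expr1 ?mul1r.
    have -> : k.-1./2 = k./2 by rewrite -[in LHS](odd_double_half k) ok /= doubleK.
    by rewrite rmorph0 add0r pow1.
  by rewrite rmorph0 mulr0 addr0 pow1.
rewrite iE !rmorphM /= !(fmorphV (real_complex R)) /= !rmorphXn /= !rmorph_nat; ring.
Qed.

(** The exponential of [x + i y] is the Cauchy product of the real exponential
    series at [x] and of the series of [cos y + i sin y]. *)
Lemma cexp_series z : `|z| <= 8%:R^-1 ->
  series (fun k => z ^+ k / k`!%:R) @ \oo --> (cexp z : C).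
Proof.
case: z => x y; have normE (a b : R) : `|a +i* b| = (Num.sqrt (a ^+ 2 + b ^+ 2))%:C.
  by rewrite normc_def.
move=> z8; have small (a : R[i]) : `|a| <= 8%:R^-1 -> forall k, `|a ^+ k / k`!%:R| <= 1 * 8%:R ^- k.
  move=> a8 k; rewrite mul1r normrM normrX normfV normr_nat -exprVn.
  rewrite -[leRHS]mulr1 ler_pM ?exprn_ge0 ?invr_ge0 //.
    exact: ler_expr.
  by rewrite invf_le1 ?ltr0n ?fact_gt0 // ler1n fact_gt0.
have x8 : `|x%:C| <= 8%:R^-1.
  apply: le_trans z8; rewrite !normE lecR ler_wsqrtr // expr0n addr0 lerDl sqr_ge0.
  by [].
have y8 : `|'i * y%:C| <= 8%:R^-1.
  apply: le_trans z8; rewrite (_ : 'i * y%:C = 0 +i* y); last by simpc.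
  by rewrite !normE lecR ler_wsqrtr // expr0n add0r lerDr sqr_ge0.
rewrite -[cexp _]/((expR x)%:C * (cos y +i* sin y)).
rewrite (_ : (fun k => _) = @conv (R[i] : numFieldType) (fun k => x%:C ^+ k / k`!%:R)
  (fun k => ('i * y%:C) ^+ k / k`!%:R)).
  exact: (@cvg_series_conv (R[i] : numFieldType) complex_arch _ _ 1 1 _ _
    (small _ x8) (small _ y8) (@expR_series x) (@exp_imaginary_series y)).
apply/funext => n; rewrite /conv.
rewrite [x +i* y]complexE /= addrC exprDn mulr_suml; apply: eq_bigr => i _.
have i_n : (i <= n)%N by rewrite -ltnS.
have n0 k : k`!%:R != 0 :> R[i] by rewrite pnatr_eq0 -lt0n fact_gt0.
rewrite -(bin_fact i_n) !natrM -mulr_natr.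
have b0 : 'C(n, i)%:R != 0 :> R[i] by rewrite pnatr_eq0 -lt0n bin_gt0.
by field; rewrite !n0 b0.
Qed.

Lemma germ_cexp (alpha beta : R[i]) :
  @germ (R[i] : numFieldType) (fun h => cexp (alpha * h + beta)).
Proof.
have := germM complex_arch (@germ_cst (R[i] : numFieldType) (cexp beta)) _; rewrite /=.
move=> /(_ (fun h => cexp (alpha * h))); set P := (P in (P -> _) -> _).
suff gP : P.
  by move=> /(_ gP); congr germ; apply/funext => h; rewrite addrC cexpD.
pose q := `|alpha| + 1; have q0 : 0 < q by rewrite ltr_wpDl.
exists (fun k => alpha ^+ k / k`!%:R), 1, q, (8%:R * q)^-1.
split; first by split; rewrite ?invr_gt0 ?mulr_gt0.
split=> [k|h hq].
  rewrite mul1r normrM normrX normfV normr_nat -[leRHS]mulr1 ler_pM ?exprn_ge0 ?invr_ge0 //.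
    by apply: ler_expr; rewrite // lerDl.
  by rewrite invf_le1 ?ltr0n ?fact_gt0 // ler1n fact_gt0.
have -> : (fun k => alpha ^+ k / k`!%:R * h ^+ k) = fun k => (alpha * h) ^+ k / k`!%:R.
  by apply/funext => k; rewrite exprMn mulrAC.
apply: cexp_series; rewrite normrM; move: hq; rewrite invfM => hq.
apply: (@le_trans _ _ (q * `|h|)); first by rewrite ler_wpM2r // lerDl.
by rewrite mulrC -ler_pdivlMr // ltW.
Qed.

End MeromorphicContinuation.

(** * Rational continuation and its poles *)

Section GoodSeries.
Variables (C : numFieldType) (p : nat).
Local Open Scope classical_set_scope.
Implicit Types (u : nat -> C) (z l : C).

Definition denominator (fs : seq (nat * nat)) z : C :=
  \prod_(f <- fs) (1 - (p ^ f.1)%:R * z ^+ f.2).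

Lemma series_strip f u z l : series (fun n => u n * z ^+ n) @ \oo --> l ->
  series (fun n => strip p f u n * z ^+ n) @ \oo --> (1 - (p ^ f.1)%:R * z ^+ f.2) * l.
Proof.
case: f => a b /= ul; set U := fun n => u n * z ^+ n in ul.
have shift n : series (fun k => delay b u k * z ^+ k) n = z ^+ b * series U (n - b)%N.
  rewrite /series /=; have [bn|nb] := leqP b n; last first.
    have -> : (n - b = 0)%N by lia.
    rewrite [X in _ * X]big_geq // mulr0 big_nat_cond big1 // => k /andP[/andP[_ kn] _].
    by rewrite /delay ifF ?mul0r //; lia.
  rewrite (@big_cat_nat _ _ _ b) //= big_nat_cond big1 ?add0r => [|k /andP[/andP[_ kb] _]].
    rewrite -{1}[b]add0n big_addn big_distrr; apply: eq_bigr => k _ /=.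
    by rewrite /delay leq_addl addnK /U exprD mulrA mulrC.
  by rewrite /delay ifF ?mul0r //; lia.
have shift_cvg : (fun n => series U (n - b)%N) @ \oo --> l.
  rewrite -(cvg_shiftn b) (_ : (fun n => _) = series U) //.
  by apply/funext => n; rewrite addnK.
rewrite (_ : series _ = fun n => series U n - (p ^ a)%:R * z ^+ b * series U (n - b)%N).
  rewrite mulrBl mul1r; apply: cvgB => //; apply: cvgM => //; exact: cvg_cst.
apply/funext => n; rewrite -mulrA -shift /series /= big_distrr -sumrB.
by apply: eq_bigr => k _; rewrite /strip /U mulrBl /= !mulrA.
Qed.

(** Each denominator that is stripped multiplies the sum of the power series by its
    value, until a polynomial is left. *)
Lemma good_series u : good p u -> exists fs M (w : nat -> C), all half_slope fs /\
  forall z l, series (fun n => u n * z ^+ n) @ \oo --> l ->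
    denominator fs z * l = \sum_(n < M) w n * z ^+ n.
Proof.
move=> [fs fsP [M wM]]; exists fs, M, (foldr (@strip p C) u fs); split=> // z l ul.
have strip_l : series (fun n => foldr (@strip p C) u fs n * z ^+ n) @ \oo --> denominator fs z * l.
  rewrite /denominator; elim: fs {fsP wM} => [|f fs IHfs]; first by rewrite big_nil mul1r.
  by rewrite big_cons -mulrA; apply: series_strip.
have := @cvg_series_finite C (fun n => foldr (@strip p C) u fs n * z ^+ n) M.
move=> /(_ (fun n Mn => etrans (congr1 ( *%R^~ _) (wM n Mn)) (mul0r _))).
exact: cvg_unique strip_l.
Qed.

(** The terms of the series at one point of the punctured disc tend to zero, whence
    the geometric bound on the coefficients. *)
Lemma laurent_germ F w N (c : nat -> C) : laurent_expansion F w N c ->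
  germ (fun h => if h == 0 then c 0%N else h ^+ N * F (w + h)).
Proof.
move=> [r r0 cF]; pose h0 := r / 2%:R.
have h0_gt0 : 0 < h0 by rewrite divr_gt0.
have h0_lt : h0 < r by rewrite ltr_pdivrMr // mulr_natr mulr2n ltrDl.
have hE h : w + h - w = h by rewrite addrC addKr.
have norm_h0 : `|h0| = h0 by rewrite ger0_norm // ltW.
have h0r : 0 < `|w + h0 - w| < r by rewrite hE norm_h0 h0_gt0.
have := cF _ h0r; rewrite hE => S0.
have : (fun k => c k * h0 ^+ k) @ \oo --> (0 : C).
  exact: cvg_series_cvg_0 (cvgP _ S0).
move=> /cvgr0Pnorm_lt /(_ 1 ltr01)[n0 _ n0P].
pose B := 1 + \sum_(k < n0) `|c k * h0 ^+ k|.
have B0 : 0 < B by rewrite ltr_pwDl // sumr_ge0.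
exists c, B, (h0^-1), r; split; [by split; rewrite ?invr_gt0|split].
  move=> k; rewrite exprVn ler_pdivlMr ?exprn_gt0 // -{1}norm_h0 -normrX -normrM /B.
  have [n0k|kn0] := leqP n0 k.
    by rewrite (le_trans (ltW (n0P k n0k))) // lerDl sumr_ge0.
  rewrite (bigD1 (Ordinal kn0)) //= addrCA lerDl addr_ge0 // sumr_ge0 //.
move=> h hr; case: eqP => [->|/eqP h_neq0].
  have := @cvg_series_finite C (fun k => c k * 0 ^+ k) 1; rewrite big_ord1 expr0 mulr1; apply.
  by case=> // n _; rewrite exprS mul0r mulr0.
by have := cF (w + h); rewrite hE; apply; rewrite normr_gt0 h_neq0.
Qed.

End GoodSeries.

Section IdentityTheorem.
Variable R : realType.
Local Open Scope complex_scope.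
Local Notation C := (R[i] : numFieldType).
Implicit Types (s w z h : R[i]) (F G Q : R[i] -> R[i]).

Definition entire G : Prop := forall w, @germ C (fun h => G (w + h)).

Definition vanishes_around (P : R[i] -> Prop) w : Prop :=
  exists r, 0 < r /\ forall h, 0 < `|h| < r -> P (w + h).

Section Continuation.
Variables (F G Q : R[i] -> R[i]) (sigma : R).
Hypotheses (Fmero : @meromorphic C F) (Gent : entire G) (Qent : entire Q).
Hypothesis GFQ : forall s, sigma < complex.Re s -> G s * F s = Q s.

Let P z : Prop := G z * F z = Q z.

(** The difference of the two sides is analytic near [w] and has accumulating
    zeros. *)
Lemma laurent_relation w N c : @laurent_expansion C F w N c ->
    (forall e, 0 < e -> exists h, 0 < `|h| < e /\ P (w + h)) ->
  exists r, 0 < r /\ forall h, `|h| < r ->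
    G (w + h) * (if h == 0 then c 0%N else h ^+ N * F (w + h)) = h ^+ N * Q (w + h).
Proof.
move=> cF zeros; pose f h : R[i] := if h == 0 then c 0%N else h ^+ N * F (w + h).
pose psi h : R[i] := G (w + h) * f h + (-1 * h ^+ N) * Q (w + h).
have psi_germ : @germ C psi.
  apply: germD; apply: (germM (@complex_arch R)); [exact: Gent|exact: laurent_germ| |exact: Qent].
  exact: germ_monomial.
have [|r [r0 psi0]] := @germ_isolated_zeros C psi psi_germ.
  move=> e /zeros[h [/andP[h0 he] hP]]; exists h; split=> //.
  have h_neq0 : h != 0 by rewrite -normr_gt0.
  by rewrite /psi /f (negPf h_neq0) -hP; ring.
exists r; split=> // h /psi0; rewrite /psi /f mulN1r mulNr => /eqP.
by rewrite subr_eq0 => /eqP.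
Qed.

Lemma vanishes_around_limit w :
  (forall e, 0 < e -> exists h, 0 < `|h| < e /\ P (w + h)) -> vanishes_around P w.
Proof.
move=> zeros; have [N [c cF]] := Fmero w.
have [r [r0 rel]] := laurent_relation cF zeros; exists r; split=> // h /andP[h0 hr].
have h_neq0 : h != 0 by rewrite -normr_gt0.
have := rel h hr; rewrite (negPf h_neq0) mulrCA => /mulfI; apply.
by rewrite expf_neq0.
Qed.

Lemma real_norm (x : R) : `|x%:C| = `|x|%:C :> R[i].
Proof. by rewrite normc_def /= expr0n addr0 sqrtr_sqr. Qed.

Lemma gt0_complex (e : R[i]) : 0 < e -> exists2 x : R, e = x%:C & 0 < x.
Proof. by case: e => a b; rewrite ltcE /= => /andP[/eqP -> a0]; exists a. Qed.

(** Moving to the left from the half-plane of convergence, the relation cannot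
    stop holding at a last point, as it would hold at points accumulating there. *)
Lemma vanishes_everywhere s : vanishes_around P s.
Proof.
pose bad := [set x : R | 0 <= x /\ ~ vanishes_around P (s + x%:C)]%classic.
have far x : sigma < complex.Re s + x -> vanishes_around P (s + x%:C).
  move=> sx; exists (complex.Re s + x - sigma)%:C; split; first by rewrite ltcR subr_gt0.
  move=> h /andP[_ hr]; apply: GFQ; rewrite !raddfD /=.
  have : `|complex.Re h| < complex.Re s + x - sigma.
    by rewrite -ltcR (le_lt_trans (normc_ge_Re h)).
  by rewrite ltr_norml => /andP[]; lra.
apply: contrapT => bad_s.
have bad0 : bad 0 by split; rewrite ?addr0.
have bad_ub : has_sup bad.
  split; first by exists 0.
  exists (`|sigma - complex.Re s|) => x [x0 xbad]; rewrite leNgt; apply/negP => xbig.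
  apply: xbad; apply: far; have := ler_norm (sigma - complex.Re s); lra.
pose t := sup bad; have t0 : 0 <= t by apply: sup_upper_bound.
have above x : t < x -> vanishes_around P (s + x%:C).
  move=> tx; apply: contrapT => xbad.
  have : x <= t by apply: sup_upper_bound => //; split=> //; lra.
  lra.
have [r [r0 rP]] : vanishes_around P (s + t%:C).
  apply: vanishes_around_limit => _ /gt0_complex[e -> e0].
  have [r1 [r10 r1P]] : vanishes_around P (s + (t + e / 2)%:C) by apply: above; lra.
  have e4_gt0 : 0 < (e / 4%:R)%:C :> R[i] by rewrite ltcR; lra.
  have [c [c0 cr1 ce]] := common_radius r10 e4_gt0.
  have [d dE d0] := gt0_complex c0; rewrite dE in c0 cr1 ce.
  have de : d <= e / 4%:R by rewrite -lecR.
  have d2_gt0 : 0 < d / 2%:R by lra.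
  have e2_gt0 : 0 < e / 2%:R + d / 2%:R by lra.
  exists (e / 2%:R + d / 2%:R)%:C; rewrite real_norm gtr0_norm // !ltcR e2_gt0 /=.
  split; first by lra.
  have d2_lt : (d / 2%:R)%:C < r1 by rewrite (lt_le_trans _ cr1) // ltcR; lra.
  have := r1P (d / 2%:R)%:C; rewrite real_norm gtr0_norm // d2_lt ltcR d2_gt0.
  move=> /(_ isT); congr P; rewrite -!addrA; congr (s + _).
  by rewrite -!rmorphD /=; congr _%:C; ring.
have [rho rE rho0] := gt0_complex r0; rewrite {r r0}rE in rP.
have : t <= t - rho; last by lra.
apply: ge_sup; first by exists 0.
move=> x x_bad; have xt : x <= t by apply: sup_upper_bound.
rewrite leNgt; apply/negP => tx; case: x_bad => _; apply.
have [->|xt_neq] := eqVneq x t; first by exists rho%:C; split=> //; rewrite ltcR.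
have xt_lt : x < t by rewrite lt_neqAle xt_neq.
pose d := Num.min (t - x) (rho - (t - x)).
have d0 : 0 < d by rewrite lt_min; apply/andP; split; lra.
exists d%:C; split=> [|h /andP[h0 hd]]; first by rewrite ltcR.
have -> : s + x%:C + h = s + t%:C + ((x - t)%:C + h).
  by rewrite rmorphB /=; ring.
have norm_xt : `|(x - t)%:C| = (t - x)%:C by rewrite real_norm ltr0_norm ?opprB // subr_lt0.
apply: rP; apply/andP; split.
  rewrite (lt_le_trans _ (lerB_normD _ _)) // norm_xt subr_gt0 (lt_le_trans hd) // lecR.
  by rewrite ge_min lexx.
rewrite (le_lt_trans (ler_normD _ _)) // norm_xt -ltrBrDl (lt_le_trans hd) // -rmorphB lecR.
by rewrite ge_min lexx orbT.
Qed.

(** Multiplied by [h ^ N], the relation [G F = Q] extends by continuity to the pole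
    [h = 0], where it reads [G(s) c_0 = 0]. *)
Theorem pole_root s : @pole C F s -> G s = 0.
Proof.
move=> [N [c [N0 c0 cF]]]; have [r [r0 rP]] := vanishes_everywhere s.
have [|r1 [r10 rel]] := laurent_relation cF.
  move=> e e0; have [d [d0 de dr]] := common_radius e0 r0.
  have d2 : `|d / 2%:R| = d / 2%:R by rewrite ger0_norm // divr_ge0 // ltW.
  have d2_lt : d / 2%:R < d by rewrite ltr_pdivrMr // mulr_natr mulr2n ltrDl.
  have d2_gt0 : 0 < d / 2%:R by rewrite divr_gt0.
  exists (d / 2%:R); rewrite d2 d2_gt0 (lt_le_trans d2_lt) //; split=> //.
  by apply: rP; rewrite d2 d2_gt0 (lt_le_trans d2_lt).
have := rel 0; rewrite normr0 r10 eqxx expr0n eqn0Ngt N0 => /(_ isT).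
rewrite mul0r addr0 => /eqP; rewrite mulf_eq0 (negPf c0) orbF => /eqP.
exact.
Qed.

End Continuation.
End IdentityTheorem.

(** * Poles of the zeta function *)

Section ScaledLieAlgebra.
Variables (p : nat) (p_prime : prime p) (L : lieAlgType (padicInt p)) (i : nat).
Local Notation Zp := (padicInt p).

Lemma scaled_free : free_of_rank L 3 -> free_of_rank (scaledLie L (p%:R ^+ i)) 3.
Proof.
move=> [e eP]; have multiple_e j : @multiple _ L (p%:R ^+ i) (p%:R ^+ i *: e j).
  by apply/asboolP; exists (e j).
pose e' j : scaledLie L (p%:R ^+ i) := Sub (p%:R ^+ i *: e j) (multiple_e j).
have valE (c : 'rV[Zp]_3) : val (\sum_j c 0 j *: e' j) = \sum_j (p%:R ^+ i * c 0 j) *: e j.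
  rewrite raddf_sum; apply: eq_bigr => j _.
  by rewrite /= scalerA mulrC.
exists e' => x; have /asboolP[y yE] := valP x; have [c [cE c_uniq]] := eP y.
exists c; split=> [|c' c'E].
  apply: val_inj; rewrite valE yE {1}cE scaler_sumr.
  by apply: eq_bigr => j _; rewrite scalerA.
have [d [_ d_uniq]] := eP (val x).
have c1 : d = \row_j (p%:R ^+ i * c 0 j).
  apply: d_uniq; rewrite yE {1}cE scaler_sumr.
  by apply: eq_bigr => j _; rewrite scalerA mxE.
have c2 : d = \row_j (p%:R ^+ i * c' 0 j).
  by apply: d_uniq; rewrite c'E valE; apply: eq_bigr => j _; rewrite mxE.
apply/rowP => j; apply: (@pexp_inj _ p_prime i) => /=.
by have /rowP/(_ j) := etrans (esym c1) c2; rewrite !mxE.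
Qed.

End ScaledLieAlgebra.

Section PolesOfDenominator.
Variables (R : realType) (p : nat) (p_prime : prime p).
Local Open Scope complex_scope.
Local Notation C := (R[i] : numFieldType).

Lemma germ_nat_cpow w : @germ C (fun h => nat_cpow p (- (w + h))).
Proof.
have := germ_cexp (- (ln p%:R)%:C) (- w * (ln p%:R)%:C); congr germ.
by apply/funext => h; rewrite /nat_cpow; congr cexp; ring.
Qed.

Lemma entire_denominator fs : entire (fun s => @denominator C p fs (nat_cpow p (- s))).
Proof.
move=> w; rewrite /denominator; elim: fs => [|f fs IHfs].
  by have := @germ_cst C 1; congr germ; apply/funext => h; rewrite big_nil.
have factor : @germ C (fun h => 1 + - (p ^ f.1)%:R * nat_cpow p (- (w + h)) ^+ f.2).
  apply: germD; first exact: germ_cst.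
  apply: (germM (@complex_arch R)); first exact: germ_cst.
  by apply: (germX (@complex_arch R)); apply: germ_nat_cpow.
have := germM (@complex_arch R) factor IHfs; congr germ.
by apply/funext => h; rewrite big_cons mulNr.
Qed.

Lemma entire_numerator M (w : nat -> R[i]) :
  entire (fun s => \sum_(n < M) w n * nat_cpow p (- s) ^+ n).
Proof.
move=> s; elim: M => [|M IHM].
  by have := @germ_cst C 0; congr germ; apply/funext => h; rewrite big_ord0.
have term : @germ C (fun h => w M * nat_cpow p (- (s + h)) ^+ M).
  apply: (germM (@complex_arch R)); first exact: germ_cst.
  by apply: (germX (@complex_arch R)); apply: germ_nat_cpow.
have := germD IHM term; congr germ.
by apply/funext => h; rewrite big_ord_recr.
Qed.

Lemma norm_cexp (z : R[i]) : `|cexp z| = (expR (complex.Re z))%:C.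
Proof.
rewrite /cexp normrM real_norm (ger0_norm (expR_ge0 _)).
by rewrite normc_def /= cos2Dsin2 sqrtr1 mulr1.
Qed.

(** If [p^(a - b s) = 1], taking absolute values gives [a = b Re s]. *)
Lemma denominator_root fs s : all half_slope fs ->
  @denominator C p fs (nat_cpow p (- s)) = 0 -> complex.Re s \in [:: 0; 1 / 2; 1; 3 / 2; 2].
Proof.
move=> fsP /eqP; rewrite /denominator prodf_seq_eq0 => /hasP[[a b] /(allP fsP)].
move=> /andP[b0 /mapP[k k5 /= ab]]; rewrite subr_eq0 => /eqP /= root.
have p0 : 0 < p%:R :> R by rewrite ltr0n prime_gt0.
have ln_p : 0 < ln p%:R :> R by rewrite ln_gt0 // ltr1n prime_gt1.
have : 1 = expR (a%:R * ln p%:R - b%:R * (complex.Re s * ln p%:R)).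
  apply: (@complexI R); have /(congr1 (fun z : R[i] => `|z|)) := root.
  rewrite normr1 normrM normrX /nat_cpow norm_cexp normr_nat rmorph1 => ->.
  have -> : complex.Re (- s * (ln p%:R)%:C) = - (complex.Re s * ln p%:R).
    by case: (s) => x y /=; ring.
  rewrite expRD expRM_natl lnK ?posrE // -(mulrN b%:R) expRM_natl.
  by rewrite rmorphM !rmorphXn /= rmorph_nat.
move=> /(congr1 (@ln R))/esym/eqP; rewrite expRK ln1 mulrA -mulrBl mulf_eq0 (gt_eqF ln_p) orbF.
rewrite subr_eq0 => /eqP abs.
have b_neq0 : b%:R != 0 :> R by rewrite pnatr_eq0 -lt0n.
have -> : complex.Re s = k%:R / 2%:R.
  apply: (mulfI b_neq0); rewrite -abs mulrA -natrM mulnC -ab natrM.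
  by rewrite mulrC mulKf ?pnatr_eq0.
move: k5; rewrite /= !inE => /or4P[/eqP->|/eqP->|/eqP->|/orP[/eqP->|/eqP->]].
- by rewrite mul0r eqxx.
- by rewrite eqxx orbT.
- by rewrite divff ?pnatr_eq0 // eqxx !orbT.
- by rewrite eqxx !orbT.
by rewrite (_ : 4%:R / 2%:R = 2%:R) ?eqxx ?orbT //; field.
Qed.

End PolesOfDenominator.

Theorem corollary1p2 (R : realType) (p : nat) (p_prime : prime p)
    (L : lieAlgType (padicInt p)) (L_rank3 : free_of_rank L 3) (i : nat)
    (zeta : R[i] -> R[i])
    (zeta_cont : zeta_continuation (scaledLie L (p%:R ^+ i)) zeta)
    (s : R[i]) (s_pole : pole zeta s) :
  complex.Re s \in [:: 0; 1 / 2; 1; 3 / 2; 2].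
Proof.
have [E [C frames]] := rotated_frames_of_free (scaled_free p_prime i L_rank3).
have [fs [M [w [fsP rational]]]] := good_series (good_card_data p_prime (R[i] : numFieldType) E C).
have [zeta_mero [sigma zeta_sigma]] := zeta_cont.
apply: (denominator_root p_prime fsP).
apply: (@pole_root R zeta (fun s => denominator p fs (nat_cpow p (- s)))
  (fun s => \sum_(n < M) w n * nat_cpow p (- s) ^+ n) sigma) s_pole => //.
- exact: entire_denominator.
- exact: entire_numerator.
move=> z /zeta_sigma/(zeta_sum_series p_prime frames).
exact: rational.
Qed.
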